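(* The map $\Psi:=\mu\circ(\int\otimes\int)\circ\Delta:(\mathcal{MH}_\Lambda(\mathcal{A}),\star)\longrightarrow(\mathcal{T}_\Lambda,\star)$ is a homomorphism of algebras. Moreover, for any $\alpha\in\mathbb{Z}^n$, $M\in\mathcal{A}$ and $P\in\mathscr{P}$, $$\Psi(K_\alpha)=X^{\widetilde{\alpha}}\quad\text{and}\quad\Psi(\mathbb{X}_{M\oplus P[1]})=\sum_{\mathbf e}v^{\langle\mathbf p-\mathbf e,\mathbf m-\mathbf e\rangle}|\mathrm{Gr}_{\mathbf e}M|\,X^{\widetilde E'(\mathbf p-\mathbf e)-\widetilde E(\mathbf m-\mathbf e)},$$ where $\mathbf m,\mathbf p$ are the dimension vectors of $M,P$ and $\mathrm{Gr}_{\mathbf e}M$ is the set of all submodules of $M$ of dimension vector $\mathbf e$.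
   Context: Setting. Let $k=\mathbb{F}_q$, $v=\sqrt q$; tensor products are over $\mathbb{Z}[v,v^{-1}]$. Let $Q$ be a finite acyclic valued quiver with vertices $1,\dots,n$ and valuations $d_1,\dots,d_n$; let $m=2n$ and let $\widetilde Q$ be a valued quiver obtained from $Q$ by attaching additional vertices $n+1,\dots,m$ (so $Q$ is the full subquiver on $1,\dots,n$). Let $\mathfrak S$, $\widetilde{\mathfrak S}$ be the $k$-species associated to $Q$, $\widetilde Q$, identified with their tensor algebras; $\mathfrak S$ is a finite dimensional hereditary $k$-algebra. Let $S_i$ be the $i$-th simple $\widetilde{\mathfrak S}$-module, $\mathcal D_i=\operatorname{End}_{\widetilde{\mathfrak S}}(S_i)$, of $k$-dimension $d_i$. Let $\widetilde R,\widetilde R'$ be the $m\times n$ matrices with entries $r_{ij}=\dim_{\mathcal D_i}\operatorname{Ext}^1_{\widetilde{\mathfrak S}}(S_j,S_i)$ and $r'_{ij}=\dim_{\mathcal D_i^{op}}\operatorname{Ext}^1_{\widetilde{\mathfrak S}}(S_i,S_j)$; let $\widetilde I$ be the left $m\times n$ submatrix of $I_m$; put $\widetilde B=\widetilde R'-\widetilde R$, $\widetilde E=\widetilde I-\widetilde R'$, $\widetilde E'=\widetilde I-\widetilde R$. Assume $\Lambda$ is a skew-symmetric integral $m\times m$ matrix with $\Lambda(-\widetilde B)=\binom{D_n}{0}$, $D_n=\mathrm{diag}(d_1,\dots,d_n)$; also write $\Lambda(\cdot,\cdot)$ for the associated skew-symmetric bilinear form on $\mathbb{Z}^m$. For $\alpha\in\mathbb{Z}^n$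 put $\widetilde\alpha=\binom{\mathbf 0}{\alpha}$, $\bar\alpha=\binom{\alpha}{\mathbf 0}\in\mathbb{Z}^{2n}$. Hall algebra of morphisms. $\mathcal{A}$ is the category of finite dimensional left $\mathfrak S$-modules, $\mathscr P$ its projectives; $K(\mathcal A)=\mathbb{Z}^n$ via dimension vectors (coordinates in the basis of simples); boldface lowercase letters denote dimension vectors of the modules named by the corresponding capital letters. $\langle M,N\rangle=\dim_k\operatorname{Hom}(M,N)-\dim_k\operatorname{Ext}^1(M,N)$ induces the Euler form on $\mathbb{Z}^n$; $(\alpha,\beta)=\langle\alpha,\beta\rangle+\langle\beta,\alpha\rangle$. $F_{MN}^L=|\{N'\subset L:N'\cong N,L/N'\cong M\}|$. $C_2(\mathscr P)$ is the category of morphisms $M_\bullet=(M_{-1}\to M_0)$ in $\mathscr P$ (morphisms: commutative squares), with $\langle M_\bullet,N_\bullet\rangle=\dim_k\operatorname{Hom}(M_\bullet,N_\bullet)-\dim_k\operatorname{Ext}^1(M_\bullet,N_\bullet)$. $\mathcal H_{\rm tw}(C_2(\mathscr P))$ is the free $\mathbb{Z}[v,v^{-1}]$-module on isomorphism classes $[M_\bullet]$ with $[M_\bullet]\ast[N_\bullet]=q^{\langle M_\bullet,N_\bullet\rangle}\sum_{[L_\bullet]}\frac{|\operatorname{Ext}^1(M_\bullet,N_\bullet)_{L_\bullet}|}{|\operatorname{Hom}(M_\bullet,N_\bullet)|}[L_\bullet]$, the subscript $L_\bullet$ denoting extensions with middle term isomorphic to $L_\bullet$. Put $K_P=(P\xrightarrow{1}P)$,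 $Z_P=(P\to0)$ for $P\in\mathscr P$, and $C_M=(\Omega_M\xrightarrow{\delta_M}P_M)$ for a minimal projective resolution $0\to\Omega_M\xrightarrow{\delta_M}P_M\to M\to0$. $\mathcal{MH}(\mathcal A)$ is the localization of $\mathcal H_{\rm tw}(C_2(\mathscr P))$ at the (central) elements $[K_P]$. Put $K_\alpha=[K_P]\ast[K_Q]^{-1}$ if $\alpha=\hat P-\hat Q$ ($P,Q\in\mathscr P$), $\mathbb X_M=K_{-\hat P_M}\ast[C_M]$, $\mathbb X_{P[1]}=[Z_P]$, $\mathbb X_{M\oplus P[1]}=\mathbb X_M\ast\mathbb X_{P[1]}$. The elements $K_\alpha\ast\mathbb X_{M\oplus P[1]}$ form a basis of $\mathcal{MH}(\mathcal A)$. $\mathcal{MH}_\Lambda(\mathcal A)$ is the same module with $$(K_\alpha\ast\mathbb X_{M\oplus P[1]})\star(K_\beta\ast\mathbb X_{N\oplus Q[1]})=v^{\Lambda(\widetilde E'(\mathbf m-\mathbf p)-\widetilde\alpha,\,\widetilde E'(\mathbf n-\mathbf q)-\widetilde\beta)}(K_\alpha\ast\mathbb X_{M\oplus P[1]})\ast(K_\beta\ast\mathbb X_{N\oplus Q[1]}).$$ Maps. (i) $\Delta$ is the linear map $\mathcal{MH}_\Lambda(\mathcal A)\to\mathcal{MH}(\mathcal A)\otimes\mathcal{MH}(\mathcal A)$, $\Delta(K_\alpha\ast\mathbb X_{L\oplus P[1]})=\sum_{[M],[N]}q^{\langle\hat M,\hat N-\hat P\rangle}F_{MN}^L(\mathbb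 X_M\otimes K_\alpha\ast\mathbb X_{N\oplus P[1]})$. (ii) $\mathcal T$ is the free $\mathbb{Z}[v,v^{-1}]$-module with basis $X^\alpha$, $\alpha\in\mathbb{Z}^{2n}$, and $\int:\mathcal{MH}(\mathcal A)\to\mathcal T$ is the linear map $K_\alpha\ast[M_\bullet]\mapsto X^{\widetilde\alpha+\mathbf{dim}\,M_\bullet}$ with $\mathbf{dim}\,M_\bullet=\binom{\mathbf{dim}\,M_0-\mathbf{dim}\,M_{-1}}{\mathbf{dim}\,M_0}$; in particular $\int K_\alpha\ast\mathbb X_{M\oplus P[1]}=X^{\widetilde\alpha+\bar{\mathbf m}-\bar{\mathbf p}}$. (iii) $\mathcal T_\Lambda$ is the $\mathbb{Z}[v,v^{-1}]$-algebra with basis $X^\alpha$, $\alpha\in\mathbb{Z}^m$, and $X^\alpha\star X^\beta=v^{\Lambda(\alpha,\beta)}X^{\alpha+\beta}$; $\mu:\mathcal T\otimes\mathcal T\to\mathcal T_\Lambda$ is the linear map $\mu(X^{\binom{\alpha_1}{\alpha_2}}\otimes X^{\binom{\beta_1}{\beta_2}})=v^{-(\alpha_1,\beta_1)-\langle\alpha_1,\beta_1\rangle}X^{-\widetilde E\alpha_1-\widetilde E'\beta_1+\widetilde\alpha_2+\widetilde\beta_2}$, $\alpha_i,\beta_i\in\mathbb{Z}^n$. *)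

(* Defs.v *)
From HB Require Import structures.
From mathcomp Require Import all_boot all_order all_algebra all_field.
From mathcomp Require Import boolp classical_sets functions cardinality fsbigop.
From mathcomp Require Import finmap.
From mathcomp Require Import monalg.

Set Implicit Arguments.
Unset Strict Implicit.
Unset Printing Implicit Defensive.

Import Order.TTheory GRing.Theory Num.Theory.

Local Open Scope ring_scope.

Section Coefficients.
(* Z[v, v^-1] with v = sqrt #|F|, as a subring of algC *)
Variable F : finFieldType.

Definition vC : algC := sqrtC (#|F|%:R).

Definition Zv_pred : {pred algC} := fun x =>
  `[< exists (p : {poly int}) (k : nat),
        x = (map_poly intr p).[vC] / vC ^+ k >].

Lemma vC_neq0 : vC != 0.
Proof.
rewrite /vC sqrtC_eq0 pnatr_eq0 -lt0n.
by apply/card_gt0P; exists 0.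
Qed.

Lemma Zv_subring : subring_closed Zv_pred.
Proof.
have v0 k : vC ^+ k != 0 by rewrite expf_neq0 ?vC_neq0.
split.
- by apply/asboolP; exists 1, 0%N; rewrite rmorph1 hornerE expr0 divr1.
- move=> x y /asboolP[p [k ->]] /asboolP[r [l ->]]; apply/asboolP.
  exists (p * 'X^l - r * 'X^k), (k + l)%N.
  rewrite rmorphB !rmorphM /= !map_polyXn hornerD hornerN !hornerM !hornerXn.
  by rewrite exprD -[in LHS]mulNr addf_div ?v0 // mulNr.
- move=> x y /asboolP[p [k ->]] /asboolP[r [l ->]]; apply/asboolP.
  exists (p * r), (k + l)%N.
  by rewrite rmorphM hornerM exprD mulf_div.
Qed.

HB.instance Definition _ := GRing.isSubringClosed.Build algC Zv_pred Zv_subring.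

Record Zv := MkZv { Zv_val : algC; Zv_valP : Zv_val \in Zv_pred }.
HB.instance Definition _ := [isSub for Zv_val].
HB.instance Definition _ := [Choice of Zv by <:].
HB.instance Definition _ := [SubChoice_isSubComNzRing of Zv by <:].

Definition Zv_unit : pred Zv := fun x => `[< exists y : Zv, y * x = 1 >].
Definition Zv_inv (x : Zv) : Zv := xget x [set y | y * x = 1]%classic.

Lemma Zv_mulVr : {in Zv_unit, left_inverse 1 Zv_inv *%R}.
Proof.
move=> x /asboolP ex; rewrite /Zv_inv.
exact: (@xgetPex _ x [set y | y * x = 1]%classic).
Qed.

Lemma Zv_unitP (x y : Zv) : y * x = 1 -> x \in Zv_unit.
Proof. by move=> yx; apply/asboolP; exists y. Qed.

Lemma Zv_inv_out : {in [predC Zv_unit], Zv_inv =1 id}.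
Proof.
move=> x; rewrite !inE => /asboolP nx; rewrite /Zv_inv.
by case: xgetP => // y _ yx; case: nx; exists y.
Qed.

HB.instance Definition _ :=
  GRing.ComNzRing_hasMulInverse.Build Zv Zv_mulVr Zv_unitP Zv_inv_out.

Lemma vC_Zv : vC \in Zv_pred.
Proof.
by apply/asboolP; exists 'X, 0%N; rewrite map_polyX hornerX expr0 divr1.
Qed.

Definition vv : Zv := MkZv vC_Zv.
Definition qq : Zv := #|F|%:R.

End Coefficients.

(* Vertices are 'I_n.  [sD i] is the division algebra K_i at the vertex i (a
   finite division algebra is a field), d_i = dim_k K_i, and [sM i j] is the
   K_i-K_j-bimodule, on which k acts centrally.  Multiple arrows between two
   vertices are summed up in [sM]. *)
Record species (F : finFieldType) (n : nat) := Species {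
  sD : 'I_n -> fieldExtType F;
  sM : 'I_n -> 'I_n -> vectType F;
  sl : forall i j, sD i -> sM i j -> sM i j;
  sr : forall i j, sM i j -> sD j -> sM i j;
  sl_linl : forall i j (m : sM i j) (c : F) (a b : sD i),
    sl (c *: a + b) m = c *: sl a m + sl b m;
  sl_linr : forall i j (a : sD i) (c : F) (m m' : sM i j),
    sl a (c *: m + m') = c *: sl a m + sl a m';
  sl1 : forall i j (m : sM i j), sl 1 m = m;
  slM : forall i j (a b : sD i) (m : sM i j), sl (a * b) m = sl a (sl b m);
  sr_linl : forall i j (m : sM i j) (c : F) (a b : sD j),
    sr m (c *: a + b) = c *: sr m a + sr m b;
  sr_linr : forall i j (a : sD j) (c : F) (m m' : sM i j),
    sr (c *: m + m') a = c *: sr m a + sr m' a;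
  sr1 : forall i j (m : sM i j), sr m 1 = m;
  srM : forall i j (a b : sD j) (m : sM i j), sr m (a * b) = sr (sr m a) b;
  slr : forall i j (a : sD i) (m : sM i j) (b : sD j),
    sl a (sr m b) = sr (sl a m) b
}.

Definition sub_species F n p (S : species F (n + p)) : species F n :=
  let l := @lshift n p in
  Species (fun i j => @sl_linl _ _ S (l i) (l j))
    (fun i j => @sl_linr _ _ S (l i) (l j))
    (fun i j => @sl1 _ _ S (l i) (l j)) (fun i j => @slM _ _ S (l i) (l j))
    (fun i j => @sr_linl _ _ S (l i) (l j))
    (fun i j => @sr_linr _ _ S (l i) (l j))
    (fun i j => @sr1 _ _ S (l i) (l j)) (fun i j => @srM _ _ S (l i) (l j))
    (fun i j => @slr _ _ S (l i) (l j)).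

(* There is an arrow j -> i exactly when the K_i-K_j-bimodule is nonzero. *)
Definition acyclic F n (S : species F n) : Prop :=
  forall s : seq 'I_n, s != [::] ->
    ~~ cycle (fun i j => \dim {:sM S i j} != 0%N) s.

Definition sdim F n (S : species F n) (i : 'I_n) : nat := \dim {:sD S i}.

Section Modules.
Variables (F : finFieldType) (n : nat) (S : species F n).

(* Generators of the tensor algebra: the elements of the K_i and of the
   bimodules, as a finite type. *)
Definition gens : finType :=
  ({i : 'I_n & finvect_type (sD S i)} +
   {ij : 'I_n * 'I_n & finvect_type (sM S ij.1 ij.2)})%type.

Definition gD (i : 'I_n) (a : sD S i) : gens :=
  inl (existT (fun i => finvect_type (sD S i)) i a).
Definition gM (i j : 'I_n) (m : sM S i j) : gens :=
  inr (existT (fun ij : 'I_n * 'I_n => finvect_type (sM S ij.1 ij.2)) (i, j) m).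

(* A k-space of column vectors with an operator for each generator. *)
Record rawmod := RawMod { rdim : nat; act : gens -> 'M[F]_rdim }.

(* By the universal property of the tensor algebra T_D(M), D = prod_i K_i and
   M = sum_(i,j) M_ij, a left T_D(M)-module is a k-space V with a unital
   k-algebra map D -> End V (given on the factors K_i, whose units go to
   orthogonal idempotents of sum 1) and a D-bimodule map M -> End V. *)
Record is_mod (X : rawmod) : Prop := IsMod {
  actD_lin : forall i (c : F) (a b : sD S i),
    act X (gD (c *: a + b)) = c *: act X (gD a) + act X (gD b);
  actDM : forall i (a b : sD S i),
    act X (gD (a * b)) = act X (gD a) *m act X (gD b);
  actD_ortho : forall i j (a : sD S i) (b : sD S j), i != j ->
    act X (gD a) *m act X (gD b) = 0;
  actD1 : \sum_i act X (gD (1 : sD S i)) = 1%:M;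
  actM_lin : forall i j (c : F) (m m' : sM S i j),
    act X (gM (c *: m + m')) = c *: act X (gM m) + act X (gM m');
  actM_l : forall i j (a : sD S i) (m : sM S i j),
    act X (gM (sl a m)) = act X (gD a) *m act X (gM m);
  actM_r : forall i j (m : sM S i j) (b : sD S j),
    act X (gM (sr m b)) = act X (gM m) *m act X (gD b)
}.

Record mod := Mod { mod_raw :> rawmod; modP : is_mod mod_raw }.

HB.instance Definition _ := gen_eqMixin mod.
HB.instance Definition _ := gen_choiceMixin mod.

Definition is_hom (X Y : rawmod) (f : 'M[F]_(rdim Y, rdim X)) : bool :=
  [forall g, f *m act X g == act Y g *m f].

Definition mx_inj m p (f : 'M[F]_(m, p)) : Prop :=
  injective (fun u : 'cV_p => f *m u).
Definition mx_surj m p (f : 'M[F]_(m, p)) : Prop :=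
  forall w : 'cV_m, exists u : 'cV_p, f *m u = w.

Definition mod_iso (X Y : rawmod) : Prop :=
  exists (f : 'M_(rdim Y, rdim X)) (g : 'M_(rdim X, rdim Y)),
    [/\ is_hom f, is_hom g, g *m f = 1%:M & f *m g = 1%:M].

Definition Hom (X Y : rawmod) : {set 'M[F]_(rdim Y, rdim X)} :=
  [set f | is_hom f]%SET.

(* As a k-space L is Y (+) X and the generators act by block triangular
   matrices; z is the off-diagonal block. *)
Local Notation coc X Y := {ffun gens -> 'M[F]_(rdim Y, rdim X)}.
Definition ext_mid (X Y : rawmod) (z : coc X Y) : rawmod :=
  RawMod (fun g => block_mx (act Y g) (z g) 0 (act X g)).
Definition Z1 (X Y : rawmod) : {set coc X Y} :=
  [set z : coc X Y | `[< is_mod (ext_mid z) >]]%SET.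
(* z and z' define equivalent extensions, through [1 h; 0 1], iff z - z' is
   one of these. *)
Definition B1 (X Y : rawmod) : {set coc X Y} :=
  [set [ffun g => act Y g *m h - h *m act X g] | h : 'M[F]_(rdim Y, rdim X)]%SET.

Definition dimHom (X Y : rawmod) : nat := \dim <<enum (Hom X Y)>>%VS.
Definition dimExt (X Y : rawmod) : nat :=
  (\dim <<enum (Z1 X Y)>>%VS - \dim <<enum (B1 X Y)>>%VS)%N.

Definition euler_mod (X Y : rawmod) : int := (dimHom X Y)%:Z - (dimExt X Y)%:Z.

(* Dimension of Ext^1(X, Y) = Z1 / B1 over the division algebra End(Y) acting
   by push-out, resp. over End(X)^op acting by pull-back: the cardinality of a
   basis. *)
Definition is_ext_ldim (X Y : rawmod) (r : nat) : Prop :=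
  exists z : 'I_r -> coc X Y, (forall k, z k \in Z1 X Y) /\
    forall x, x \in Z1 X Y -> exists! f : {ffun 'I_r -> 'M[F]_(rdim Y)},
      (forall k, f k \in Hom Y Y) /\
      x - [ffun g => \sum_k f k *m z k g] \in B1 X Y.
Definition is_ext_rdim (X Y : rawmod) (r : nat) : Prop :=
  exists z : 'I_r -> coc X Y, (forall k, z k \in Z1 X Y) /\
    forall x, x \in Z1 X Y -> exists! f : {ffun 'I_r -> 'M[F]_(rdim X)},
      (forall k, f k \in Hom X X) /\
      x - [ffun g => \sum_k z k g *m f k] \in B1 X Y.
Definition ext_ldim (X Y : rawmod) : nat :=
  xget 0%N [set r | is_ext_ldim X Y r]%classic.
Definition ext_rdim (X Y : rawmod) : nat :=
  xget 0%N [set r | is_ext_rdim X Y r]%classic.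

(* K_i acting on itself by multiplication, in a k-basis. *)
Definition regmx (i : 'I_n) (a : sD S i) : 'M[F]_(\dim {:sD S i}) :=
  \matrix_(r, c) coord (vbasis {:sD S i}) r (a * (vbasis {:sD S i})`_c).

Lemma regmx_lin i : linear (@regmx i).
Proof.
by move=> c a b; apply/matrixP=> r s; rewrite !mxE mulrDl -scalerAl linearP.
Qed.

Lemma regmxM i (a b : sD S i) : regmx (a * b) = regmx a *m regmx b.
Proof.
apply/matrixP=> r s; rewrite !mxE -mulrA.
rewrite {1}(coord_vbasis (memvf (b * (vbasis {:sD S i})`_s))).
rewrite mulr_sumr linear_sum; apply: eq_bigr=> k _; rewrite !mxE.
by rewrite -scalerAr linearZ /= mulrC.
Qed.

Lemma regmx1 i : regmx (1 : sD S i) = 1%:M.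
Proof.
apply/matrixP=> r s; rewrite !mxE mul1r.
by rewrite coord_free 1?eq_sym //; exact: basis_free (vbasisP _).
Qed.

(* S_i: K_i acts on itself, all K_j (j != i) and all bimodules act by 0. *)
Definition raw_simple (i : 'I_n) : rawmod :=
  RawMod (fun g : gens => match g with
    | inl u => untag 0 (fun a : finvect_type (sD S i) => regmx a) u
    | inr _ => 0
    end).

Lemma raw_simple_gD i (a : sD S i) : act (raw_simple i) (gD a) = regmx a.
Proof. by rewrite /raw_simple /= untagE. Qed.

Lemma raw_simple_gD0 i j (a : sD S j) :
  j != i -> act (raw_simple i) (gD a) = 0.
Proof. by move=> ne; rewrite /raw_simple /= untag_dflt. Qed.

Lemma raw_simple_mod i : is_mod (raw_simple i).
Proof.
split.
- move=> j c a b; have [e|ne] := eqVneq j i; last first.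
    by rewrite !raw_simple_gD0 // scaler0 addr0.
  by subst j; rewrite !raw_simple_gD regmx_lin.
- move=> j a b; have [e|ne] := eqVneq j i; last first.
    by rewrite !raw_simple_gD0 // mul0mx.
  by subst j; rewrite !raw_simple_gD regmxM.
- move=> j k a b ne; have [e|nj] := eqVneq j i; last first.
    by rewrite (raw_simple_gD0 a nj) mul0mx.
  by rewrite (raw_simple_gD0 b) ?mulmx0 // -e eq_sym.
- rewrite (bigD1 i) //= big1; last by move=> j ne; exact: raw_simple_gD0.
  by rewrite addr0 -[LHS]/(act (raw_simple i) (gD _)) raw_simple_gD regmx1.
- by move=> *; rewrite scaler0 addr0.
- by move=> *; rewrite mulmx0.
- by move=> *; rewrite mul0mx.
Qed.

Definition simple (i : 'I_n) : mod := Mod (raw_simple_mod i).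

Definition submod (X : rawmod) (U : {set 'cV[F]_(rdim X)}) : bool :=
  [&& 0 \in U,
      [forall u in U, forall w in U, u + w \in U],
      [forall c : F, forall u in U, c *: u \in U] &
      [forall g, forall u in U, act X g *m u \in U]].

(* The i-th coordinate of the class of a submodule U in K(A) is
   dim_(K_i) e_i U = (dim_k e_i U) / d_i, with e_i the unit of K_i. *)
Definition dimvec_sub (X : rawmod) (U : {set 'cV[F]_(rdim X)}) : 'cV[int]_n :=
  \col_i (\dim <<[seq act X (gD (1 : sD S i)) *m u | u in U]>>%VS
            %/ sdim S i)%N%:Z.
Definition dimvec (X : rawmod) : 'cV[int]_n := dimvec_sub [set: 'cV[F]_(rdim X)]%SET.

Definition euler (a b : 'cV[int]_n) : int :=
  \sum_i \sum_j a i 0 * b j 0 * euler_mod (simple i) (simple j).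
Definition seuler (a b : 'cV[int]_n) : int := euler a b + euler b a.

Definition Gr (X : rawmod) (e : 'cV[int]_n) : {set {set 'cV[F]_(rdim X)}} :=
  [set U : {set 'cV[F]_(rdim X)} | submod U && (dimvec_sub U == e)]%SET.

(* F_(MN)^L: N' = U is isomorphic to N when it is the image of an injection
   N -> L, and L / U is isomorphic to M when U is the kernel of a surjection
   L -> M. *)
Definition hallF (M N L : rawmod) : nat :=
  #|[set U : {set 'cV[F]_(rdim L)} | [&& submod U,
      `[< exists f : 'M[F]_(rdim L, rdim N), [/\ is_hom f, mx_inj f &
            U = [set f *m u | u : 'cV[F]_(rdim N)]%SET] >] &
      `[< exists p : 'M[F]_(rdim M, rdim L), [/\ is_hom p, mx_surj p &
            U = [set u | p *m u == 0]%SET] >]]]%SET|.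

Definition projective (P : rawmod) : Prop :=
  forall (M N : mod) (g : 'M[F]_(rdim N, rdim M)) (f : 'M[F]_(rdim N, rdim P)),
    is_hom g -> mx_surj g -> is_hom f ->
    exists2 h : 'M[F]_(rdim M, rdim P), is_hom h & g *m h = f.

Record prj := Prj { prj_mod :> mod; prjP : projective prj_mod }.

HB.instance Definition _ := gen_eqMixin prj.
HB.instance Definition _ := gen_choiceMixin prj.

(* The object src -> tgt, with src = M_(-1) and tgt = M_0. *)
Record rawmor := RawMor {
  src : rawmod; tgt : rawmod; dif : 'M[F]_(rdim tgt, rdim src) }.

Record is_c2p (X : rawmor) : Prop := IsC2P {
  src_mod : is_mod (src X); tgt_mod : is_mod (tgt X);
  src_proj : projective (src X); tgt_proj : projective (tgt X);
  dif_hom : is_hom (dif X) }.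

Record c2p := C2P { c2p_raw :> rawmor; c2pP : is_c2p c2p_raw }.

HB.instance Definition _ := gen_eqMixin c2p.
HB.instance Definition _ := gen_choiceMixin c2p.

Local Notation morT X Y :=
  ('M[F]_(rdim (src Y), rdim (src X)) * 'M[F]_(rdim (tgt Y), rdim (tgt X)))%type.

Definition is_hom2 (X Y : rawmor) (f : morT X Y) : bool :=
  [&& is_hom f.1, is_hom f.2 & f.2 *m dif X == dif Y *m f.1].

Definition Hom2 (X Y : rawmor) : {set morT X Y} :=
  [set f | is_hom2 f]%SET.

Definition mor_iso (X Y : rawmor) : Prop :=
  exists (f : morT X Y) (g : morT Y X), [/\ is_hom2 f, is_hom2 g,
    g.1 *m f.1 = 1%:M /\ f.1 *m g.1 = 1%:M &
    g.2 *m f.2 = 1%:M /\ f.2 *m g.2 = 1%:M].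

(* Extensions 0 -> Y -> L -> X -> 0 in C_2(P), with the components of L
   written as block modules and its differential as the block triangular
   matrix [dif Y, z.2; 0, dif X]. *)
Local Notation coc2 X Y :=
  (coc (src X) (src Y) * coc (tgt X) (tgt Y) *
   'M[F]_(rdim (tgt Y), rdim (src X)))%type.
Definition ext_mid2 (X Y : rawmor) (z : coc2 X Y) : rawmor :=
  @RawMor (ext_mid z.1.1) (ext_mid z.1.2) (block_mx (dif Y) z.2 0 (dif X)).

Definition Z2 (X Y : rawmor) : {set coc2 X Y} :=
  [set z | [&& z.1.1 \in Z1 (src X) (src Y), z.1.2 \in Z1 (tgt X) (tgt Y) &
               is_hom (dif (ext_mid2 z))]]%SET.
Definition B2 (X Y : rawmor) : {set coc2 X Y} :=
  [set ([ffun g => act (src Y) g *m h.1 - h.1 *m act (src X) g],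
        [ffun g => act (tgt Y) g *m h.2 - h.2 *m act (tgt X) g],
        dif Y *m h.1 - h.2 *m dif X)
   | h : 'M[F]_(rdim (src Y), rdim (src X)) *
         'M[F]_(rdim (tgt Y), rdim (tgt X))]%SET.

Definition Ext2 (X Y : rawmor) : {set {set coc2 X Y}} :=
  [set [set (z : coc2 X Y) + b | b in B2 X Y]%SET | z in Z2 X Y]%SET.
Definition Ext2_mid (X Y L : rawmor) : {set {set coc2 X Y}} :=
  [set E in Ext2 X Y | [exists z in E, `[< mor_iso (ext_mid2 z) L >]]]%SET.

Definition euler2 (X Y : rawmor) : int :=
  (\dim <<enum (Hom2 X Y)>>%VS)%:Z
  - (\dim <<enum (Z2 X Y)>>%VS - \dim <<enum (B2 X Y)>>%VS)%N%:Z.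

Definition raw0 : rawmod := @RawMod 0 (fun _ => 0).

Lemma raw0_mod : is_mod raw0.
Proof. by split=> *; rewrite ?[LHS]flatmx0 ?[RHS]flatmx0. Qed.

Definition mod0 : mod := Mod raw0_mod.

Lemma mod0_proj : projective mod0.
Proof.
move=> M N g f _ _ _; exists 0; last by rewrite [LHS]thinmx0 [RHS]thinmx0.
by apply/forallP=> w; rewrite [X in _ == X]thinmx0 [X in X == _]thinmx0.
Qed.

Definition prj0 : prj := Prj mod0_proj.

Lemma K_subproof (P : prj) : is_c2p (@RawMor P P 1%:M).
Proof.
split; try exact: modP; try exact: prjP.
by apply/forallP=> g /=; rewrite mul1mx mulmx1.
Qed.
Lemma Z_subproof (P : prj) : is_c2p (@RawMor P prj0 0).
Proof.
split; try exact: modP; try exact: prjP.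
by apply/forallP=> g /=; rewrite [X in _ == X]flatmx0 [X in X == _]flatmx0.
Qed.

Definition K_ (P : prj) : c2p := C2P (K_subproof P).
Definition Z_ (P : prj) : c2p := C2P (Z_subproof P).

(* X = (Omega -> P) is a minimal projective resolution of M: there is an exact
   sequence 0 -> Omega -> P -> M -> 0 in which P -> M is a projective cover,
   i.e. no proper submodule of P surjects onto M. *)
Definition is_min_res (M : mod) (X : c2p) : Prop :=
  mx_inj (dif X) /\
  exists p : 'M[F]_(rdim M, rdim (tgt X)),
    [/\ is_hom p, mx_surj p,
        forall u : 'cV_(rdim (tgt X)),
          p *m u = 0 <-> exists w : 'cV_(rdim (src X)), dif X *m w = u &
        forall U : {set 'cV[F]_(rdim (tgt X))}, submod U ->
          (forall w : 'cV_(rdim M), exists2 u, u \in U & p *m u = w) ->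
          U = [set: 'cV[F]_(rdim (tgt X))]%SET].

Definition C_ (M : mod) : c2p := xget (Z_ prj0) [set X | is_min_res M X]%classic.

Lemma is_hom1 (X : rawmod) : is_hom (1%:M : 'M_(rdim X)).
Proof. by apply/forallP=> g; rewrite mul1mx mulmx1. Qed.

Lemma is_hom_comp (X Y Z : rawmod) (f : 'M_(rdim Y, rdim X))
  (g : 'M_(rdim Z, rdim Y)) : is_hom f -> is_hom g -> is_hom (g *m f).
Proof.
move=> /forallP hf /forallP hg; apply/forallP=> w.
by rewrite -mulmxA (eqP (hf w)) mulmxA (eqP (hg w)) mulmxA.
Qed.

Lemma mod_iso_equiv : equiv_class_of (fun X Y : mod => `[< mod_iso X Y >]).
Proof.
have sym (X Y : mod) : mod_iso X Y -> mod_iso Y X.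
  by case=> f [g [? ? ? ?]]; exists g, f.
split.
- move=> X; apply/asboolP; exists 1%:M, 1%:M.
  by split; rewrite ?is_hom1 ?mulmx1.
- by move=> X Y; apply/asboolP/asboolP; apply: sym.
- move=> Y X Z /asboolP[f [g [hf hg gf fg]]] /asboolP[f' [g' [hf' hg' gf' fg']]].
  apply/asboolP; exists (f' *m f), (g *m g').
  split; try exact: is_hom_comp.
    by rewrite mulmxA -(mulmxA g) gf' mulmx1 gf.
  by rewrite mulmxA -(mulmxA f') fg mulmx1 fg'.
Qed.

Definition mod_iso_rel := EquivRelPack mod_iso_equiv.
Definition isomod : choiceType := {eq_quot mod_iso_rel}%qT.
Definition rep_mod (a : isomod) : mod := repr (a : {eq_quot mod_iso_rel}%qT).

Lemma mor_iso_equiv : equiv_class_of (fun X Y : c2p => `[< mor_iso X Y >]).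
Proof.
have sym (X Y : c2p) : mor_iso X Y -> mor_iso Y X.
  by case=> f [g [? ? [? ?] [? ?]]]; exists g, f.
split.
- move=> X; apply/asboolP; exists (1%:M, 1%:M), (1%:M, 1%:M).
  by split; rewrite /is_hom2 /= ?is_hom1 ?mulmx1 ?mul1mx ?eqxx.
- by move=> X Y; apply/asboolP/asboolP; apply: sym.
- move=> Y X Z /asboolP[f [g [/and3P[f1 f2 /eqP fd] /and3P[g1 g2 /eqP gd]
    [gf1 fg1] [gf2 fg2]]]].
  move=> /asboolP[f' [g' [/and3P[f1' f2' /eqP fd'] /and3P[g1' g2' /eqP gd']
    [gf1' fg1'] [gf2' fg2']]]].
  apply/asboolP; exists (f'.1 *m f.1, f'.2 *m f.2), (g.1 *m g'.1, g.2 *m g'.2).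
  split=> /=.
  + apply/and3P; split=> /=; try exact: is_hom_comp.
    by rewrite -mulmxA fd mulmxA fd' mulmxA.
  + apply/and3P; split=> /=; try exact: is_hom_comp.
    by rewrite -mulmxA gd' mulmxA gd mulmxA.
  + split; first by rewrite mulmxA -(mulmxA g.1) gf1' mulmx1 gf1.
    by rewrite mulmxA -(mulmxA f'.1) fg1 mulmx1 fg1'.
  + split; first by rewrite mulmxA -(mulmxA g.2) gf2' mulmx1 gf2.
    by rewrite mulmxA -(mulmxA f'.2) fg2 mulmx1 fg2'.
Qed.

Definition mor_iso_rel := EquivRelPack mor_iso_equiv.
Definition isoc2p : choiceType := {eq_quot mor_iso_rel}%qT.
Definition cls (X : c2p) : isoc2p := (\pi_({eq_quot mor_iso_rel}) X)%qT.
Definition rep_c2p (a : isoc2p) : c2p := repr (a : {eq_quot mor_iso_rel}%qT).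

End Modules.

Section Bilinear.
Variable R : comNzRingType.

Definition bilin (U V W : lmodType R) (f : U -> V -> W) : Prop :=
  (forall u, linear (f u)) /\ (forall w, linear (f^~ w)).

Definition is_tensor (U V W : lmodType R) (t : U -> V -> W) : Prop :=
  bilin t /\
  forall (W' : lmodType R) (f : U -> V -> W'), bilin f ->
    (exists g : {linear W -> W'}, forall u w, g (t u w) = f u w) /\
    (forall g h : {linear W -> W'},
       (forall u w, g (t u w) = h (t u w)) -> g =1 h).

Definition malg_bilin (K : choiceType) (W : lmodType R) (f : K -> K -> W)
    (x y : {malg R[K]}) : W :=
  \sum_(a <- msupp x) \sum_(b <- msupp y) (x@_a * y@_b) *: f a b.

End Bilinear.

Section Hall.
Variables (F : finFieldType) (n : nat) (S : species F n).

Definition Hall := {malg (Zv F)[isoc2p S]}.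

Definition cl (X : c2p S) : Hall := << cls X >>.

Definition hall_basis_mul (X Y : c2p S) : Hall :=
  \sum_(L \in [set: isoc2p S])
    (qq F ^ euler2 X Y * #|Ext2_mid X Y (rep_c2p L)|%:R / #|Hom2 X Y|%:R) *: << L >>.

Definition hall_mul : Hall -> Hall -> Hall :=
  malg_bilin (fun a b => hall_basis_mul (rep_c2p a) (rep_c2p b)).

(* MH is the ring of fractions of the Hall algebra whose denominators are the
   [K_P]; these are central and closed under products up to isomorphism, and
   the class of the zero object is the unit of the Hall algebra. *)
Record is_localization (MH : unitAlgType (Zv F)) (loc : {linear Hall -> MH})
    : Prop := IsLocalization {
  loc1 : loc (cl (Z_ (prj0 S))) = 1;
  locM : forall x y, loc (hall_mul x y) = loc x * loc y;
  loc_unit : forall P : prj S, loc (cl (K_ P)) \is a GRing.unit;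
  loc_frac : forall z : MH, exists (x : Hall) (P : prj S),
    z = loc x / loc (cl (K_ P));
  loc_eq0 : forall x : Hall, loc x = 0 ->
    exists P : prj S, hall_mul (cl (K_ P)) x = 0
}.

Section MH.
Variables (MH : unitAlgType (Zv F)) (loc : {linear Hall -> MH}).

(* Independent of the choice of (P, Q): projectives are determined up to
   isomorphism by their dimension vectors, and these generate Z^n. *)
Definition Kel (a : 'cV[int]_n) : MH :=
  let PQ := xget (prj0 S, prj0 S)
    [set PQ | dimvec (prj_mod PQ.1) - dimvec (prj_mod PQ.2) = a]%classic in
  loc (cl (K_ PQ.1)) / loc (cl (K_ PQ.2)).

Definition XM (M : mod S) : MH :=
  Kel (- dimvec (tgt (C_ M))) * loc (cl (C_ M)).
Definition XP (P : prj S) : MH := loc (cl (Z_ P)).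
Definition XX (M : mod S) (P : prj S) : MH := XM M * XP P.

End MH.
End Hall.

Section Maps.
Variables (F : finFieldType) (n : nat) (S : species F (n + n)).

Local Notation Q := (sub_species S).

(* T and T_Lambda have the same underlying module. *)
Definition torus := {malg (Zv F)['cV[int]_(n + n)]}.

Definition til (a : 'cV[int]_n) : 'cV[int]_(n + n) := col_mx 0 a.

Definition Lform (Lam : 'M[int]_(n + n)) (a b : 'cV[int]_(n + n)) : int :=
  (a^T *m Lam *m b) 0 0.

Definition torus_mul (Lam : 'M[int]_(n + n)) : torus -> torus -> torus :=
  malg_bilin (fun a b => (vv F ^ Lform Lam a b) *: (<< a + b >> : torus)).

Definition Rt : 'M[int]_(n + n, n) :=
  \matrix_(i, j) (ext_ldim (simple S (lshift n j)) (simple S i))%:Z.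
Definition Rt' : 'M[int]_(n + n, n) :=
  \matrix_(i, j) (ext_rdim (simple S i) (simple S (lshift n j)))%:Z.
Definition It : 'M[int]_(n + n, n) := lsubmx 1%:M.
Definition Bt : 'M[int]_(n + n, n) := Rt' - Rt.
Definition Et : 'M[int]_(n + n, n) := It - Rt'.
Definition Et' : 'M[int]_(n + n, n) := It - Rt.
Definition Dn : 'M[int]_n := diag_mx (\row_i (sdim S (lshift n i))%:Z).

Section WithMH.
Variables (MH : unitAlgType (Zv F)) (loc : {linear Hall Q -> MH}).

(* The elements K_a * X_(M (+) P[1]) form a basis of MH, so the next two
   predicates determine a bilinear product and a linear map on MH. *)
Definition is_star (Lam : 'M[int]_(n + n)) (star : MH -> MH -> MH) : Prop :=
  bilin star /\
  forall (a b : 'cV[int]_n) (M N : mod Q) (P P' : prj Q),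
    star (Kel loc a * XX loc M P) (Kel loc b * XX loc N P') =
    vv F ^ Lform Lam (Et' *m (dimvec M - dimvec P) - til a)
                     (Et' *m (dimvec N - dimvec P') - til b) *:
      ((Kel loc a * XX loc M P) * (Kel loc b * XX loc N P')).

Definition is_Delta (MM : lmodType (Zv F)) (t : MH -> MH -> MM)
    (Delta : MH -> MM) : Prop :=
  forall (a : 'cV[int]_n) (L : mod Q) (P : prj Q),
    Delta (Kel loc a * XX loc L P) =
    \sum_(MN \in [set: isomod Q * isomod Q])
      (let M := rep_mod MN.1 in let N := rep_mod MN.2 in
       (qq F ^ euler Q (dimvec M) (dimvec N - dimvec P) * (hallF M N L)%:R) *:
         t (XM loc M) (Kel loc a * XX loc N P)).

Definition is_int (I : MH -> torus) : Prop :=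
  forall (a : 'cV[int]_n) (X : c2p Q),
    I (Kel loc a * loc (cl X)) =
    << til a + col_mx (dimvec (tgt X) - dimvec (src X)) (dimvec (tgt X)) >>.

End WithMH.

Definition is_mu (TT : lmodType (Zv F)) (t : torus -> torus -> TT)
    (mu : TT -> torus) : Prop :=
  forall a1 a2 b1 b2 : 'cV[int]_n,
    mu (t << col_mx a1 a2 >> << col_mx b1 b2 >>) =
    vv F ^ (- seuler Q a1 b1 - euler Q a1 b1) *:
      << - (Et *m a1) - Et' *m b1 + til a2 + til b2 >>.

End Maps.

(* Main.v *)
Require Import Defs.
From HB Require Import structures.
From mathcomp Require Import all_boot all_order all_algebra all_field.
From mathcomp Require Import boolp classical_sets functions cardinality fsbigop.
From mathcomp Require Import finmap zify ring.
From mathcomp Require Import monalg.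

Set Implicit Arguments.
Unset Strict Implicit.
Unset Printing Implicit Defensive.

Import Order.TTheory GRing.Theory Num.Theory.

Local Open Scope ring_scope.

(** The image under Psi of any object X = (X_(-1) -> X_0), twisted by some K_c,
    is a sum of monomials indexed by the submodules U of the cokernel of X
    (Psi_obj):

      Psi(K_c * [X]) = sum_U v^<x_1 - u, x_0 - u> X^(E'(x_1 - u) - E(x_0 - u) + c + x_0),

    where (x_1, x_0) is the class of X, the exponent c + x_0 is put in the
    last n coordinates, and U is read as a submodule of X_0 containing the
    image of the differential. On the basis elements this is the
    coproduct, whose Hall numbers count submodules (Psi_XX), and this gives
    the formula of the theorem. It extends to all objects because the
    image of the differential is projective: up to direct
    summands K_T, which are invertible, X is the sum of the resolution of its
    cokernel and of Z_P with P its kernel (decomposition, loc_decomposition).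

    For the product, the components of X are projective, so an extension of X
    by Y is the cone of a hom w : X_(-1) -> Y_0, and the product of the
    classes is the average of the classes of the cones (hall_cl). Applying Psi
    to it gives a sum over the pairs of a w and a submodule U of X_0 + Y_0
    admitted by the cone of w. Such a U has a part V in Y_0 and a projection W
    to X_0, which are indices of the two factors Psi[X] and Psi[Y]. For given
    V and W, there are |Hom(W, Y_0 / V)| choices of U, the graphs, and for each
    of them |Hom(X_(-1), V)| choices of w (cone_count). All these homs have
    a projective source, so their numbers are q^<w, y_0 - v> and q^<x_1, v>.
    It remains to compare exponents of v term by term (exponents): the
    compatibility of the form Lambda with B makes its values on the degrees
    that occur differences of Euler forms (Lform_shift).

    What is needed of representation theory is proved by counting. Over the
    product D of the fields K_i every cocycle is inner: |K_i| = 0 in k, so that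
    summing the cocycle identity over the units of K_i gives a potential
    (cocycle_inner). Hence a cocycle on the whole algebra is, up to a
    coboundary, a bimodule map on the arrows, which gives the Euler form in
    terms of dimension vectors (eulerE) and lets cocycles extend from
    submodules (cocycle_extend), that is, the algebra is hereditary. Projective
    covers exist as the quiver is acyclic (enough_projectives,
    min_resolution), and a projective is determined by its class
    (projective_iso), so that K_a is multiplicative in a. The matrices R
    and R' are dimensions over the division rings End(S_i), and D(I - R) and
    D(I - R') are the Gram matrices of the Euler form on the vertices of Q
    (Rt_euler, Rt'_euler). *)

(** * Counting in finite vector spaces *)

(* Cochains are finite groups, for which both structures are used at once. *)
HB.instance Definition _ (aT : finType) (rT : finZmodType) :=
  GRing.Zmodule.on {ffun aT -> rT}.
HB.instance Definition _ (U V : finZmodType) :=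
  GRing.Zmodule.on (U * V)%type.

Lemma card_span (F : finFieldType) (V : vectType F) (s : seq V) :
  uniq s -> 0 \in s ->
  (forall (c : F) u w, u \in s -> w \in s -> c *: u + w \in s) ->
  (size s = #|F| ^ \dim <<s>>)%N.
Proof.
case: V s => T0 c s us s0 scl; pose V := Vector.Pack c.
pose T : finType := finvect_type V.
rewrite -(@card_vspace F T c <<s>>%VS).
have /card_uniqP <- : uniq (s : seq T) by [].
apply: eq_card => u; apply/idP/idP; first exact: memv_span.
move/(@coord_span _ V _ (in_tuple s))=> ->; elim/big_ind: _ => // [x y xs ys|i _].
  by rewrite -[x]scale1r; apply: scl.
by rewrite -[_ *: _]addr0; apply: scl => //; exact: mem_nth.
Qed.

Lemma card_fibers (U V : finType) (A : {set U}) (f : U -> V) k :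
  (forall u, u \in A -> #|[set a in A | f a == f u]%SET| = k) ->
  (#|A| = #|f @: A| * k)%N.
Proof.
move=> fk; rewrite -sum1_card (partition_big_imset f) /=.
rewrite -sum_nat_const; apply: eq_bigr => v /imsetP[u uA ->].
by rewrite -(fk u uA) -sum1_card; apply: eq_bigl => a; rewrite inE.
Qed.

Section Additive.
Variables (U V : finZmodType) (A : {set U}) (f : U -> V).
Hypothesis A0 : 0 \in A.
Hypothesis AB : forall a b, a \in A -> b \in A -> a - b \in A.
Hypothesis fB : forall a b, a \in A -> b \in A -> f (a - b) = f a - f b.

Lemma closedD a b : a \in A -> b \in A -> a + b \in A.
Proof.
by move=> aA bA; rewrite -[b]opprK -[- b]add0r; apply: AB => //; apply: AB.
Qed.

Lemma card_additive : (#|A| = #|f @: A| * #|[set a in A | f a == 0%R]%SET|)%N.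
Proof.
apply: card_fibers => u uA.
rewrite -(card_imset _ (addrI (- u))); apply: eq_card => a.
apply/imsetP/idP=> [[b]|].
  rewrite !inE => /andP[bA /eqP fb] ->.
  by rewrite addrC AB //= fB // fb subrr.
rewrite inE => /andP[aA /eqP fa]; exists (a + u); last by rewrite addrCA addNr addr0.
rewrite inE closedD //=; apply/eqP/subr0_eq.
by rewrite -fB ?closedD // addrK fa.
Qed.
End Additive.

(** Exchange the sums in the sum over h and z of phi (z + h): for fixed h,
    translation by h permutes Z; for fixed z, replacing z by a representative
    in H of its coset leaves a translate of the sum over H. *)
Lemma average_cosets (U : finZmodType) (W : zmodType) (Z B H : {set U})
    (phi : U -> W) :
  (forall z h, z \in Z -> h \in H -> z + h \in Z) ->
  (forall h h', h \in H -> h' \in H -> h - h' \in H) ->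
  (0 \in H) ->
  (forall z, z \in Z -> exists2 h, h \in H & z - h \in B) ->
  (forall z b, z \in Z -> z + b \in Z -> b \in B -> phi (z + b) = phi z) ->
  (forall h, h \in H -> h \in Z) ->
  (\sum_(z in Z) phi z) *+ #|H| = (\sum_(h in H) phi h) *+ #|Z|.
Proof.
move=> ZH HB H0 ZBH phiB HZ.
have HN h : h \in H -> - h \in H by move=> hH; rewrite -sub0r HB.
have HD h h' : h \in H -> h' \in H -> h + h' \in H.
  by move=> hH h'H; rewrite -[h']opprK HB ?HN.
transitivity (\sum_(h in H) \sum_(z in Z) phi (z + h)).
  rewrite -sumr_const; apply: eq_bigr => h hH.
  rewrite (reindex_inj (addIr h)) /=; apply: eq_bigl => z.
  apply/idP/idP => [zh|zZ]; last exact: ZH.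
  by rewrite -(addrK h z) ZH ?HN.
rewrite exchange_big /= -sumr_const; apply: eq_bigr => z zZ.
have [h' h'H zb] := ZBH z zZ.
transitivity (\sum_(h in H) phi (h' + h)).
  apply: eq_bigr => h hH; rewrite -(phiB (h' + h) (z - h')) //.
  - by congr phi; rewrite addrAC addrCA subrr addr0.
  - by apply: ZH => //; apply: HZ.
  - by rewrite addrAC addrCA subrr addr0; exact: ZH.
rewrite [RHS](reindex_inj (addrI h')) /=; apply: eq_bigl => h.
by apply/idP/idP => [hH|hh]; [exact: HD | rewrite -(addKr h' h) HD ?HN].
Qed.

(** * Split exact sequences of matrices *)

Section Splits.
Variable F : finFieldType.
Implicit Types (r d t : nat).

(** A decomposition of the space of columns of height d as a direct sum: f and
    s are the inclusions of the summands, g and p the projections. *)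
Record splits r d t (f : 'M[F]_(d, r)) (g : 'M[F]_(r, d)) (p : 'M[F]_(t, d))
    (s : 'M[F]_(d, t)) : Prop := Splits {
  split_gf : g *m f = 1%:M;
  split_ps : p *m s = 1%:M;
  split_fg : f *m g + s *m p = 1%:M }.

Section Rel.
Variables (r d t : nat) (f : 'M[F]_(d, r)) (g : 'M[F]_(r, d)).
Variables (p : 'M[F]_(t, d)) (s : 'M[F]_(d, t)).
Hypothesis fgps : splits f g p s.

Lemma split_pf : p *m f = 0.
Proof.
case: fgps => gf ps fg.
have: p *m (f *m g + s *m p) *m f = p *m f by rewrite fg mulmx1.
rewrite mulmxDr mulmxDl !mulmxA ps mul1mx -(mulmxA (p *m f)) gf mulmx1.
by move/(canRL (addrK _)); rewrite subrr.
Qed.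

Lemma split_gs : g *m s = 0.
Proof.
case: fgps => gf ps fg.
have: g *m (f *m g + s *m p) *m s = g *m s by rewrite fg mulmx1.
rewrite mulmxDr mulmxDl !mulmxA gf mul1mx -(mulmxA (g *m s)) ps mulmx1.
by move/(canRL (addrK _)); rewrite subrr.
Qed.

Lemma split_ker m (h : 'M_(d, m)) : p *m h = 0 -> h = f *m (g *m h).
Proof.
move=> ph; rewrite -[LHS]mul1mx -(split_fg fgps) mulmxDl -!mulmxA ph.
by rewrite mulmx0 addr0.
Qed.

Lemma split_coker m (h : 'M_(m, d)) : h *m f = 0 -> h = h *m s *m p.
Proof.
move=> hf; rewrite -[LHS]mulmx1 -(split_fg fgps) mulmxDr !mulmxA hf.
by rewrite mul0mx add0r.
Qed.

Lemma split_swap : splits s p g f.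
Proof. by case: fgps => gf ps fg; split=> //; rewrite addrC. Qed.
End Rel.

Lemma split_idem d (e : 'M[F]_d) : e *m e = e ->
  exists t (p : 'M_(t, d)) (s : 'M_(d, t)), p *m s = 1%:M /\ s *m p = e.
Proof.
move=> ee; exists (\rank e), (row_base e), (col_base e).
split; last exact: mulmx_base.
have /row_freeP[B rB] := row_base_free e.
have /row_fullP[C Cc] := col_base_full e.
have cancel_ee (t : nat) (c : 'M_(d, t)) (r : 'M_(t, d)) (B' : 'M_(d, t))
    (C' : 'M_(t, d)) : c *m r = e -> r *m B' = 1%:M -> C' *m c = 1%:M ->
    r *m c = 1%:M.
  move=> cr rB' C'c; have : C' *m (e *m e) *m B' = C' *m e *m B' by rewrite ee.
  by rewrite -cr !mulmxA C'c mul1mx -!mulmxA rB' mulmx1.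
exact: cancel_ee (mulmx_base e) rB Cc.
Qed.

Lemma split_inj r d (f : 'M[F]_(d, r)) (g : 'M[F]_(r, d)) :
  g *m f = 1%:M ->
  exists t (p : 'M_(t, d)) (s : 'M_(d, t)), splits f g p s.
Proof.
move=> gf.
have [|t [p [s [ps sp]]]] := @split_idem d (1%:M - f *m g).
  by rewrite mulmxBr mulmx1 mulmxBl mul1mx mulmxA -(mulmxA f) gf mulmx1
    subrr subr0.
by exists t, p, s; split=> //; rewrite sp addrCA subrr addr0.
Qed.

Lemma split_surj d t (p : 'M[F]_(t, d)) (s : 'M[F]_(d, t)) :
  p *m s = 1%:M ->
  exists r (f : 'M_(d, r)) (g : 'M_(r, d)), splits f g p s.
Proof.
move=> ps; have [r [g [f sg]]] := split_inj ps.
by exists r, f, g; apply: split_swap.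
Qed.

Lemma mx_inj_retract m p (f : 'M[F]_(m, p)) : mx_inj f -> exists g, g *m f = 1%:M.
Proof.
move=> fi; apply/row_fullP; rewrite -[f]trmxK; apply/eqP; rewrite mxrank_tr; apply/eqP.
rewrite -/(row_free f^T) -kermx_eq0; apply/eqP/row_matrixP=> i.
rewrite row0; apply: trmx_inj; apply: fi; rewrite trmx0 mulmx0.
apply: trmx_inj; rewrite trmx_mul trmxK trmx0 -row_mul.
by rewrite mulmx_ker row0.
Qed.

Lemma mx_surj_section m p (f : 'M[F]_(m, p)) : mx_surj f -> exists s, f *m s = 1%:M.
Proof.
move=> fs; have ex j : exists u, f *m u == (delta_mx j 0 : 'cV_m).
  by have [u fu] := fs (delta_mx j 0); exists u; apply/eqP.
exists (\matrix_(i, j) xchoose (ex j) i 0); apply/matrixP=> i j.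
have /eqP/matrixP/(_ i 0) := xchooseP (ex j).
by rewrite !mxE eqxx andbT => <-; apply: eq_bigr => k _; rewrite mxE.
Qed.

Lemma retract_inj m p (f : 'M[F]_(m, p)) g : g *m f = 1%:M -> mx_inj f.
Proof.
by move=> gf u w /(congr1 (mulmx g)); rewrite !mulmxA gf !mul1mx.
Qed.

Lemma section_surj m p (f : 'M[F]_(m, p)) s : f *m s = 1%:M -> mx_surj f.
Proof. by move=> fs w; exists (s *m w); rewrite mulmxA fs mul1mx. Qed.

Definition subspace d (U : {set 'cV[F]_d}) :=
  (0 \in U) /\ forall (c : F) u w, u \in U -> w \in U -> c *: u + w \in U.

Lemma subspace_mul d m (U : {set 'cV[F]_d}) (f : 'M_(d, m)) (w : 'cV_m) :
  subspace U -> (forall k, col k f \in U) -> f *m w \in U.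
Proof.
move=> [U0 Ucl] fU.
have -> : f *m w = \sum_k w k 0 *: col k f.
  apply/matrixP=> i j; rewrite !mxE summxE; apply: eq_bigr => k _.
  by rewrite !mxE mulrC ord1.
elim/big_ind: _ => // [x y xU yU|k _].
  by rewrite -[x]scale1r; apply: Ucl.
by rewrite -[_ *: _]addr0; apply: Ucl.
Qed.

Lemma subspace_split d (U : {set 'cV[F]_d}) : subspace U ->
  exists r t (f : 'M_(d, r)) g (p : 'M_(t, d)) s,
    splits f g p s /\ U = [set u | p *m u == 0]%SET.
Proof.
move=> Us; have [U0 Ucl] := Us.
pose B := vbasis <<enum U>>%VS; pose r := \dim <<enum U>>%VS.
pose f := \matrix_(i < d, k < r) (B`_k : 'cV[F]_d) i 0.
have fE (w : 'cV_r) : f *m w = \sum_k w k 0 *: B`_k.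
  apply/matrixP=> i j; rewrite !mxE summxE; apply: eq_bigr => k _.
  by rewrite !mxE mulrC ord1.
have Uspan u : (u \in <<enum U>>%VS) = (u \in U).
  apply/idP/idP => [/(@coord_span _ _ _ (in_tuple (enum U)))->|uU]; last by rewrite memv_span ?mem_enum.
  elim/big_ind: _ => // [x y xs ys|i _].
    by rewrite -[x]scale1r; apply: Ucl.
  by rewrite -[_ *: _]addr0; apply: Ucl => //; rewrite -mem_enum mem_nth.
have fi : mx_inj f.
  move=> u w; rewrite !fE => uw; apply/matrixP=> k j; rewrite ord1.
  have /freeP fr := basis_free (vbasisP <<enum U>>%VS).
  apply/eqP; rewrite -subr_eq0; apply/eqP.
  apply: (fr (fun k => u k 0 - w k 0)).
  by under eq_bigr => i _ do rewrite scalerBl; rewrite sumrB uw subrr.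
have [g gf] := mx_inj_retract fi.
have [t [p [s spl]]] := split_inj gf.
exists r, t, f, g, p, s; split=> //; apply/setP=> u; rewrite inE.
apply/idP/eqP => [uU|pu].
  move: uU; rewrite -Uspan => /coord_vbasis ->.
  have -> : \sum_i coord (vbasis <<enum U>>) i u *: (vbasis <<enum U>>)`_i
     = f *m \col_i coord (vbasis <<enum U>>) i u.
    by rewrite fE; apply: eq_bigr => i _; rewrite mxE.
  by rewrite mulmxA (split_pf spl) mul0mx.
rewrite (split_ker spl pu) fE -Uspan rpred_sum // => k _.
by rewrite rpredZ // vbasis_mem // mem_nth // size_tuple.
Qed.

End Splits.

(** * Modules, submodules and quotients *)

Section Modules.
Variables (F : finFieldType) (n : nat) (S : species F n).
Implicit Types X Y L : rawmod S.

Local Notation hom X Y f := (@is_hom F n S X Y f).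

Lemma homP X Y (f : 'M_(rdim Y, rdim X)) :
  reflect (forall g, f *m act X g = act Y g *m f) (hom X Y f).
Proof.
apply: (iffP forallP) => h g; first exact/eqP/h.
by rewrite h.
Qed.

Arguments homP {X Y f}.

Lemma hom0 X Y : hom X Y 0.
Proof. by apply/homP=> g; rewrite mul0mx mulmx0. Qed.

Lemma homZD X Y (c : F) f h : hom X Y f -> hom X Y h -> hom X Y (c *: f + h).
Proof.
move=> /homP fh /homP hh; apply/homP=> g.
by rewrite mulmxDl mulmxDr -scalemxAl -scalemxAr fh hh.
Qed.

Lemma homD X Y f h : hom X Y f -> hom X Y h -> hom X Y (f + h).
Proof. by move=> fh hh; rewrite -[f]scale1r homZD. Qed.

Lemma homN X Y f : hom X Y f -> hom X Y (- f).
Proof. by move=> fh; rewrite -scaleN1r -[_ *: f]addr0 homZD ?hom0. Qed.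

Lemma homB X Y f h : hom X Y f -> hom X Y h -> hom X Y (f - h).
Proof. by move=> fh hh; rewrite homD ?homN. Qed.

Lemma is_mod_inj X Y f g : hom X Y f -> g *m f = 1%:M -> is_mod Y -> is_mod X.
Proof.
move=> /homP fh gf [D1 D2 D3 D4 M1 M2 M3].
have XE w : act X w = g *m act Y w *m f.
  by rewrite -[LHS]mul1mx -gf -!mulmxA fh.
have XM w w' : act X w *m act X w' = g *m (act Y w *m act Y w') *m f.
  by rewrite XE -!mulmxA fh.
split.
- by move=> i c a b; rewrite !XE D1 mulmxDr mulmxDl -scalemxAr -scalemxAl.
- by move=> i a b; rewrite XM -D2 XE.
- by move=> i j a b ij; rewrite XM D3 // mulmx0 mul0mx.
- under eq_bigr => i _ do rewrite XE.
  by rewrite -mulmx_suml -mulmx_sumr D4 mulmx1.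
- by move=> i j c m m'; rewrite !XE M1 mulmxDr mulmxDl -scalemxAr -scalemxAl.
- by move=> i j a m; rewrite XM -M2 XE.
- by move=> i j m b; rewrite XM -M3 XE.
Qed.

Lemma is_mod_surj X Y p s : hom X Y p -> p *m s = 1%:M -> is_mod X -> is_mod Y.
Proof.
move=> /homP ph ps [D1 D2 D3 D4 M1 M2 M3].
have XE w : act Y w = p *m act X w *m s.
  by rewrite -[LHS]mulmx1 -ps mulmxA ph.
have XM w w' : act Y w *m act Y w' = p *m (act X w *m act X w') *m s.
  by rewrite [in act Y w']XE !mulmxA ph.
split.
- by move=> i c a b; rewrite !XE D1 mulmxDr mulmxDl -scalemxAr -scalemxAl.
- by move=> i a b; rewrite XM -D2 XE.
- by move=> i j a b ij; rewrite XM D3 // mulmx0 mul0mx.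
- under eq_bigr => i _ do rewrite XE.
  by rewrite -mulmx_suml -mulmx_sumr D4 mulmx1.
- by move=> i j c m m'; rewrite !XE M1 mulmxDr mulmxDl -scalemxAr -scalemxAl.
- by move=> i j a m; rewrite XM -M2 XE.
- by move=> i j m b; rewrite XM -M3 XE.
Qed.

(** A short exact sequence of modules together with a splitting over k. The
    linear maps g and s are part of the data so that exactness is an equation
    between matrices; they are not homomorphisms in general. *)
Record ses Y L X f g p s : Prop := Ses {
  ses_f : hom Y L f; ses_p : hom L X p; ses_split : splits f g p s }.

Definition subm L r (f : 'M[F]_(rdim L, r)) (g : 'M[F]_(r, rdim L)) : rawmod S :=
  RawMod (fun x => g *m act L x *m f).

Lemma ses_sub L r t (f : 'M_(rdim L, r)) g (p : 'M_(t, rdim L)) s :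
  splits f g p s -> (forall x, p *m act L x *m f = 0) ->
  @ses (subm f g) L (subm s p) f g p s.
Proof.
move=> spl st; split=> //; apply/homP=> x /=.
  have -> : f *m (g *m act L x *m f) = f *m (g *m (act L x *m f)) by rewrite !mulmxA.
  by rewrite -(split_ker spl) // mulmxA st.
by rewrite -(split_coker spl) // st.
Qed.

Lemma ses_modl Y L X f g p s : @ses Y L X f g p s -> is_mod L -> is_mod Y.
Proof. by case=> fh _ [gf _ _]; apply: is_mod_inj gf. Qed.

Lemma ses_modr Y L X f g p s : @ses Y L X f g p s -> is_mod L -> is_mod X.
Proof. by case=> _ ph [_ ps _]; apply: is_mod_surj ps. Qed.

Lemma inj_ses Y L f g : hom Y L f -> g *m f = 1%:M ->
  exists X p s, @ses Y L X f g p s.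
Proof.
move=> fh gf; have [t [p [s spl]]] := split_inj gf.
exists (subm s p), p, s; split=> //; apply/homP=> x /=.
rewrite -(split_coker spl) // -mulmxA -(homP fh) mulmxA.
by rewrite (split_pf spl) mul0mx.
Qed.

Lemma surj_ses L X p s : hom L X p -> p *m s = 1%:M ->
  exists Y f g, @ses Y L X f g p s.
Proof.
move=> ph ps; have [r [f [g spl]]] := split_surj ps.
exists (subm f g), f, g; split=> //; apply/homP=> x /=.
have -> : f *m (g *m act L x *m f) = f *m (g *m (act L x *m f)) by rewrite !mulmxA.
rewrite -(split_ker spl) // mulmxA (homP ph) -mulmxA.
by rewrite (split_pf spl) mulmx0.
Qed.

Lemma ses_liftl Y L X f g p s Z h : @ses Y L X f g p s -> hom Z L h ->
  p *m h = 0 -> hom Z Y (g *m h) /\ f *m (g *m h) = h.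
Proof.
move=> [fh ph spl] hh ph0; have E := esym (split_ker spl ph0); split=> //.
apply/homP=> x; rewrite -mulmxA (homP hh) -{1}E.
rewrite (mulmxA (act L x)) -(homP fh) -(mulmxA f) (mulmxA g).
by rewrite (split_gf spl) mul1mx.
Qed.

Lemma ses_liftr Y L X f g p s Z h : @ses Y L X f g p s -> hom L Z h ->
  h *m f = 0 -> hom X Z (h *m s) /\ h *m s *m p = h.
Proof.
move=> [fh ph spl] hh ph0; have E := esym (split_coker spl ph0); split=> //.
apply/homP=> x; rewrite mulmxA -(homP hh) -{2}E.
by rewrite -(mulmxA _ p) (homP ph) -!mulmxA (split_ps spl) mulmx1.
Qed.

(** The module L with the arrows acting by zero: homs of these are the maps
    that are linear over the semisimple subalgebra D, the product of the K_i. *)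
Definition Dres L : rawmod S :=
  RawMod (fun x : gens S => if x is inl _ then act L x else 0).

Lemma DresP L : is_mod L -> is_mod (Dres L).
Proof.
case=> D1 D2 D3 D4 M1 M2 M3; split=> //= *.
- by rewrite scaler0 addr0.
- by rewrite mulmx0.
- by rewrite mul0mx.
Qed.

Lemma hom_Dres X Y f : hom X Y f -> hom (Dres X) (Dres Y) f.
Proof.
move=> /homP fh; apply/homP=> -[u|u] /=; first exact: fh.
by rewrite mul0mx mulmx0.
Qed.

(** * Extensions and cocycles *)

Local Notation coc X Y := {ffun gens S -> 'M[F]_(rdim Y, rdim X)}.

(** The off-diagonal block of a module structure on Y + X satisfies the linear
    identities obtained from the axioms of a module. *)
Record cocycle X Y (z : coc X Y) : Prop := Cocycle {
  cD_lin : forall i (c : F) (a b : sD S i),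
    z (gD (c *: a + b)) = c *: z (gD a) + z (gD b);
  cDM : forall i (a b : sD S i),
    z (gD (a * b)) = act Y (gD a) *m z (gD b) + z (gD a) *m act X (gD b);
  cD_ortho : forall i j (a : sD S i) (b : sD S j), i != j ->
    act Y (gD a) *m z (gD b) + z (gD a) *m act X (gD b) = 0;
  cD1 : \sum_i z (gD (1 : sD S i)) = 0;
  cM_lin : forall i j (c : F) (m m' : sM S i j),
    z (gM (c *: m + m')) = c *: z (gM m) + z (gM m');
  cM_l : forall i j (a : sD S i) (m : sM S i j),
    z (gM (sl a m)) = act Y (gD a) *m z (gM m) + z (gD a) *m act X (gM m);
  cM_r : forall i j (m : sM S i j) (b : sD S j),
    z (gM (sr m b)) = act Y (gM m) *m z (gD b) + z (gM m) *m act X (gD b) }.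

Lemma ext_mod X Y (z : coc X Y) : is_mod X -> is_mod Y ->
  is_mod (ext_mid z) <-> cocycle z.
Proof.
move=> [X1 X2 X3 X4 X5 X6 X7] [Y1 Y2 Y3 Y4 Y5 Y6 Y7].
have bsum I (r : seq I) (A : I -> 'M[F]_(rdim Y)) (B : I -> 'M[F]_(rdim Y, rdim X))
    (C : I -> 'M[F]_(rdim X)) :
    \sum_(i <- r) block_mx (A i) (B i) 0 (C i) =
    block_mx (\sum_(i <- r) A i) (\sum_(i <- r) B i) 0 (\sum_(i <- r) C i).
  elim: r => [|i r IH]; first by rewrite !big_nil [RHS]block_mx0.
  by rewrite !big_cons IH add_block_mx addr0.
have bb (A A' : 'M[F]_(rdim Y)) (B B' : 'M_(rdim Y, rdim X)) (D D' : 'M[F]_(rdim X)) :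
   block_mx A B 0 D *m block_mx A' B' 0 D' =
   block_mx (A *m A') (A *m B' + B *m D') 0 (D *m D').
  by rewrite mulmx_block !mul0mx !mulmx0 !add0r !addr0.
have bl c (A A' : 'M[F]_(rdim Y)) (B B' : 'M_(rdim Y, rdim X)) (D D' : 'M[F]_(rdim X)) :
   c *: block_mx A B 0 D + block_mx A' B' 0 D' =
   block_mx (c *: A + A') (c *: B + B') 0 (c *: D + D').
  by rewrite scale_block_mx add_block_mx scaler0 addr0.
have b1 : 1%:M = block_mx 1%:M 0 0 1%:M :> 'M[F]_(rdim Y + rdim X).
  exact: scalar_mx_block.
split=> [] [Z1' Z2' Z3' Z4' Z5' Z6' Z7']; split.
- by move=> i c a b; move: (Z1' i c a b); rewrite /= bl => /eq_block_mx[].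
- by move=> i a b; move: (Z2' i a b); rewrite /= bb => /eq_block_mx[].
- move=> i j a b ij; move: (Z3' i j a b ij).
  by rewrite /= bb -[RHS]block_mx0 => /eq_block_mx[].
- by move: Z4'; rewrite /= bsum b1 => /eq_block_mx[].
- by move=> i j c a b; move: (Z5' i j c a b); rewrite /= bl => /eq_block_mx[].
- by move=> i j a m; move: (Z6' i j a m); rewrite /= bb => /eq_block_mx[].
- by move=> i j m b; move: (Z7' i j m b); rewrite /= bb => /eq_block_mx[].
- by move=> i c a b; rewrite /= bl X1 Y1 Z1'.
- by move=> i a b; rewrite /= bb X2 Y2 Z2'.
- by move=> i j a b ij; rewrite /= bb X3 // Y3 // Z3' // block_mx0.
- by rewrite /= bsum Z4' X4 Y4 b1.
- by move=> i j c a b; rewrite /= bl X5 Y5 Z5'.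
- by move=> i j a m; rewrite /= bb X6 Y6 Z6'.
- by move=> i j m b; rewrite /= bb X7 Y7 Z7'.
Qed.

Lemma Z1P X Y (z : coc X Y) : is_mod X -> is_mod Y ->
  reflect (cocycle z) (z \in Z1 X Y).
Proof.
by move=> Xm Ym; rewrite inE; apply: (iffP (asboolP _)) => /ext_mod; apply.
Qed.

Definition cob X Y (h : 'M[F]_(rdim Y, rdim X)) : coc X Y :=
  [ffun g => act Y g *m h - h *m act X g].

Lemma B1P X Y (z : coc X Y) :
  reflect (exists h, z = cob h) (z \in B1 X Y).
Proof.
by apply: (iffP imsetP) => [[h _ ->]|[h ->]]; exists h.
Qed.

Lemma cob_cocycle X Y h : is_mod X -> is_mod Y -> cocycle (@cob X Y h).
Proof.
move=> [X1 X2 X3 X4 X5 X6 X7] [Y1 Y2 Y3 Y4 Y5 Y6 Y7].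
have lin (c : F) (A A' : 'M[F]_(rdim Y)) (B B' : 'M[F]_(rdim X)) :
   (c *: A + A') *m h - h *m (c *: B + B') =
   c *: (A *m h - h *m B) + (A' *m h - h *m B').
  rewrite mulmxDl mulmxDr -scalemxAl -scalemxAr opprD scalerBr.
  by rewrite [LHS]addrACA.
have mul (A A' : 'M[F]_(rdim Y)) (B B' : 'M[F]_(rdim X)) :
   A *m A' *m h - h *m (B *m B') =
   A *m (A' *m h - h *m B') + (A *m h - h *m B) *m B'.
  by rewrite mulmxBr mulmxBl !mulmxA addrA subrK.
split=> *; rewrite ?ffunE.
- by rewrite X1 Y1 lin.
- by rewrite X2 Y2 mul.
- by rewrite -mul X3 // Y3 // mul0mx mulmx0 subrr.
- under eq_bigr => i _ do rewrite ffunE.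
  by rewrite sumrB -mulmx_suml -mulmx_sumr X4 Y4 mul1mx mulmx1 subrr.
- by rewrite X5 Y5 lin.
- by rewrite X6 Y6 mul.
- by rewrite X7 Y7 mul.
Qed.

Lemma cocycleZD X Y (c : F) (z z' : coc X Y) :
  cocycle z -> cocycle z' -> cocycle (c *: z + z').
Proof.
move=> [C1 C2 C3 C4 C5 C6 C7] [E1 E2 E3 E4 E5 E6 E7].
have lin (V : lmodType F) (k : F) (a a' b b' : V) :
   c *: (k *: a + a') + (k *: b + b') = k *: (c *: a + b) + (c *: a' + b').
  by rewrite !scalerDr !scalerA mulrC addrACA.
have mul (A : 'M[F]_(rdim Y)) (B : 'M[F]_(rdim X)) a a' b b' :
   c *: (A *m a + a' *m B) + (A *m b + b' *m B) =
   A *m (c *: a + b) + (c *: a' + b') *m B.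
  by rewrite mulmxDr mulmxDl scalerDr -!scalemxAr -!scalemxAl addrACA.
split=> *; rewrite ?ffunE.
- by rewrite C1 E1 lin.
- by rewrite C2 E2 mul.
- by rewrite -mul C3 // E3 // scaler0 addr0.
- under eq_bigr => i _ do rewrite !ffunE.
  by rewrite big_split /= -scaler_sumr C4 E4 scaler0 addr0.
- by rewrite C5 E5 lin.
- by rewrite C6 E6 mul.
- by rewrite C7 E7 mul.
Qed.

Lemma cocycle0 X Y : cocycle (0 : coc X Y).
Proof.
by split=> *; rewrite ?ffunE ?mulmx0 ?mul0mx ?scaler0 ?addr0 // big1 // => i _;
  rewrite ffunE.
Qed.

Definition pull X' X Y Y' (b : 'M[F]_(rdim Y', rdim Y)) (z : coc X Y)
    (a : 'M[F]_(rdim X, rdim X')) : coc X' Y' := [ffun g => b *m z g *m a].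

Lemma pull_cocycle X' X Y Y' b z a : hom X' X a -> hom Y Y' b -> cocycle z ->
  cocycle (@pull X' X Y Y' b z a).
Proof.
move=> /homP ah /homP bh [C1 C2 C3 C4 C5 C6 C7].
have lin (k : F) (A A' : 'M[F]_(rdim Y, rdim X)) :
   b *m (k *: A + A') *m a = k *: (b *m A *m a) + b *m A' *m a.
  by rewrite mulmxDr mulmxDl -scalemxAr -scalemxAl.
have mul u w (A A' : 'M[F]_(rdim Y, rdim X)) :
   b *m (act Y u *m A + A' *m act X w) *m a =
   act Y' u *m (b *m A *m a) + b *m A' *m a *m act X' w.
  by rewrite mulmxDr mulmxDl !mulmxA bh -!mulmxA ah.
split=> *; rewrite ?ffunE.
- by rewrite C1 lin.
- by rewrite C2 mul.
- by rewrite -mul C3 // mulmx0 mul0mx.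
- under eq_bigr => i _ do rewrite !ffunE.
  by rewrite -mulmx_suml -mulmx_sumr C4 mulmx0 mul0mx.
- by rewrite C5 lin.
- by rewrite C6 mul.
- by rewrite C7 mul.
Qed.

(** * Averaging over the unit groups of the K_i *)

Lemma natr_card : #|F|%:R = 0 :> F.
Proof.
rewrite -sumr_const; apply: (addrI (\sum_(a : F) a)); rewrite addr0 -big_split /=.
by rewrite [RHS](reindex_inj (addIr 1)).
Qed.

Lemma sdim_gt0 i : (0 < sdim S i)%N.
Proof.
rewrite lt0n; apply/eqP=> d0; have := memvf (1 : sD S i).
by move/eqP: d0; rewrite dimv_eq0 => /eqP->; rewrite memv0 oner_eq0.
Qed.

Lemma card_sD i : #|finvect_type (sD S i)| = (#|F| ^ sdim S i)%N.
Proof.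
rewrite /sdim -(@card_vspace F (finvect_type (sD S i))).
by apply/esym/eq_card=> a; exact: memvf.
Qed.

(** There are |K_i| - 1 units, and |K_i| is zero in k. *)
Lemma sum_units i (V : lmodType F) (x : V) :
  \sum_(a : finvect_type (sD S i) | a != 0) x = - x.
Proof.
have sum0 : \sum_(a : finvect_type (sD S i)) x = 0.
  rewrite sumr_const card_sD -scaler_nat natrX natr_card expr0n.
  by rewrite eqn0Ngt sdim_gt0 scale0r.
apply: (addrI x); rewrite subrr -[RHS]sum0.
by rewrite [RHS](bigD1 (0 : finvect_type (sD S i))).
Qed.

Lemma actD0 X i : is_mod X -> act X (gD (0 : sD S i)) = 0.
Proof.
case=> D1 _ _ _ _ _ _; have := D1 i (-1) 0 0.
by rewrite scaler0 addr0 scaleN1r addNr.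
Qed.

(** The potential of a cocycle: since |K_i| is zero in k, summing the cocycle
    identity over the units of the K_i exhibits it as inner on D, which is how
    separability of the K_i over the finite field k enters. *)
Definition potential X Y (z : coc X Y) : 'M[F]_(rdim Y, rdim X) :=
  \sum_i \sum_(a : finvect_type (sD S i) | a != 0)
     z (gD (a : sD S i)) *m act X (gD (a^-1 : sD S i)).

Lemma cocycle_inner X Y (z : coc X Y) j (b : sD S j) :
  is_mod X -> is_mod Y -> cocycle z ->
  z (gD b) = cob (potential z) (gD b).
Proof.
move=> Xm Ym [C1 C2 C3 C4 _ _ _]; rewrite ffunE.
have [->|b0] := eqVneq b 0.
  have := C1 j (-1) 0 0; rewrite !actD0 // mul0mx mulmx0 subrr.
  by rewrite scaler0 addr0 scaleN1r addNr.
pose K i := finvect_type (sD S i).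
case: (Xm) => X1 X2 X3 X4 _ _ _.
pose T := \sum_(a : K j | a != 0) z (gD (b * a : sD S j)) *m act X (gD (a^-1 : sD S j)).
have TE : potential z *m act X (gD b) = T.
  rewrite /potential mulmx_suml (bigD1 j) //= [X in _ + X]big1 => [|i ij].
    rewrite addr0 mulmx_suml /T (reindex_inj (mulfI (b0 : (b : K j) != 0))) /=.
    apply: eq_big => [a|a a0]; first by rewrite mulf_eq0 (negPf b0).
    rewrite -mulmxA -X2; congr (_ *m act X (gD _)).
    by rewrite invfM mulrAC mulVf // mul1r.
  by rewrite mulmx_suml big1 // => a _; rewrite -mulmxA X3 // mulmx0.
have pE : act Y (gD b) *m potential z = T + z (gD b).
  rewrite /potential mulmx_sumr.
  transitivity (\sum_i ((if i == j then T else 0) + z (gD b) *m act X (gD (1 : sD S i)))).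
    apply: eq_bigr => i _; rewrite mulmx_sumr.
    have -> : z (gD b) *m act X (gD (1 : sD S i)) =
        - \sum_(a : K i | a != 0) z (gD b) *m act X (gD (a : sD S i)) *m
             act X (gD (a^-1 : sD S i)).
      rewrite -[LHS]opprK; congr (- _); rewrite -(@sum_units i).
      by apply: eq_bigr => a a0; rewrite -mulmxA -X2 mulfV.
    have [e|ij] := eqVneq i j.
      subst i; rewrite /T -sumrB; apply: eq_bigr => a a0.
      by rewrite C2 mulmxDl addrK mulmxA.
    rewrite add0r -sumrN; apply: eq_bigr => a a0.
    rewrite mulmxA; apply/eqP; rewrite -addr_eq0 -mulmxDl C3 ?mul0mx //.
    by rewrite eq_sym.
  rewrite big_split /= -mulmx_sumr X4 mulmx1; congr (_ + _).
  by rewrite -big_mkcond /= big_pred1_eq.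
by rewrite TE pE addrC addKr.
Qed.

End Modules.

Arguments homP {F n S X Y f}.

(** * Splitting over the semisimple subalgebra *)

Section EulerForm.
Variables (F : finFieldType) (n : nat) (S : species F n).
Implicit Types X Y L Z : rawmod S.

Local Notation hom X Y f := (@is_hom F n S X Y f).
Local Notation coc X Y := {ffun gens S -> 'M[F]_(rdim Y, rdim X)}.
Local Notation q := #|F|.

(** Short exact sequences whose splitting is by homomorphisms; they are used
    for the D-modules, over which every sequence splits. *)
Record dses Y L X f g p s : Prop := DSes {
  dses_ses : @ses F n S Y L X f g p s;
  dses_g : hom L Y g; dses_s : hom X L s }.

(** The potential of the coboundary of a linear retraction corrects it to a
    D-linear one, so that D is semisimple. *)
Lemma Dretract X L (f : 'M_(rdim L, rdim X)) r : is_mod L -> is_mod X ->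
  hom (Dres X) (Dres L) f -> r *m f = 1%:M ->
  exists r', hom (Dres L) (Dres X) r' /\ r' *m f = 1%:M.
Proof.
move=> /DresP Lm /DresP Xm fh rf.
pose z : coc (Dres L) (Dres X) := cob (X := Dres L) (Y := Dres X) r.
have zc : cocycle z by apply: cob_cocycle.
exists (r - potential z); split; last first.
  rewrite mulmxBl rf [X in _ - X](_ : _ = 0) ?subr0 //.
  rewrite mulmx_suml big1 // => i _; rewrite mulmx_suml big1 // => a _.
  rewrite -mulmxA -(homP fh) ffunE mulmxA mulmxBl -!mulmxA rf mulmx1.
  by rewrite -(homP fh) !mulmxA rf mul1mx subrr mul0mx.
apply/homP=> -[[i a]|u]; last by rewrite mul0mx mulmx0.
have := cocycle_inner a Lm Xm zc; rewrite !ffunE => E.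
have sub_swap (V : zmodType) (x y w t : V) : x - y = w - t -> y - t = x - w.
  by move=> e; rewrite -[y](subKr x) e opprB addrA addrAC addrK.
by rewrite mulmxBl mulmxBr; apply: sub_swap.
Qed.

Lemma Dsplit Y L X f g p s : is_mod L -> is_mod Y ->
  @ses F n S (Dres Y) (Dres L) (Dres X) f g p s ->
  exists g' s', dses (Y := Dres Y) (L := Dres L) (X := Dres X) f g' p s'.
Proof.
move=> Lm Ym [fh ph spl].
have [g' [g'h g'f]] := Dretract Lm Ym fh (split_gf spl).
have e : f *m g' + (s - f *m g' *m s) *m p = 1%:M.
  have sp : s *m p = 1%:M - f *m g by rewrite -(split_fg spl) addrC addKr.
  rewrite mulmxBl -(mulmxA (f *m g')) !sp mulmxBr mulmx1 mulmxA.
  rewrite -(mulmxA f) g'f mulmx1 opprB [X in _ + X]addrA subrK.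
  by rewrite addrCA subrr addr0.
have ps' : p *m (s - f *m g' *m s) = 1%:M.
  by rewrite mulmxBr (split_ps spl) !mulmxA (split_pf spl) !mul0mx subr0.
have spl' : splits f g' p (s - f *m g' *m s) by split.
exists g', (s - f *m g' *m s); split; [exact: Ses | by [] | ].
set s' := s - _ in e ps' spl' *.
have s'p : s' *m p = 1%:M - f *m g' by rewrite -e addrC addKr.
apply/homP=> x.
have -> : act (Dres X) x = p *m act (Dres L) x *m s'.
  by rewrite (homP ph) -mulmxA ps' mulmx1.
rewrite !mulmxA s'p !mulmxBl mul1mx -!mulmxA (mulmxA g') (homP g'h).
by rewrite -mulmxA (split_gs spl') !mulmx0 subr0.
Qed.

Lemma actD_idem X i : is_mod X ->
  act X (gD (1 : sD S i)) *m act X (gD (1 : sD S i)) = act X (gD (1 : sD S i)).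
Proof. by case=> _ D2 _ _ _ _ _; rewrite -D2 mulr1. Qed.

(** The i-th component e_i X of a module, with e_i the unit of K_i. *)
Definition Epart X i : {set 'cV[F]_(rdim X)} :=
  [set u | act X (gD (1 : sD S i)) *m u == u]%SET.

Definition edim X i : nat :=
  \dim <<[seq act X (gD (1 : sD S i)) *m u | u in [set: 'cV[F]_(rdim X)]%SET]>>%VS.

Definition mlt X i : nat := (edim X i %/ sdim S i)%N.

Lemma dimvecE X i : dimvec X i 0 = (mlt X i)%:Z.
Proof. by rewrite mxE. Qed.

Lemma card_image_span (X : rawmod S) i (U : {set 'cV[F]_(rdim X)}) :
  subspace U ->
  (q ^ \dim <<[seq act X (gD (1 : sD S i)) *m u | u in U]>>%VS
   = #|[set act X (gD (1 : sD S i)) *m u | u in U]%SET|)%N.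
Proof.
move=> [U0 Ucl]; set V := [set _ | _ in _]%SET.
rewrite (_ : <<_>>%VS = <<enum V>>%VS); last first.
  apply: eq_span => w; apply/idP/idP=> [/mapP[u]|].
    by rewrite !mem_enum => uU ->; apply: imset_f.
  by rewrite mem_enum => /imsetP[u uU ->]; apply: map_f; rewrite mem_enum.
rewrite cardE -card_span ?enum_uniq //.
  rewrite mem_enum; apply/imsetP; exists 0 => //; by rewrite mulmx0.
move=> c u w; rewrite !mem_enum => /imsetP[u' u'U ->] /imsetP[w' w'U ->].
apply/imsetP; exists (c *: u' + w'); first exact: Ucl.
by rewrite mulmxDr scalemxAr.
Qed.

Lemma card_Epart X i : is_mod X -> #|Epart X i| = (q ^ edim X i)%N.
Proof.
move=> Xm; rewrite card_image_span; last by split=> *; rewrite inE.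
apply: eq_card => u; rewrite inE; apply/eqP/imsetP=> [ue|[w _ ->]].
  by exists u; rewrite ?inE.
by rewrite mulmxA actD_idem.
Qed.

Lemma card_Eimage Y X f g i : is_mod Y -> hom Y X f -> g *m f = 1%:M ->
  #|[set act X (gD (1 : sD S i)) *m u | u in [set f *m w | w : 'cV_(rdim Y)]%SET]%SET|
  = #|Epart Y i|.
Proof.
move=> Ym fh gf; rewrite -(card_imset _ (retract_inj gf)); apply: eq_card => u.
apply/imsetP/imsetP=> [[_ /imsetP[w _ ->] ->]|[w wE ->]].
  exists (act Y (gD (1 : sD S i)) *m w); first by rewrite inE mulmxA actD_idem.
  by rewrite mulmxA -(homP fh) mulmxA.
exists (f *m w); first by apply/imsetP; exists w.
by move: wE; rewrite inE mulmxA -(homP fh) -mulmxA => /eqP->.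
Qed.

Lemma q_gt1 : (1 < q)%N.
Proof. exact: finRing_gt1. Qed.

Lemma expq_inj a b : (q ^ a = q ^ b)%N -> a = b.
Proof. by move/eqP; rewrite eqn_exp2l ?q_gt1 // => /eqP. Qed.

(** Over k the sequence splits, and acting by the idempotent e_i is exact:
    vectors of e_i L project onto e_i X with fibres translates of e_i Y. *)
Lemma edimD Y L X f g p s i : is_mod L -> @ses F n S Y L X f g p s ->
  edim L i = (edim Y i + edim X i)%N.
Proof.
move=> Lm YLX; have Ym := ses_modl YLX Lm; have Xm := ses_modr YLX Lm.
case: YLX => fh ph spl; apply: expq_inj; rewrite expnD -!card_Epart //.
have imp : [set p *m u | u in Epart L i]%SET = Epart X i.
  apply/setP=> u; apply/imsetP/idP=> [[w]|].
    by rewrite !inE => /eqP wE ->; rewrite mulmxA -(homP ph) -mulmxA wE.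
  rewrite inE => /eqP uE; exists (act L (gD (1 : sD S i)) *m (s *m u)).
    by rewrite inE mulmxA actD_idem.
  by rewrite mulmxA (homP ph) -mulmxA (mulmxA p) (split_ps spl) mul1mx uE.
have LE a b : a \in Epart L i -> b \in Epart L i -> a - b \in Epart L i.
  by rewrite !inE => /eqP aE /eqP bE; rewrite mulmxBr aE bE.
rewrite (@card_additive _ _ _ (mulmx p)) //; last 2 first.
  by rewrite inE mulmx0.
  by move=> a b _ _; rewrite mulmxBr.
rewrite imp mulnC; congr (_ * _)%N.
rewrite -(card_imset (Epart Y i) (retract_inj (split_gf spl))).
apply: eq_card => u; rewrite !inE; apply/andP/imsetP=> [[/eqP uE /eqP pu]|[w]].
  have uf := split_ker spl pu; exists (g *m u) => //; rewrite inE; apply/eqP.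
  apply: (retract_inj (split_gf spl)); rewrite mulmxA (homP fh) -mulmxA -uf.
  exact: uE.
rewrite inE => /eqP wE ->; rewrite !mulmxA (split_pf spl) mul0mx eqxx.
by rewrite -(homP fh) -mulmxA wE.
Qed.

End EulerForm.

(** * Modules over the semisimple subalgebra *)

Section DModules.
Variables (F : finFieldType) (n : nat) (S : species F n).
Implicit Types X Y L Z : rawmod S.

Local Notation hom X Y f := (@is_hom F n S X Y f).

Lemma mx_ext m p (A B : 'M[F]_(m, p)) : (forall v : 'cV_p, A *m v = B *m v) -> A = B.
Proof.
move=> AB; apply/matrixP=> i j; have /matrixP/(_ i 0) := AB (delta_mx j 0).
by rewrite -!colE !mxE.
Qed.

Lemma splits_dim r d t (f : 'M[F]_(d, r)) g (p : 'M[F]_(t, d)) s :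
  splits f g p s -> d = (r + t)%N.
Proof.
move=> spl; have pf := split_pf spl; have gs := split_gs spl.
case: spl => gf ps fg; apply/eqP; rewrite eqn_leq; apply/andP; split.
  by apply: (@mulmx1_min F _ _ (row_mx f s) (col_mx g p)); rewrite mul_row_col.
apply: (@mulmx1_min F _ _ (col_mx g p) (row_mx f s)).
by rewrite mul_col_row gf ps pf gs scalar_mx_block.
Qed.

Definition Kvec i (v : 'cV[F]_(\dim {:sD S i})) : sD S i :=
  \sum_c v c 0 *: (vbasis {:sD S i})`_c.
Definition vecK i (a : sD S i) : 'cV[F]_(\dim {:sD S i}) :=
  \col_c coord (vbasis {:sD S i}) c a.

Lemma vecKK i : cancel (@vecK i) (@Kvec i).
Proof.
move=> a; rewrite [RHS](coord_vbasis (memvf a)).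
by apply: eq_bigr => c _; rewrite mxE.
Qed.

Lemma KvecK i : cancel (@Kvec i) (@vecK i).
Proof.
move=> v; apply/matrixP=> c j; rewrite mxE ord1 coord_sum_free //.
exact: basis_free (vbasisP _).
Qed.

Lemma Kvec_regmx i (a : sD S i) v : Kvec (regmx a *m v) = a * Kvec v.
Proof.
have reg (c : 'I_(\dim {:sD S i})) : a * (vbasis {:sD S i})`_c =
    \sum_k regmx a k c *: (vbasis {:sD S i})`_k.
  rewrite [LHS](coord_vbasis (memvf _)).
  by apply: eq_bigr => k _; rewrite mxE.
rewrite /Kvec mulr_sumr; under [RHS]eq_bigr => c _.
  rewrite -scalerAr reg scaler_sumr; over.
rewrite exchange_big /=; apply: eq_bigr => k _.
by rewrite mxE scaler_suml; apply: eq_bigr => c _; rewrite scalerA mulrC.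
Qed.

Lemma actD_Kvec X i (v : 'cV[F]_(\dim {:sD S i})) : is_mod X ->
  act X (gD (Kvec v)) = \sum_c v c 0 *: act X (gD (vbasis {:sD S i})`_c).
Proof.
move=> Xm; have [D1 _ _ _ _ _ _] := Xm.
rewrite /Kvec; elim: (index_enum _) => [|c r IH]; first by rewrite !big_nil actD0.
by rewrite !big_cons D1 IH.
Qed.

(** The map a |-> a u, injective as K_i is a field. *)
Lemma simple_embed X i (u : 'cV_(rdim X)) : is_mod X -> act X (gD (1 : sD S i)) *m u = u ->
  u != 0 ->
  exists (f : 'M_(rdim X, sdim S i)) g,
    hom (Dres (simple S i)) (Dres X) f /\ g *m f = 1%:M.
Proof.
move=> Xm eu u0; have [_ X2 X3 _ _ _ _] := Xm.
pose f := \matrix_(r < rdim X, c < \dim {:sD S i}) (act X (gD (vbasis {:sD S i})`_c) *m u) r 0.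
have fE v : f *m v = act X (gD (Kvec v)) *m u.
  rewrite actD_Kvec // mulmx_suml; apply/matrixP=> r j; rewrite !ord1 mxE summxE.
  by apply: eq_bigr => c _; rewrite -scalemxAl [RHS]mxE /f mxE mulrC.
have fh : hom (Dres (simple S i)) (Dres X) f.
  apply/homP=> -[[j a]|w]; last by rewrite mulmx0 mul0mx.
  rewrite -/(gD (a : sD S j)) -[act (Dres _) _]/(act (simple S i) (gD a)).
  rewrite -[act (Dres _) _]/(act X (gD a)).
  apply: mx_ext => v; rewrite -!mulmxA; have [e|ji] := eqVneq j i; last first.
    by rewrite raw_simple_gD0 // mul0mx mulmx0 fE mulmxA X3 // mul0mx.
  by subst j; rewrite raw_simple_gD !fE Kvec_regmx X2 mulmxA.
have fi : mx_inj f.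
  move=> v w; rewrite !fE => vw; apply: (can_inj (@KvecK i)); apply/eqP.
  apply: contraNT u0; rewrite -subr_eq0 => d0.
  rewrite -eu -(mulVf d0) X2 -mulmxA.
  have -> : Kvec v - Kvec w = Kvec (v - w).
    by rewrite /Kvec -sumrB; apply: eq_bigr => c _; rewrite !mxE scalerBl.
  by rewrite -fE mulmxBr !fE vw subrr mulmx0.
by have [g gf] := mx_inj_retract fi; exists f, g.
Qed.

Lemma exists_Epart X : is_mod X -> rdim X != 0%N ->
  exists i (u : 'cV_(rdim X)), act X (gD (1 : sD S i)) *m u = u /\ u != 0.
Proof.
move=> Xm X0; have [/existsP[i Ei]|/existsPn E0] :=
    boolP [exists i, act X (gD (1 : sD S i)) != 0].
  have [v vi] : exists v : 'cV_(rdim X), act X (gD (1 : sD S i)) *m v != 0.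
    apply: contrapT => /forallNP av; move/eqP: Ei; apply; apply: mx_ext => v.
    by rewrite mul0mx; apply/eqP/negPn/negP/av.
  by exists i, (act X (gD (1 : sD S i)) *m v); rewrite mulmxA actD_idem.
case: Xm => _ _ _ D4 _ _ _; move/eqP: X0; case: X E0 D4 => -[|d] //= a E0.
rewrite big1 => [|i _]; last by apply/eqP/negPn/E0.
by move/matrixP/(_ 0 0)/eqP; rewrite !mxE eq_sym oner_eq0.
Qed.

(** Over the semisimple algebra D every module is a direct sum of copies of the
    S_i; this is the induction principle that this gives. *)
Lemma Dind (Pr : rawmod S -> Prop) :
  (forall X, is_mod X -> rdim X = 0%N -> Pr X) ->
  (forall i L X f g p s, is_mod L -> is_mod X ->
    @dses F n S (Dres (simple S i)) (Dres L) (Dres X) f g p s -> Pr X -> Pr L) ->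
  forall X, is_mod X -> Pr X.
Proof.
move=> P0 PS X; have [m] := ubnP (rdim X); elim: m X => // m IH L Lm LM.
have [L0|L0] := eqVneq (rdim L) 0%N; first exact: P0.
have [i [u [eu u0]]] := exists_Epart LM L0.
have [f [g [fh gf]]] := simple_embed LM eu u0.
have [X [p [s LX]]] := inj_ses fh gf.
have XM := ses_modr LX (DresP LM).
have LX' : @ses F n S (Dres (simple S i)) (Dres L) (Dres X) f g p s.
  case: LX => _ ph spl; split=> //; apply/homP=> -[w|w] /=.
    exact: (homP ph (inl w)).
  by rewrite mulmx0 mul0mx.
have [g' [s' dLX]] := Dsplit LM (modP (simple S i)) LX'.
apply: PS dLX _ => //; apply: IH => //.
have := splits_dim (ses_split LX) => /= dE.
rewrite ltnS in Lm; apply: leq_trans Lm; rewrite dE -[X in (X <= _)%N]add1n leq_add2r.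
exact: sdim_gt0.
Qed.

Lemma edim_simple i j : edim (simple S i) j = (if i == j then sdim S j else 0)%N.
Proof.
apply: (@expq_inj F); rewrite -card_Epart; last exact: modP.
have [e|ij] := eqVneq i j.
  subst j; rewrite (_ : Epart (simple S i) i = [set: 'cV[F]_(rdim (simple S i))]%SET).
    by rewrite cardsT card_mx muln1.
  apply/setP=> u; rewrite !inE /Epart raw_simple_gD regmx1 mul1mx.
  exact: eqxx.
rewrite expn0 (_ : Epart _ _ = [set 0]%SET) ?cards1 //.
by apply/setP=> u; rewrite !inE raw_simple_gD0 1?eq_sym // mul0mx eq_sym.
Qed.

(** By induction on the D-module, as e_i S_j is either 0 or K_i. *)
Lemma edim_dvd X i : is_mod X -> (sdim S i %| edim X i)%N.
Proof.
move: X; apply: Dind => [X Xm X0|j L X f g p s Lm Xm [] LX _ _ IH].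
  suff -> : edim X i = 0%N by [].
  apply: (@expq_inj F); rewrite -card_Epart // expn0; apply/eqP.
  rewrite eqn_leq; apply/andP; split; last first.
    by apply/card_gt0P; exists 0; rewrite inE mulmx0.
  apply: leq_trans (max_card _) _; rewrite card_mx /= muln1 X0 //.
have := edimD i (DresP Lm) LX.
rewrite -[edim (Dres L) i]/(edim L i) -[edim (Dres X) i]/(edim X i) => ->.
rewrite -[edim (Dres _) i]/(edim (simple S j) i) edim_simple dvdn_addr //.
by case: ifP.
Qed.

Lemma mltD Y L X f g p s i : is_mod L -> @ses F n S Y L X f g p s ->
  mlt L i = (mlt Y i + mlt X i)%N.
Proof.
move=> Lm LX; rewrite /mlt (edimD i Lm LX) divnDl //.
by apply: edim_dvd; apply: ses_modl LX Lm.
Qed.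

Lemma mlt_simple i j : mlt (simple S i) j = (i == j).
Proof.
by rewrite /mlt edim_simple; case: eqP => _; rewrite ?div0n // divnn sdim_gt0.
Qed.

Lemma mlt0 X i : is_mod X -> rdim X = 0%N -> mlt X i = 0%N.
Proof.
move=> Xm X0; rewrite /mlt (_ : edim X i = 0%N) ?div0n //.
apply: (@expq_inj F); rewrite -card_Epart // expn0; apply/eqP.
rewrite eqn_leq; apply/andP; split; last first.
  by apply/card_gt0P; exists 0; rewrite inE mulmx0.
by apply: leq_trans (max_card _) _; rewrite card_mx /= muln1 X0.
Qed.

Lemma dimvecD Y L X f g p s : is_mod L -> @ses F n S Y L X f g p s ->
  dimvec L = dimvec Y + dimvec X.
Proof.
move=> Lm LX; apply/matrixP=> i j; rewrite ord1 [RHS]mxE !dimvecE.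
by rewrite (mltD i Lm LX) PoszD.
Qed.

(** A subset A of the cochains that is closed under addition and functorial
    for D-linear maps is a biadditive functor, hence its cardinality on any
    pair is determined by its values on the simples. It will be applied to
    D-linear maps and to cocycles vanishing on D. *)
Section Bifunctor.
Variables (G : finType).
Variable A : forall X Y, {set {ffun G -> 'M[F]_(rdim Y, rdim X)}}.
Hypothesis A0 : forall X Y, 0 \in A X Y.
Hypothesis AD : forall X Y z z', z \in A X Y -> z' \in A X Y -> z + z' \in A X Y.
Hypothesis Apull : forall X' X Y Y' b z a,
  hom (Dres X') (Dres X) a -> hom (Dres Y) (Dres Y') b -> z \in A X Y ->
  [ffun x => b *m z x *m a] \in A X' Y'.

Lemma card_bifunctor_l Y L X f g p s Z :
  @dses F n S (Dres Y) (Dres L) (Dres X) f g p s ->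
  #|A L Z| = (#|A Y Z| * #|A X Z|)%N.
Proof.
move=> [[fh ph spl] gh sh].
pose phi (z : {ffun G -> 'M[F]_(rdim Z, rdim L)}) :
  {ffun G -> 'M[F]_(rdim Z, rdim Y)} * {ffun G -> 'M[F]_(rdim Z, rdim X)} :=
  ([ffun x => z x *m f], [ffun x => z x *m s]).
have phi_inj : injective phi.
  move=> z z' [/ffunP zf /ffunP zs]; apply/ffunP=> x.
  move: (zf x) (zs x); rewrite !ffunE => ef es.
  rewrite -[LHS]mulmx1 -[RHS]mulmx1 -(split_fg spl) !mulmxDr !mulmxA.
  by rewrite ef es.
have id1 : hom (Dres Z) (Dres Z) 1%:M := is_hom1 _.
rewrite -cardsX -(card_imset _ phi_inj); apply: eq_card => -[z1 z2].
apply/imsetP/idP=> [[z zA [-> ->]]|].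
  rewrite inE /=; apply/andP; split.
    suff -> : [ffun x => z x *m f] = [ffun x => 1%:M *m z x *m f].
      exact: Apull.
    by apply/ffunP=> x; rewrite !ffunE ?mul1mx ?mulmx1.
  suff -> : [ffun x => z x *m s] = [ffun x => 1%:M *m z x *m s].
      exact: Apull.
    by apply/ffunP=> x; rewrite !ffunE ?mul1mx ?mulmx1.
rewrite inE /= => /andP[z1A z2A].
have := AD (Apull gh id1 z1A) (Apull ph id1 z2A) => zA.
eexists; first exact: zA.
congr pair; apply/ffunP=> x; rewrite !ffunE !mul1mx mulmxDl -!mulmxA.
  by rewrite (split_gf spl) (split_pf spl) mulmx1 mulmx0 addr0.
by rewrite (split_ps spl) (split_gs spl) mulmx1 mulmx0 add0r.
Qed.

Lemma card_bifunctor_r Y L X f g p s Z :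
  @dses F n S (Dres Y) (Dres L) (Dres X) f g p s ->
  #|A Z L| = (#|A Z Y| * #|A Z X|)%N.
Proof.
move=> [[fh ph spl] gh sh].
pose phi (z : {ffun G -> 'M[F]_(rdim L, rdim Z)}) :
  {ffun G -> 'M[F]_(rdim Y, rdim Z)} * {ffun G -> 'M[F]_(rdim X, rdim Z)} :=
  ([ffun x => g *m z x], [ffun x => p *m z x]).
have phi_inj : injective phi.
  move=> z z' [/ffunP zf /ffunP zs]; apply/ffunP=> x.
  move: (zf x) (zs x); rewrite !ffunE => ef es.
  rewrite -[LHS]mul1mx -[RHS]mul1mx -(split_fg spl) !mulmxDl -!mulmxA.
  by rewrite ef es.
have id1 : hom (Dres Z) (Dres Z) 1%:M := is_hom1 _.
rewrite -cardsX -(card_imset _ phi_inj); apply: eq_card => -[z1 z2].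
apply/imsetP/idP=> [[z zA [-> ->]]|].
  rewrite inE /=; apply/andP; split.
    suff -> : [ffun x => g *m z x] = [ffun x => g *m z x *m 1%:M].
      exact: Apull.
    by apply/ffunP=> x; rewrite !ffunE ?mul1mx ?mulmx1.
  suff -> : [ffun x => p *m z x] = [ffun x => p *m z x *m 1%:M].
      exact: Apull.
    by apply/ffunP=> x; rewrite !ffunE ?mul1mx ?mulmx1.
rewrite inE /= => /andP[z1A z2A].
have := AD (Apull id1 fh z1A) (Apull id1 sh z2A) => zA.
eexists; first exact: zA.
congr pair; apply/ffunP=> x; rewrite !ffunE !mulmx1 mulmxDr !mulmxA.
  by rewrite (split_gf spl) (split_gs spl) mul1mx mul0mx addr0.
by rewrite (split_ps spl) (split_pf spl) mul1mx mul0mx add0r.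
Qed.

Lemma card_bifunctor0 X Y : rdim X = 0%N \/ rdim Y = 0%N -> #|A X Y| = 1%N.
Proof.
move=> XY0; apply/eqP; rewrite eqn_leq; apply/andP; split; last first.
  by apply/card_gt0P; exists 0; exact: A0.
apply: leq_trans (max_card _) _; rewrite card_ffun card_mx.
by case: XY0 => ->; rewrite ?muln0 ?mul0n expn0 exp1n.
Qed.

Lemma card_bifunctor X Y : is_mod X -> is_mod Y ->
  #|A X Y| = (\prod_i \prod_j #|A (simple S i) (simple S j)| ^ (mlt X i * mlt Y j))%N.
Proof.
move=> Xm Ym.
have right i : #|A (simple S i) Y| = (\prod_j #|A (simple S i) (simple S j)| ^ mlt Y j)%N.
  move: Y Ym; apply: Dind => [Y Ym Y0|j L Y f g p s Lm Ym LY IH].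
    rewrite card_bifunctor0; last by right.
    by rewrite big1 // => j _; rewrite mlt0.
  rewrite (card_bifunctor_r _ LY) IH.
  have mE k : mlt L k = ((j == k) + mlt Y k)%N.
    by case: LY => LY _ _; rewrite -(mlt_simple j k); exact: (mltD k (DresP Lm) LY).
  under [RHS]eq_bigr => k _ do rewrite mE expnD.
  rewrite big_split /=; congr (_ * _)%N.
  rewrite (bigD1 j) //= eqxx expn1 big1 ?muln1 // => k kj.
  by rewrite eq_sym (negPf kj).
transitivity (\prod_i #|A (simple S i) Y| ^ mlt X i)%N; last first.
  apply: eq_bigr => i _; rewrite right.
  rewrite (big_morph (fun x => x ^ mlt X i)%N (fun x y => expnMn x y _) (exp1n _)).
  by apply: eq_bigr => j _; rewrite -expnM mulnC.
move: X Xm; apply: Dind => [X Xm X0|j L X f g p s Lm Xm LX IH].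
  rewrite card_bifunctor0; last by left.
  by rewrite big1 // => j _; rewrite mlt0.
rewrite (card_bifunctor_l _ LX) IH.
have mE k : mlt L k = ((j == k) + mlt X k)%N.
  by case: LX => LX _ _; rewrite -(mlt_simple j k); exact: (mltD k (DresP Lm) LX).
under [RHS]eq_bigr => k _ do rewrite mE expnD.
rewrite big_split /=; congr (_ * _)%N.
rewrite (bigD1 j) //= eqxx expn1 big1 ?muln1 // => k kj.
by rewrite eq_sym (negPf kj).
Qed.
End Bifunctor.

End DModules.

(** * Hom and Ext through the semisimple subalgebra *)

Section Euler.
Variables (F : finFieldType) (n : nat) (S : species F n).
Implicit Types X Y L Z : rawmod S.

Local Notation hom X Y f := (@is_hom F n S X Y f).
Local Notation coc X Y := {ffun gens S -> 'M[F]_(rdim Y, rdim X)}.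
Local Notation q := #|F|.
Local Notation Homs X Y := (@Defs.Hom F n S X Y).

Lemma card_Hom X Y : #|Homs X Y| = (q ^ dimHom X Y)%N.
Proof.
rewrite cardE -card_span ?enum_uniq // ?mem_enum ?inE ?hom0 //.
by move=> c u w; rewrite !mem_enum !inE; apply: homZD.
Qed.

Definition dimZ1 X Y := \dim <<enum (Z1 X Y)>>%VS.
Definition dimB1 X Y := \dim <<enum (B1 X Y)>>%VS.

Lemma card_Z1 X Y : is_mod X -> is_mod Y -> #|Z1 X Y| = (q ^ dimZ1 X Y)%N.
Proof.
move=> Xm Ym; rewrite cardE -card_span ?enum_uniq // ?mem_enum.
  exact/Z1P/cocycle0.
move=> c u w; rewrite !mem_enum => /(Z1P _ Xm Ym) uc /(Z1P _ Xm Ym) wc.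
exact/Z1P/cocycleZD.
Qed.

Lemma cobZD X Y (c : F) h h' : @cob F n S X Y (c *: h + h') = c *: cob h + cob h'.
Proof.
apply/ffunP=> g; rewrite !ffunE mulmxDr mulmxDl -scalemxAr -scalemxAl.
by rewrite opprD scalerBr addrACA.
Qed.

Lemma cobB X Y h h' : @cob F n S X Y (h - h') = cob h - cob h'.
Proof. by rewrite addrC -scaleN1r cobZD scaleN1r addrC. Qed.

Lemma cob0 X Y : @cob F n S X Y 0 = 0.
Proof. by apply/ffunP=> g; rewrite !ffunE mulmx0 mul0mx subrr. Qed.

Lemma cob_eq0 X Y h : (@cob F n S X Y h == 0) = hom X Y h.
Proof.
apply/eqP/homP=> [/ffunP h0 g|hh]; last first.
  by apply/ffunP=> g; rewrite !ffunE hh subrr.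
by have := h0 g; rewrite !ffunE => /subr0_eq.
Qed.

Lemma card_B1 X Y : #|B1 X Y| = (q ^ dimB1 X Y)%N.
Proof.
rewrite cardE -card_span ?enum_uniq // ?mem_enum.
  by apply/B1P; exists 0; rewrite cob0.
move=> c u w; rewrite !mem_enum => /B1P[h ->] /B1P[h' ->].
by apply/B1P; exists (c *: h + h'); rewrite cobZD.
Qed.

Lemma B1_Z1 X Y : is_mod X -> is_mod Y -> B1 X Y \subset Z1 X Y.
Proof.
by move=> Xm Ym; apply/fintype.subsetP=> _ /B1P[h ->]; apply/Z1P=> //; apply: cob_cocycle.
Qed.

Lemma dimB1_le X Y : is_mod X -> is_mod Y -> (dimB1 X Y <= dimZ1 X Y)%N.
Proof.
move=> Xm Ym; rewrite -(leq_exp2l _ _ (@q_gt1 F)) -card_B1 -card_Z1 //.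
exact/subset_leq_card/B1_Z1.
Qed.

(** Cocycles vanishing on D are the bimodule maps from the arrows; they depend
    only on the D-module structures. *)
Definition Z10 X Y : {set coc X Y} :=
  [set z | (z \in Z1 (Dres X) (Dres Y)) && [forall u, z (inl u) == 0]]%SET.

Lemma cocycle_Dres X Y (z : coc X Y) : (forall u, z (inl u) = 0) ->
  cocycle (X := X) (Y := Y) z <-> cocycle (X := Dres X) (Y := Dres Y) z.
Proof.
move=> z0; split=> -[C1 C2 C3 C4 C5 C6 C7]; split=> //= *.
- by rewrite C6 /gD z0 !mul0mx.
- by rewrite C7 /gD z0 !mulmx0.
- by rewrite C6 /gD z0 !mul0mx.
- by rewrite C7 /gD z0 !mulmx0.
Qed.

Lemma Z10P X Y (z : coc X Y) : is_mod X -> is_mod Y ->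
  reflect (cocycle z /\ forall u, z (inl u) = 0) (z \in Z10 X Y).
Proof.
move=> Xm Ym; rewrite inE; apply: (iffP andP).
  move=> [/(Z1P _ (DresP Xm) (DresP Ym)) zc /forallP z0].
  have z0' u : z (inl u) = 0 by apply/eqP.
  by split=> //; exact: (proj2 (cocycle_Dres z0')).
move=> [zc z0]; split; last by apply/forallP=> u; rewrite z0.
by apply/(Z1P _ (DresP Xm) (DresP Ym)); exact: (proj1 (cocycle_Dres z0)).
Qed.

Definition dimZ10 X Y := \dim <<enum (Z10 X Y)>>%VS.

Lemma card_Z10 X Y : is_mod X -> is_mod Y -> #|Z10 X Y| = (q ^ dimZ10 X Y)%N.
Proof.
move=> Xm Ym; rewrite cardE -card_span ?enum_uniq // ?mem_enum.
  by apply/Z10P => //; split=> [|u]; [exact: cocycle0 | rewrite ffunE].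
move=> c u w; rewrite !mem_enum => /(Z10P _ Xm Ym)[uc u0] /(Z10P _ Xm Ym)[wc w0].
apply/Z10P => //; split=> [|x]; first exact: cocycleZD.
by rewrite !ffunE u0 w0 scaler0 addr0.
Qed.

(** Subtract the coboundary of the potential. *)
Lemma cocycle_split X Y (z : coc X Y) : is_mod X -> is_mod Y -> cocycle z ->
  exists h, z - cob h \in Z10 X Y.
Proof.
move=> Xm Ym zc; exists (potential z); apply/Z10P=> //; split.
  have := cocycleZD (-1) (cob_cocycle (potential z) Xm Ym) zc.
  by rewrite scaleN1r addrC.
case=> i a; rewrite !ffunE; apply/eqP; rewrite subr_eq0; apply/eqP.
by rewrite -[inl _]/(gD (a : sD S i)) (cocycle_inner _ Xm Ym zc) ffunE.
Qed.

Lemma card_B1_Hom X Y : (#|B1 X Y| * #|Homs X Y| = #|'M[F]_(rdim Y, rdim X)|)%N.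
Proof.
rewrite -[RHS]cardsT [RHS](@card_additive _ _ _ (@cob F n S X Y)); first last.
- by move=> a b _ _; apply: cobB.
- by move=> *; rewrite inE.
- by rewrite inE.
congr (_ * _)%N; last by apply: eq_card => h; rewrite !inE cob_eq0.
by apply: eq_card => z; apply/B1P/imsetP=> [[h ->]|[h _ ->]]; exists h.
Qed.

(** The map (h, z) |-> cob h + z from linear maps and cocycles vanishing on D
    is onto the cocycles, and its kernel consists of the D-linear h. *)
Lemma card_Z1_Z10 X Y : is_mod X -> is_mod Y ->
  (#|Z1 X Y| * #|Homs (Dres X) (Dres Y)| = #|B1 X Y| * #|Homs X Y| * #|Z10 X Y|)%N.
Proof.
move=> Xm Ym; rewrite card_B1_Hom -[#|'M[F]_(_, _)|]cardsT -[RHS]cardsX.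
pose f (u : 'M[F]_(rdim Y, rdim X) * coc X Y) := cob (X := X) (Y := Y) u.1 + u.2.
have fB a b : f (a - b) = f a - f b.
  by rewrite /f cobB opprD addrACA.
rewrite [RHS](@card_additive ('M[F]_(rdim Y, rdim X) * coc X Y)%type _
   (finset.setX [set: 'M[F]_(rdim Y, rdim X)] (Z10 X Y)) f); first last.
- by move=> a b _ _; apply: fB.
- move=> [h z] [h' z'] /finset.setXP[_ zZ] /finset.setXP[_ z'Z].
  apply/finset.setXP; split; first by rewrite inE.
  have [zc z0] := Z10P z Xm Ym zZ; have [zc' z0'] := Z10P z' Xm Ym z'Z.
  rewrite [_.2]/= -scaleN1r addrC; apply/Z10P=> //; split; first exact: cocycleZD.
  by move=> u; rewrite !ffunE z0 z0' scaler0 addr0.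
- apply/finset.setXP; split; first by rewrite inE.
  apply/Z10P=> //.
  by split=> [|u]; [exact: cocycle0 | rewrite ffunE].
congr (_ * _)%N.
  apply: eq_card => z; apply/idP/imsetP=> [/(Z1P _ Xm Ym) zc|[[h z'] /finset.setXP[_ z'Z] ->]].
    have [h hZ] := cocycle_split Xm Ym zc.
    exists (h, z - cob h); last by rewrite /f /= addrC subrK.
    by apply/finset.setXP; rewrite inE.
  apply/Z1P=> //; rewrite /f /= -[cob _]scale1r; apply: cocycleZD.
    exact: cob_cocycle.
  by have [] := Z10P z' Xm Ym z'Z.
have cobN h : - cob (X := X) (Y := Y) h = cob (- h).
  by rewrite -[- h]sub0r cobB cob0 sub0r.
have cobD h : (h \in Homs (Dres X) (Dres Y)) = [forall u, cob (X := X) (Y := Y) h (inl u) == 0].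
  rewrite inE; apply/homP/forallP=> [hh u|h0 [u|u]] /=.
  - by rewrite ffunE subr_eq0 eq_sym; apply/eqP; exact: (hh (inl u)).
  - by have := h0 u; rewrite ffunE subr_eq0 eq_sym => /eqP.
  - by rewrite mul0mx mulmx0.
rewrite -(card_imset (Homs (Dres X) (Dres Y)) (f := fun h => (h, - cob (X := X) (Y := Y) h))); last first.
  by move=> h h' [].
apply: eq_card => -[h z]; apply/imsetP/idP=> [[h' hh [-> ->]]|].
  move: hh; rewrite cobD => /forallP h0.
  rewrite finset.in_set; apply/andP; split; last by rewrite /f /= addrN.
  apply/finset.setXP; split; first by rewrite inE.
  apply/Z10P=> //; split; first by rewrite /= cobN; apply: cob_cocycle.
  by move=> u; rewrite ffunE (eqP (h0 u)) oppr0.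
rewrite finset.in_set => /andP[/finset.setXP[_ zZ]]; rewrite /f /= addrC addr_eq0 => /eqP zE.
exists h; last by rewrite zE.
rewrite cobD; apply/forallP=> u; have [_ /(_ u)] := Z10P z Xm Ym zZ.
by rewrite zE ffunE => /eqP; rewrite oppr_eq0.
Qed.

(** The standard resolution of a module over a tensor algebra, at the level of
    cardinalities: Hom - Ext^1 is the difference of two terms that depend on
    the D-module structures alone. *)
Lemma euler_modE X Y : is_mod X -> is_mod Y ->
  euler_mod X Y = (dimHom (Dres X) (Dres Y))%:Z - (dimZ10 X Y)%:Z.
Proof.
move=> Xm Ym; have := card_Z1_Z10 Xm Ym.
rewrite card_Z1 // card_B1 card_Z10 // !card_Hom -!expnD => /expq_inj e.
rewrite /euler_mod /dimExt -/(dimZ1 X Y) -/(dimB1 X Y) -subzn ?dimB1_le //.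
by lia.
Qed.

Lemma dim_DHom X Y : is_mod X -> is_mod Y ->
  dimHom (Dres X) (Dres Y) = (\sum_i \sum_j mlt X i * mlt Y j *
     dimHom (Dres (simple S i)) (Dres (simple S j)))%N.
Proof.
move=> Xm Ym.
pose A X Y : {set {ffun unit -> 'M[F]_(rdim Y, rdim X)}} :=
  [set z : {ffun unit -> 'M[F]_(rdim Y, rdim X)} | hom (Dres X) (Dres Y) (z tt)]%SET.
have cA Z W : #|A Z W| = #|Homs (Dres Z) (Dres W)|.
  rewrite -(card_imset (Homs (Dres Z) (Dres W)) (f := fun h => [ffun=> h] : {ffun unit -> 'M[F]_(rdim W, rdim Z)})); last first.
    by move=> h h' /ffunP/(_ tt); rewrite !ffunE.
  apply: eq_card => z; rewrite inE; apply/idP/imsetP=> [zh|[h]].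
    by exists (z tt); rewrite ?inE //; apply/ffunP=> -[]; rewrite ffunE.
  by rewrite inE => hh ->; rewrite ffunE.
apply: (@expq_inj F); rewrite -card_Hom -cA card_bifunctor //; first last.
- move=> X1 X2 Y2 Y1 b z a ah bh; rewrite !inE ffunE => zh.
  by apply: (is_hom_comp ah); exact: (is_hom_comp zh).
- by move=> X1 Y1 z z'; rewrite !inE ffunE; exact: homD.
- by move=> X1 Y1; rewrite inE ffunE hom0.
rewrite expn_sum; apply: eq_bigr => i _; rewrite expn_sum; apply: eq_bigr => j _.
by rewrite cA card_Hom -expnM mulnC.
Qed.

Lemma dim_Z10 X Y : is_mod X -> is_mod Y ->
  dimZ10 X Y = (\sum_i \sum_j mlt X i * mlt Y j *
     dimZ10 (simple S i) (simple S j))%N.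
Proof.
move=> Xm Ym; pose A X Y : {set coc X Y} :=
  [set z : coc X Y | `[< cocycle (X := Dres X) (Y := Dres Y) z /\ forall u, z (inl u) = 0 >]]%SET.
have cA Z W : is_mod Z -> is_mod W -> #|A Z W| = #|Z10 Z W|.
  move=> Zm Wm; apply: eq_card => z; rewrite inE; apply/asboolP/Z10P=> //.
    by case=> zc z0; split=> //; exact: (proj2 (cocycle_Dres z0)).
  by case=> zc z0; split=> //; exact: (proj1 (cocycle_Dres z0)).
apply: (@expq_inj F); rewrite -card_Z10 // -cA // card_bifunctor //; first last.
- move=> X1 X2 Y2 Y1 b z a ah bh; rewrite !inE => /asboolP[zc z0]; apply/asboolP.
  split=> [|u]; last by rewrite ffunE z0 mulmx0 mul0mx.
  exact: (pull_cocycle ah bh zc).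
- move=> X1 Y1 z z'; rewrite !inE => /asboolP[zc z0] /asboolP[zc' z0'].
  apply/asboolP; split=> [|u]; last by rewrite ffunE z0 z0' addr0.
  by rewrite -[z]scale1r; exact: cocycleZD.
- move=> X1 Y1; rewrite inE; apply/asboolP; split=> [|u]; last by rewrite ffunE.
  exact: cocycle0.
rewrite expn_sum; apply: eq_bigr => i _; rewrite expn_sum; apply: eq_bigr => j _.
by rewrite cA ?card_Z10 -?expnM 1?mulnC //; apply: modP (simple S _).
Qed.

(** Both terms of the standard resolution are biadditive over D-modules, and a
    D-module is the sum of simples counted by its dimension vector. *)
Lemma eulerE X Y : is_mod X -> is_mod Y ->
  euler_mod X Y = euler S (dimvec X) (dimvec Y).
Proof.
move=> Xm Ym; rewrite euler_modE // dim_DHom // dim_Z10 // /euler.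
rewrite !(big_morph Posz PoszD (erefl _)) -sumrB; apply: eq_bigr => i _.
rewrite !(big_morph Posz PoszD (erefl _)) -sumrB; apply: eq_bigr => j _.
rewrite euler_modE ?(modP (simple S _)) //; [|exact: (modP (simple S _))..].
by rewrite !dimvecE mulrBr !PoszM.
Qed.

End Euler.

(** * Projective modules and the hereditary property *)

Section Projectives.
Variables (F : finFieldType) (n : nat) (S : species F n).
Implicit Types X Y L Z P : rawmod S.

Local Notation hom X Y f := (@is_hom F n S X Y f).
Local Notation coc X Y := {ffun gens S -> 'M[F]_(rdim Y, rdim X)}.
Local Notation cob X Y h := (@cob F n S X Y h).

(** Vanishing of Ext^1(X, Y). *)
Definition Ext0 X Y := forall z : coc X Y, cocycle z -> exists h, z = cob X Y h.

Lemma ext_mid_ses X Y (z : coc X Y) :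
  @ses F n S Y (ext_mid z) X (col_mx 1%:M 0) (row_mx 1%:M 0)
    (row_mx 0 1%:M) (col_mx 0 1%:M).
Proof.
split.
- apply/homP=> g /=; rewrite mul_block_col mul_col_mx.
  by rewrite !mulmx0 !mulmx1 mul1mx mul0mx !addr0.
- apply/homP=> g /=; rewrite mul_row_block mul_mx_row.
  by rewrite !mulmx0 !mulmx1 mul1mx !mul0mx !add0r.
split.
- by rewrite mul_row_col mulmx1 mulmx0 addr0.
- by rewrite mul_row_col mulmx1 mulmx0 add0r.
rewrite !mul_col_row !mul1mx !mul0mx add_block_mx.
by rewrite !addr0 !add0r -scalar_mx_block.
Qed.

Lemma cocycle_comp_inj X Y Y' (f : 'M_(rdim Y', rdim Y)) r (z : coc X Y) :
  is_mod X -> is_mod Y -> is_mod Y' ->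
  hom Y Y' f -> r *m f = 1%:M ->
  cocycle (X := X) (Y := Y') [ffun x => f *m z x] -> cocycle z.
Proof.
move=> Xm Ym Y'm fh rf /(ext_mod _ Xm Y'm) zm; apply/ext_mod => //.
refine (@is_mod_inj F n S (ext_mid z) (@ext_mid F n S X Y' [ffun x => f *m z x])
  (block_mx f 0 0 1%:M)
  (block_mx r 0 0 1%:M) _ _ zm); last first.
  by rewrite mulmx_block rf !mulmx0 !mul0mx mulmx1 !addr0 !add0r -scalar_mx_block.
apply/homP=> x /=; rewrite !mulmx_block ffunE (homP fh).
by rewrite !mulmx0 !mul0mx !mulmx1 !mul1mx !addr0 !add0r.
Qed.

Lemma cocycle_comp_surj X X' Y (p : 'M_(rdim X', rdim X)) s (z : coc X' Y) :
  is_mod X -> is_mod X' -> is_mod Y ->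
  hom X X' p -> p *m s = 1%:M ->
  cocycle (X := X) (Y := Y) [ffun x => z x *m p] -> cocycle z.
Proof.
move=> Xm X'm Ym ph ps /(ext_mod _ Xm Ym) zm; apply/ext_mod => //.
refine (@is_mod_surj F n S (@ext_mid F n S X Y [ffun x => z x *m p]) (ext_mid z)
  (block_mx 1%:M 0 0 p) (block_mx 1%:M 0 0 s) _ _ zm); last first.
  by rewrite mulmx_block ps !mulmx0 !mul0mx mulmx1 !addr0 !add0r -scalar_mx_block.
apply/homP=> x /=; rewrite !mulmx_block ffunE (homP ph).
by rewrite !mulmx0 !mul0mx !mulmx1 !mul1mx !addr0 !add0r.
Qed.

(** A homomorphic section of the extension that the cocycle defines exhibits
    it as a coboundary. *)
Lemma projective_Ext0 P Y : is_mod P -> is_mod Y -> projective P -> Ext0 P Y.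
Proof.
move=> Pm Ym Pp z zc; have Em := proj2 (ext_mod z Pm Ym) zc.
have [fh ph spl] := ext_mid_ses z.
have [h hh e] := Pp (Mod Em) (Mod Pm) _ 1%:M ph (section_surj (split_ps spl)) (is_hom1 _).
exists (- usubmx h); apply/ffunP=> x; rewrite ffunE mulmxN mulNmx opprK addrC.
move: e (homP hh x); rewrite -[h in row_mx _ _ *m h]vsubmxK mul_row_col mul0mx mul1mx add0r.
move=> hd; rewrite -[h]vsubmxK hd /= mul_block_col mul_col_mx mulmx1 col_mxKu.
by move/eq_col_mx => [-> _]; rewrite addrC addKr.
Qed.

(** The coboundary of a linear lift of f has values in the kernel of g; as a
    coboundary there, it corrects the lift to a hom. *)
Lemma Ext0_projective P : is_mod P -> (forall Y, is_mod Y -> Ext0 P Y) ->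
  projective P.
Proof.
move=> Pm P0 M N g f gh gs fh; have [s gs1] := mx_surj_section gs.
have [Y [i [r YMN]]] := surj_ses gh gs1.
have Ym := ses_modl YMN (modP M).
have [ih _ spl] := YMN.
pose z : coc P Y := [ffun x => r *m cob P M (s *m f) x].
have iz x : i *m z x = cob P M (s *m f) x.
  rewrite ffunE; apply/esym/(split_ker spl).
  rewrite ffunE mulmxBr !mulmxA (homP gh) -!mulmxA (mulmxA g s) gs1 mul1mx.
  by rewrite (mulmxA g s) gs1 mul1mx (homP fh) subrr.
have zc : cocycle z.
  apply: (cocycle_comp_inj Pm Ym (modP M) ih (split_gf spl)).
  have := cob_cocycle (s *m f) Pm (modP M); congr cocycle.
  by apply/ffunP=> x; rewrite [RHS]ffunE iz.
have [h zh] := P0 Y Ym z zc; exists (s *m f - i *m h); last first.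
  by rewrite mulmxBr !mulmxA gs1 mul1mx (split_pf spl) mul0mx subr0.
rewrite -cob_eq0 cobB; apply/eqP/ffunP=> x; rewrite ffunE.
rewrite -iz zh !ffunE mulmxBr !mulmxA (homP ih).
by rewrite addrN.
Qed.

(** Cocycles extend from a submodule: this is where the tensor algebra being
    hereditary comes from, as a D-linear retraction extends the bimodule maps. *)
Lemma cocycle_extend X' X Y f g (z' : coc X' Y) :
  is_mod X -> is_mod X' -> is_mod Y -> hom X' X f -> g *m f = 1%:M ->
  cocycle z' -> exists2 z : coc X Y, cocycle z & forall x, z x *m f = z' x.
Proof.
move=> Xm X'm Ym fh gf z'c.
have [g' [g'h g'f]] := Dretract Xm X'm (hom_Dres fh) gf.
have [h hZ] := cocycle_split X'm Ym z'c.
have [wc w0] := Z10P _ X'm Ym hZ.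
set w := z' - _ in hZ wc w0.
pose w' : coc X Y := [ffun x => 1%:M *m w x *m g'].
have w'c : cocycle (X := X) (Y := Y) w'.
  have w'0 u : w' (inl u) = 0 by rewrite ffunE w0 mulmx0 mul0mx.
  apply: (proj2 (cocycle_Dres w'0)).
  have wcD := proj1 (cocycle_Dres w0) wc.
  exact: (pull_cocycle (X' := Dres X) (Y' := Dres Y) g'h (is_hom1 (Dres Y)) wcD).
exists (cob X Y (h *m g') + w').
  by rewrite -[cob _ _ _]scale1r; apply: cocycleZD => //; apply: cob_cocycle.
move=> x; have wE : w x = z' x - (act Y x *m h - h *m act X' x).
  by rewrite /w !ffunE.
rewrite ffunE [w' x]ffunE [cob _ _ _ x]ffunE wE mul1mx.
rewrite mulmxDl mulmxBl -!mulmxA g'f mulmx1 -(homP fh).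
by rewrite (mulmxA g' f) g'f !mul1mx !mulmx1 addrC subrK.
Qed.

Lemma Ext0_sub X' X Y f g : is_mod X -> is_mod X' -> is_mod Y ->
  hom X' X f -> g *m f = 1%:M -> Ext0 X Y -> Ext0 X' Y.
Proof.
move=> Xm X'm Ym fh gf X0 z' z'c.
have [z zc zf] := cocycle_extend Xm X'm Ym fh gf z'c.
have [h zh] := X0 z zc; exists (h *m f); apply/ffunP=> x.
by rewrite -zf zh !ffunE mulmxBl -!mulmxA (homP fh).
Qed.

Lemma projective_sub X P f g : is_mod P -> is_mod X ->
  hom X P f -> g *m f = 1%:M -> projective P -> projective X.
Proof.
move=> Pm Xm fh gf Pp; apply: Ext0_projective => // Y Ym.
by apply: Ext0_sub fh gf _ => //; apply: projective_Ext0.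
Qed.

(** After subtracting a coboundary extending h, the cocycle vanishes on Y and
    so factors through the projection. *)
Lemma cocycle_descend Y L X f g p s Z (z : coc L Z) h :
  is_mod L -> is_mod Z -> @ses F n S Y L X f g p s -> cocycle z ->
  (forall x, z x *m f = cob Y Z h x) ->
  exists2 z' : coc X Z, cocycle z' &
    exists h', forall x, z x = z' x *m p + cob L Z h' x.
Proof.
move=> Lm Zm YLX zc zh; have [fh ph spl] := YLX.
have Xm := ses_modr YLX Lm.
pose w : coc L Z := z - cob L Z (h *m g).
have wc : cocycle w.
  by rewrite /w addrC -scaleN1r; apply: cocycleZD => //; apply: cob_cocycle.
have wf x : w x *m f = 0.
  rewrite !ffunE mulmxBl zh ffunE mulmxBl -!mulmxA (split_gf spl) mulmx1.
  by rewrite -(homP fh) (mulmxA g) (split_gf spl) mul1mx subrr.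
have ws x : w x = w x *m s *m p by apply: (split_coker spl).
exists [ffun x => w x *m s].
  apply: (cocycle_comp_surj Lm Xm Zm ph (split_ps spl)).
  by move: wc; congr cocycle; apply/ffunP=> x; rewrite [RHS]ffunE [X in X *m p]ffunE -ws.
exists (h *m g) => x; rewrite [in X in X *m p]ffunE -ws.
have -> : w x = z x - cob L Z (h *m g) x by rewrite /w !ffunE.
by rewrite subrK.
Qed.

Lemma Ext0_ses_l Y L X f g p s Z : is_mod L -> is_mod Z ->
  @ses F n S Y L X f g p s -> Ext0 Y Z -> Ext0 X Z -> Ext0 L Z.
Proof.
move=> Lm Zm YLX Y0 X0 z zc; have [fh ph spl] := YLX.
have Ym := ses_modl YLX Lm.
have [h zh] : exists h, [ffun x => 1%:M *m z x *m f] = cob Y Z h.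
  by apply: Y0; apply: (pull_cocycle fh (is_hom1 Z)).
have [|z' z'c [h' zE]] := cocycle_descend (h := h) Lm Zm YLX zc.
  by move=> x; rewrite -zh ffunE mul1mx.
have [h2 z'E] := X0 z' z'c; exists (h2 *m p + h'); apply/ffunP=> x.
rewrite zE z'E !ffunE mulmxBl -!mulmxA -(homP ph) !mulmxDr !mulmxDl !mulmxA.
by rewrite opprD addrACA.
Qed.

(** The composite with p becomes a coboundary, and what remains takes its
    values in Y. *)
Lemma Ext0_ses_r Y L X f g p s Z : is_mod L -> is_mod Z ->
  @ses F n S Y L X f g p s -> Ext0 Z Y -> Ext0 Z X -> Ext0 Z L.
Proof.
move=> Lm Zm YLX Y0 X0 z zc; have [fh ph spl] := YLX.
have Ym := ses_modl YLX Lm.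
have [h zh] : exists h, [ffun x => p *m z x *m 1%:M] = cob Z X h.
  by apply: X0; apply: (pull_cocycle (is_hom1 Z) ph).
pose w : coc Z L := z - cob Z L (s *m h).
have wc : cocycle w.
  by rewrite /w addrC -scaleN1r; apply: cocycleZD => //; apply: cob_cocycle.
have wf x : f *m (g *m w x) = w x.
  apply/esym/(split_ker spl); have /ffunP/(_ x) := zh.
  rewrite !ffunE mulmx1 mulmxBr => ->; rewrite mulmxBr !mulmxA (homP ph).
  by rewrite -(mulmxA _ p s) (split_ps spl) mulmx1 mul1mx subrr.
have [|h2 wE] := Y0 [ffun x => g *m w x].
  apply: (cocycle_comp_inj Zm Ym Lm fh (split_gf spl)).
  by move: wc; congr cocycle; apply/ffunP=> x; rewrite [RHS]ffunE [X in _ *m X]ffunE wf.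
exists (f *m h2 + s *m h); apply/ffunP=> x.
have : w x = f *m cob Z Y h2 x by rewrite -wE [X in _ = _ *m X]ffunE wf.
have -> : w x = z x - cob Z L (s *m h) x by rewrite /w !ffunE.
move/(canRL (subrK _)) => ->.
rewrite !ffunE mulmxBr !mulmxDr !mulmxDl !mulmxA (homP fh).
by rewrite opprD addrACA.
Qed.

Lemma projective_ses Y L X f g p s : is_mod L -> @ses F n S Y L X f g p s ->
  projective Y -> projective X -> projective L.
Proof.
move=> Lm YLX Yp Xp; have Ym := ses_modl YLX Lm; have Xm := ses_modr YLX Lm.
apply: Ext0_projective => // Z Zm.
by apply: (Ext0_ses_l Lm Zm YLX); apply: projective_Ext0.
Qed.

(** Ext^1 vanishes, so the Euler form only counts homs. *)
Lemma dimHom_proj P Y : is_mod P -> is_mod Y -> projective P ->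
  (dimHom P Y)%:Z = euler S (dimvec P) (dimvec Y).
Proof.
move=> Pm Ym Pp; rewrite -eulerE // /euler_mod /dimExt.
rewrite -/(dimZ1 P Y) -/(dimB1 P Y).
suff -> : dimZ1 P Y = dimB1 P Y by rewrite subnn subr0.
apply: (@expq_inj F); rewrite -card_Z1 // -card_B1; apply: eq_card => z.
apply/Z1P/B1P => // [|[h ->]]; last exact: cob_cocycle.
exact: projective_Ext0.
Qed.

End Projectives.

(** * Existence of projectives *)

Section Acyclic.
Variables (F : finFieldType) (n : nat) (S : species F n).
Hypothesis acS : acyclic S.
Implicit Types X Y L Z P : rawmod S.

Local Notation hom X Y f := (@is_hom F n S X Y f).
Local Notation coc X Y := {ffun gens S -> 'M[F]_(rdim Y, rdim X)}.
Local Notation cob X Y h := (@cob F n S X Y h).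

Lemma cobDx X Y h h' x : cob X Y (h + h') x = cob X Y h x + cob X Y h' x.
Proof. by rewrite -[h]scale1r cobZD !scale1r ffunE. Qed.

Lemma cob_precomp L X Z h p x : hom L X p -> cob X Z h x *m p = cob L Z (h *m p) x.
Proof. by move=> ph; rewrite !ffunE mulmxBl -!mulmxA (homP ph). Qed.

(** Otherwise, following arrows backwards inside A gives a closed walk. *)
Lemma acyclic_source (A : pred 'I_n) i0 : A i0 ->
  exists2 i, A i & forall j, A j -> \dim {:sM S i j} = 0%N.
Proof.
move=> Ai0; apply: contrapT => /forall2NP noi.
pose e i j := \dim {:sM S i j} != 0%N.
have next i : A i -> exists j, A j && e i j.
  move=> Ai; case: (noi i) => // /existsNP[j /not_implyP[Aj ne]].
  by exists j; rewrite Aj /e; apply/eqP.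
pose f i := if pick (fun j => A j && e i j) is Some j then j else i.
have fP i : A i -> A (f i) && e i (f i).
  move=> Ai; rewrite /f; case: pickP => // none; have [j] := next i Ai.
  by rewrite none.
have Ait k : A (iter k f i0) by elim: k => //= k /fP/andP[].
have : ~~ injectiveb [ffun k : 'I_n.+1 => iter k f i0].
  apply/negP=> /injectiveP/leq_card; by rewrite !card_ord ltnn.
case/injectivePn=> k1 [k2 k12]; rewrite !ffunE.
wlog k12' : k1 k2 k12 / (k1 < k2)%N.
  move=> W; case: (ltngtP k1 k2) => [lt|lt|/val_inj eq]; first exact: W.
    by move/esym; apply: W => //; rewrite eq_sym.
  by rewrite eq eqxx in k12.
move=> eqk; set y := iter k1 f i0 in eqk.
have [d kd] : exists d, (k2 = d.+1 + k1 :> nat)%N.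
  by exists (k2 - k1).-1; lia.
have /negP := acS (s := y :: traject f (f y) d) isT; apply.
have Ay k : A (iter k f y) by rewrite /y -iterD.
have -> : cycle e (y :: traject f (f y) d) = path e y (traject f (f y) d.+1).
  rewrite trajectSr [LHS]/=; congr (path e y (rcons _ _)).
  by rewrite -iterSr {1}eqk kd iterD.
have pth k z : (forall k', A (iter k' f z)) -> path e z (traject f (f z) k).
  elim: k z => //= k IH z Az; rewrite (andP (fP z (Az 0%N))).2 /=.
  by apply: IH => k'; rewrite -iterSr; exact: (Az k'.+1).
exact: pth.
Qed.

(** Take i in the support of X with no arrow into i from the support: then e_i
    X is not reached by any arrow. *)
Lemma simple_quotient X : is_mod X -> rdim X != 0%N ->
  exists i p s, hom X (simple S i) p /\ p *m s = 1%:M.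
Proof.
move=> Xm X0; have [i0 [u0 [eu0 u00]]] := exists_Epart Xm X0.
pose A i := act X (gD (1 : sD S i)) != 0.
have Ai0 : A i0.
  by apply: contraNneq u00 => e0; rewrite -eu0 e0 mul0mx.
have [i Ai Mi] := acyclic_source Ai0.
have [v vi] : exists v : 'cV_(rdim X), act X (gD (1 : sD S i)) *m v != 0.
  apply: contrapT => /forallNP av; move/eqP: Ai; apply; apply: mx_ext => v.
  by rewrite mul0mx; apply/eqP/negPn/negP/av.
have ei : act X (gD (1 : sD S i)) *m (act X (gD (1 : sD S i)) *m v) =
    act X (gD (1 : sD S i)) *m v by rewrite mulmxA actD_idem.
have [f [g [fh gf]]] := simple_embed Xm ei vi.
have [r [rh rf]] := Dretract Xm (modP (simple S i)) fh gf.
exists i, r, f; split=> //; apply/homP=> w; case: w => [u|[[k l] m]]; first exact: (homP rh (inl u)).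
rewrite [RHS]mul0mx -[inr _]/(gM (m : sM S k l)).
have [D1 D2 D3 D4 M1 M2 M3] := Xm.
have [ki|ki] := eqVneq k i; last first.
  rewrite -[m]sl1 M2 mulmxA (homP rh (gD (1 : sD S k))).
  by rewrite [act _ _]/= -[untag _ _ _]/(act (simple S i) (gD (1 : sD S k)))
    raw_simple_gD0 // !mul0mx.
subst k; rewrite -[m]sr1 M3; have [Al|] := boolP (A l); last first.
  by move/negPn/eqP => ->; rewrite !mulmx0.
have m0 : (m : sM S i l) = 0.
  have := memvf (m : sM S i l); have /eqP := Mi l Al; rewrite dimv_eq0 => /eqP->.
  by rewrite memv0 => /eqP.
rewrite m0; have := M1 i l (-1) 0 0; rewrite scaler0 addr0 scaleN1r addNr => ->.
by rewrite mul0mx mulmx0.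
Qed.

Lemma cocycle_gM0 X Y (z : coc X Y) k l : cocycle z -> z (gM (0 : sM S k l)) = 0.
Proof.
by case=> _ _ _ _ C5 _ _; have := C5 k l (-1) 0 0; rewrite scaler0 addr0 scaleN1r addNr.
Qed.

(** A cocycle vanishing on D vanishes altogether when there is no arrow from i
    to j. *)
Lemma Ext0_simple i j : \dim {:sM S j i} = 0%N -> Ext0 (simple S i) (simple S j).
Proof.
move=> d0 z zc; have [h hZ] := cocycle_split (modP (simple S i)) (modP (simple S j)) zc.
have [wc w0] := Z10P _ (modP (simple S i)) (modP (simple S j)) hZ.
exists h; apply/eqP; rewrite -subr_eq0; apply/eqP/ffunP=> -[u|[[k l] m]].
  by rewrite w0 ffunE.
set w := z - _ in wc w0 *; rewrite [RHS]ffunE -[inr _]/(gM (m : sM S k l)).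
have [_ _ _ _ _ C6 C7] := wc.
have [kj|kj] := eqVneq k j; last first.
  by rewrite -[m]sl1 C6 [w (gD _)]w0 mul0mx addr0 raw_simple_gD0 // mul0mx.
have [li|li] := eqVneq l i; last first.
  by rewrite -[m]sr1 C7 [w (gD _)]w0 mulmx0 add0r raw_simple_gD0 // mulmx0.
subst k l; have -> : (m : sM S j i) = 0; last exact: cocycle_gM0.
have := memvf (m : sM S j i); have /eqP := d0; rewrite dimv_eq0 => /eqP->.
by rewrite memv0 => /eqP.
Qed.

(** Successive extensions by S_i that kill a given list of cocycles while
    creating no new classes with values in the S_j, j in B. *)
Lemma kill_cocycles (M : rawmod S) i (B : pred 'I_n)
    (zs : seq (coc M (simple S i))) :
  is_mod M -> (forall j, B j -> Ext0 (simple S i) (simple S j)) ->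
  (forall z, z \in zs -> cocycle z) ->
  exists E p s, [/\ is_mod E, hom E M p, p *m s = 1%:M,
    forall j (z : coc E (simple S j)), B j -> cocycle z ->
      exists z' : coc M (simple S j), cocycle z' /\ exists h, forall x,
        z x = z' x *m p + cob E (simple S j) h x &
    forall z, z \in zs -> exists h, forall x, z x *m p = cob E (simple S i) h x].
Proof.
move=> Mm B0; elim: zs => [_|z0 zs IH zsc].
  exists M, 1%:M, 1%:M; split; rewrite ?is_hom1 ?mulmx1 // => j z _ zc.
  exists z; split=> //; exists 0 => x.
  by rewrite mulmx1 ffunE mulmx0 mul0mx subrr addr0.
have [|E [p [s [Em ph ps lift kill]]]] := IH.
  by move=> z zz; apply: zsc; rewrite inE zz orbT.
have z0c : cocycle z0 by apply: zsc; rewrite inE eqxx.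
pose w : coc E (simple S i) := [ffun x => 1%:M *m z0 x *m p].
have wc : cocycle (X := E) (Y := simple S i) w.
  exact: (pull_cocycle ph (is_hom1 (simple S i)) z0c).
have E'm : is_mod (ext_mid w) by apply/ext_mod => //; exact: (modP (simple S i)).
have ses := ext_mid_ses w; have [fh rh spl] := ses.
exists (ext_mid w), (p *m row_mx 0 1%:M), (col_mx 0 1%:M *m s); split=> //.
- exact: is_hom_comp rh ph.
- by rewrite mulmxA -(mulmxA p) (split_ps spl) mulmx1 ps.
- move=> j z Bj zc.
  have [|h zh] := B0 j Bj [ffun x => 1%:M *m z x *m col_mx 1%:M 0].
    exact: (pull_cocycle fh (is_hom1 (simple S j)) zc).
  have [|z1 z1c [h1 z1h]] := cocycle_descend (h := h) E'm (modP (simple S j)) ses zc.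
    by move=> x; rewrite -zh ffunE mul1mx.
  have [z2 [z2c [h2 z2h]]] := lift j z1 Bj z1c.
  exists z2; split=> //; exists (h2 *m row_mx 0 1%:M + h1) => x.
  by rewrite z1h z2h mulmxDl (cob_precomp _ _ rh) -mulmxA -addrA cobDx.
move=> z; rewrite inE => /orP[/eqP->|zz]; last first.
  have [h zh] := kill z zz; exists (h *m row_mx 0 1%:M) => x.
  by rewrite mulmxA zh (cob_precomp _ _ rh).
exists (- row_mx 1%:M 0) => x; rewrite ffunE mulmxN mulNmx opprK addrC.
rewrite mulmxA; have -> : z0 x *m p = w x by rewrite ffunE mul1mx.
rewrite [act (ext_mid w) x]/= mul_row_block !mul_mx_row !mul1mx !mul0mx !mulmx0 !mulmx1 !addr0.
by rewrite opp_row_mx add_row_mx subrr oppr0 addr0.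
Qed.

(** Vertices are treated one at a time, each a source among those left, so
    that killing the extensions by S_i does not recreate extensions by the S_j
    already treated. *)
Lemma enough_Ext0 (M : rawmod S) : is_mod M ->
  exists E p s, [/\ is_mod E, hom E M p, p *m s = 1%:M &
    forall j, Ext0 E (simple S j)].
Proof.
move=> Mm.
suff ind m : exists A : {set 'I_n}, [/\ (minn m n <= #|A|)%N,
    forall j k, j \in A -> k \notin A -> \dim {:sM S j k} = 0%N &
    exists E p s, [/\ is_mod E, hom E M p, p *m s = 1%:M &
       forall j, j \in A -> Ext0 E (simple S j)]].
  have [A [cA _ [E [p [s [Em ph ps EA]]]]]] := ind n.
  exists E, p, s; split=> // j; apply: EA.
  suff -> : A = [set: 'I_n]%SET by rewrite inE.
  by apply/eqP; rewrite eqEcard finset.subsetT cardsT card_ord; move: cA; rewrite minnn.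
elim: m => [|m [A [cA Acl [E [p [s [Em ph ps EA]]]]]]].
  exists finset.set0; split; [by rewrite min0n | by move=> j k; rewrite inE |].
  exists M, 1%:M, 1%:M; split; rewrite ?is_hom1 ?mulmx1 // => j; by rewrite inE.
have [AT|] := eqVneq A [set: 'I_n]%SET.
  exists A; split=> //; first by rewrite AT cardsT card_ord geq_minr.
  by exists E, p, s.
rewrite -finset.subTset => /subsetPn[i0 _ i0A].
have [i /= iA Mi] := acyclic_source (A := fun i => i \notin A) i0A.
pose B j := (j == i) || (j \in A).
have B0 j : B j -> Ext0 (simple S i) (simple S j).
  case/orP=> [/eqP->|jA]; apply: Ext0_simple; first exact: Mi.
  exact: Acl.
have [|E' [p' [s' [E'm p'h ps' lift kill]]]] :=
    kill_cocycles (zs := enum (Z1 E (simple S i))) Em B0.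
  by move=> z; rewrite mem_enum => /Z1P; apply=> //; exact: (modP (simple S i)).
exists (i |: A)%SET; split.
- rewrite cardsU1 iA; lia.
- move=> j k; rewrite !inE negb_or => /orP[/eqP->|jA] /andP[ki kA]; first exact: Mi.
  exact: Acl.
exists E', (p *m p'), (s' *m s); split=> //.
- exact: is_hom_comp p'h ph.
- by rewrite mulmxA -(mulmxA p) ps' mulmx1.
move=> j; rewrite !inE => jB z zc.
have [z' [z'c [h zE]]] := lift j z jB zc.
suff [h' z'E] : exists h', forall x, z' x *m p' = cob E' (simple S j) h' x.
  exists (h' + h); apply/ffunP=> x.
  by rewrite zE z'E cobDx.
have [ji|ji] := eqVneq j i.
  subst j; apply: kill; rewrite mem_enum; apply/Z1P => //.
  exact: (modP (simple S i)).
have jA : j \in A by move: jB; rewrite (negPf ji).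
have [h1 ->] := EA j jA z' z'c; exists (h1 *m p') => x.
by rewrite (cob_precomp _ _ p'h).
Qed.

(** Any module is an iterated extension of simple ones. *)
Lemma Ext0_simples_projective P : is_mod P ->
  (forall j, Ext0 P (simple S j)) -> projective P.
Proof.
move=> Pm P0; apply: Ext0_projective => // Y.
have [m] := ubnP (rdim Y); elim: m Y => // m IH Y Ym YM.
have [Y0|Y0] := eqVneq (rdim Y) 0%N.
  move=> z _; exists 0; apply/ffunP=> x; apply/matrixP=> a b.
  by have := ltn_ord a; rewrite {2}Y0.
have [i [p [s [ph ps]]]] := simple_quotient YM Y0.
have [N [f [g NY]]] := surj_ses ph ps.
apply: (Ext0_ses_r YM Pm NY) => //; apply: IH; last exact: (ses_modl NY YM).
have := splits_dim (ses_split NY) => /= dE.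
rewrite ltnS in Ym; apply: leq_trans Ym; rewrite dE -[X in (X <= _)%N]addn1 leq_add2l.
exact: sdim_gt0.
Qed.

Lemma enough_projectives (M : mod S) :
  exists (P : prj S) p s, hom P M p /\ p *m s = 1%:M.
Proof.
have [E [p [s [Em ph ps E0]]]] := enough_Ext0 (modP M).
by exists (@Prj F n S (Mod Em) (Ext0_simples_projective Em E0)), p, s.
Qed.

End Acyclic.

(** * Minimal resolutions *)

Section MinimalResolutions.
Variables (F : finFieldType) (n : nat) (S : species F n).
Hypothesis acS : acyclic S.
Implicit Types X Y L Z P : rawmod S.

Local Notation hom X Y f := (@is_hom F n S X Y f).
Local Notation Homs X Y := (@Defs.Hom F n S X Y).

Lemma submod_subspace X (U : {set 'cV[F]_(rdim X)}) : submod U -> subspace U.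
Proof.
case/and4P=> U0 /forall_inP UD /forallP UZ _; split=> // c u w uU wU.
have /forall_inP UZc := UZ c; have /forall_inP UDc := UD _ (UZc u uU).
exact: UDc.
Qed.

Lemma submodP X (U : {set 'cV[F]_(rdim X)}) :
  reflect (subspace U /\ forall g u, u \in U -> act X g *m u \in U) (submod U).
Proof.
apply: (iffP idP) => [Us|[[U0 Ucl] Uact]].
  split; first exact: submod_subspace.
  by case/and4P: Us => _ _ _ /forallP Ua g; exact/forall_inP.
apply/and4P; split=> //.
- apply/forall_inP=> u uU; apply/forall_inP=> w wU.
  by rewrite -[u]scale1r; apply: Ucl.
- apply/forallP=> c; apply/forall_inP=> u uU.
  by rewrite -[_ *: _]addr0; apply: Ucl.
by apply/forallP=> g; apply/forall_inP=> u; apply: Uact.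
Qed.

Lemma submod_image X Y f : hom Y X f ->
  submod [set f *m w | w : 'cV[F]_(rdim Y)]%SET.
Proof.
move=> fh; apply/submodP; split.
  split; first by apply/imsetP; exists 0; rewrite ?inE ?mulmx0.
  move=> c _ _ /imsetP[u _ ->] /imsetP[w _ ->]; apply/imsetP.
  by exists (c *: u + w); rewrite ?inE // mulmxDr scalemxAr.
move=> g _ /imsetP[w _ ->]; apply/imsetP.
by exists (act Y g *m w); rewrite ?inE // mulmxA -(homP fh) mulmxA.
Qed.

Lemma submod_ses X (U : {set 'cV[F]_(rdim X)}) : submod U ->
  exists Y Z f g p s, @ses F n S Y X Z f g p s /\ U = [set u | p *m u == 0]%SET.
Proof.
move=> /submodP[Us Uact].
have [r [t [f [g [p [s [spl UE]]]]]]] := subspace_split Us.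
exists (subm f g), (subm s p), f, g, p, s; split=> //.
apply: ses_sub => // x; apply: mx_ext => v; rewrite mul0mx -!mulmxA.
apply/eqP; have : act X x *m (f *m v) \in U.
  by apply: Uact; rewrite UE inE mulmxA (split_pf spl) mul0mx.
by rewrite UE inE.
Qed.

Lemma ses_image Y X Z f g p s : @ses F n S Y X Z f g p s ->
  [set u | p *m u == 0]%SET = [set f *m w | w : 'cV[F]_(rdim Y)]%SET.
Proof.
move=> [_ _ spl]; apply/setP=> u; rewrite inE; apply/eqP/imsetP=> [pu|[w _ ->]].
  by exists (g *m u); rewrite ?inE //; exact: (split_ker spl pu).
by rewrite mulmxA (split_pf spl) mul0mx.
Qed.

(** A projective of smallest dimension mapping onto M is a projective cover: a
    submodule of it mapping onto M is projective as the algebra is hereditary,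
    so it cannot be proper. *)
Lemma min_resolution (M : mod S) : exists X : c2p S, is_min_res M X.
Proof.
pose A k := `[< exists (P : prj S) p s, [/\ hom P M p, p *m s = 1%:M & rdim P = k] >].
have exA : exists k, A k.
  have [P [p [s [ph ps]]]] := enough_projectives acS M.
  by exists (rdim P); apply/asboolP; exists P, p, s.
have [k /asboolP[P [p [s [ph ps kP]]]] kmin] := ex_minnP exA.
have [O [i [r OPM]]] := surj_ses ph ps.
have Om := ses_modl OPM (modP P); have [ih _ spl] := OPM.
have Op : projective O by apply: projective_sub ih (split_gf spl) _ => //; [exact: modP | exact: prjP].
have Xc : is_c2p (@RawMor F n S O P i) by split=> //; [exact: modP | exact: prjP].
exists (C2P Xc); split; first exact: (retract_inj (split_gf spl)).
exists p; split=> //; first exact: (section_surj ps).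
  move=> u /=; split=> [pu|[w <-]]; last by rewrite mulmxA (split_pf spl) mul0mx.
  by exists (r *m u); rewrite -(split_ker spl pu).
move=> U Us /= UM.
have [Y [Z [f [g [p' [s' [YPZ UE]]]]]]] := submod_ses Us.
have [fh _ spl'] := YPZ; have Ym := ses_modl YPZ (modP P).
have Yp : projective Y by apply: projective_sub fh (split_gf spl') _ => //; [exact: modP | exact: prjP].
have pfs : mx_surj (p *m f).
  move=> w; have [u uU <-] := UM w; exists (g *m u).
  rewrite -mulmxA; congr (_ *m _); apply/esym/(split_ker spl')/eqP.
  by move: uU; rewrite UE inE.
have [s2 ps2] := mx_surj_section pfs.
have kY : (k <= rdim Y)%N.
  apply: kmin; apply/asboolP; exists (@Prj F n S (Mod Ym) Yp), (p *m f), s2.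
  by split=> //; exact: is_hom_comp fh ph.
have Z0 : rdim Z = 0%N by have := splits_dim spl'; rewrite /= kP; lia.
apply/setP=> u; rewrite UE !inE; apply/eqP/matrixP=> a b.
by have := ltn_ord a; rewrite {2}Z0.
Qed.

Lemma C_min_res (M : mod S) : is_min_res M (C_ M).
Proof.
have [X XM] := min_resolution M.
exact: (@xgetPex _ (Z_ (prj0 S)) [set X | is_min_res M X]%classic (ex_intro _ X XM)).
Qed.

Lemma simple_hom_surj X i p : hom X (simple S i) p -> p != 0 ->
  exists s, p *m s = 1%:M.
Proof.
move=> ph p0; have [v vp] : exists v : 'cV_(rdim X), p *m v != 0.
  apply: contrapT => /forallNP av; move/eqP: p0; apply; apply: mx_ext => v.
  by rewrite mul0mx; apply/eqP/negPn/negP/av.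
apply: mx_surj_section => w; pose a : sD S i := Kvec (p *m v).
have a0 : a != 0.
  apply: contraNneq vp => a0; rewrite -[p *m v](@KvecK _ _ S i) -/a a0.
  by apply/eqP/matrixP=> c d; rewrite !mxE linear0.
exists (act X (gD (Kvec w * a^-1 : sD S i)) *m v).
rewrite mulmxA (homP ph) -mulmxA -[w in RHS](@KvecK _ _ S i).
rewrite [act _ _](raw_simple_gD _); apply: (can_inj (@KvecK _ _ S i)).
by rewrite vecKK Kvec_regmx -/a mulfVK.
Qed.

(** Lift p' through p; the image of the lift is a submodule mapping onto N,
    hence everything. *)
Lemma cover_lift P (T : mod S) (N : mod S) p p' :
  is_mod P -> projective P -> hom P N p' -> mx_surj p' -> hom T N p -> mx_surj p ->
  (forall U : {set 'cV[F]_(rdim T)}, submod U ->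
     (forall w : 'cV_(rdim N), exists2 u, u \in U & p *m u = w) ->
          U = [set: 'cV[F]_(rdim T)]%SET) ->
  exists h s, hom P T h /\ h *m s = 1%:M.
Proof.
move=> Pm Pp p'h p's ph ps min.
have [h hh ph'] := Pp T N p p' ph ps p'h.
have hT := min _ (submod_image hh).
have hs : mx_surj h.
  move=> w; have : w \in [set: 'cV[F]_(rdim T)]%SET by rewrite inE.
  rewrite -hT; first by case/imsetP=> u _ ->; exists u.
  move=> v; have [u <-] := p's v; exists (h *m u); last by rewrite mulmxA ph'.
  by apply/imsetP; exists u.
by have [s hs1] := mx_surj_section hs; exists h, s.
Qed.

Lemma projective_splits P T h s : is_mod P -> is_mod T -> projective T ->
  hom P T h -> h *m s = 1%:M ->
  exists K f g s', @dses F n S K P T f g h s'.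
Proof.
move=> Pm Tm Tp hh hs.
have [s' s'h hs'] := Tp (Mod Pm) (Mod Tm) h 1%:M hh (section_surj hs) (is_hom1 _).
have [K [f [g KPT]]] := surj_ses hh hs'.
have [fh _ spl] := KPT; exists K, f, g, s'; split=> //; apply/homP=> x.
have fg : f *m g = 1%:M - s' *m h by rewrite -(split_fg spl) addrK.
have fgP : f *m (g *m act P x) = act P x *m (f *m g).
  rewrite mulmxA fg mulmxBl mulmxBr mul1mx mulmx1 -mulmxA (homP hh) mulmxA.
  by rewrite (homP s'h) mulmxA.
rewrite -[LHS]mul1mx -(split_gf spl) -mulmxA fgP (mulmxA _ f g) -(homP fh).
by rewrite !mulmxA (split_gf spl) mul1mx.
Qed.

Lemma dses_iso K P T f g p s K' P' f' g' p' s' :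
  @dses F n S K P T f g p s -> @dses F n S K' P' T f' g' p' s' ->
  mod_iso K K' -> mod_iso P P'.
Proof.
move=> [[fh ph spl] gh sh] [[fh' ph' spl'] gh' sh'] [a [b [ah bh ba ab]]].
have comp X Y Z (u : 'M_(rdim Y, rdim X)) (v : 'M_(rdim Z, rdim Y)) :
  hom X Y u -> hom Y Z v -> hom X Z (v *m u) by exact: is_hom_comp.
have E (P1 P2 K1 K2 : rawmod S) (f1 : 'M_(rdim P1, rdim K1)) (g1 : 'M_(rdim K1, rdim P1))
   (p1 : 'M_(rdim T, rdim P1)) s1 (f2 : 'M_(rdim P2, rdim K2)) (g2 : 'M_(rdim K2, rdim P2))
   (p2 : 'M_(rdim T, rdim P2)) s2 (c : 'M_(rdim K2, rdim K1)) (d : 'M_(rdim K1, rdim K2)) :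
   splits f1 g1 p1 s1 -> splits f2 g2 p2 s2 -> d *m c = 1%:M ->
   (f1 *m d *m g2 + s1 *m p2) *m (f2 *m c *m g1 + s2 *m p1) = 1%:M.
  move=> spl1 spl2 dc; rewrite mulmxDl !mulmxDr !mulmxA.
  rewrite -(mulmxA _ g2 f2) (split_gf spl2) mulmx1 -(mulmxA _ d c) dc mulmx1.
  rewrite -(mulmxA _ g2 s2) (split_gs spl2) mulmx0 mul0mx addr0.
  rewrite -(mulmxA _ p2 f2) (split_pf spl2) mulmx0 !mul0mx add0r.
  by rewrite -(mulmxA _ p2 s2) (split_ps spl2) mulmx1 (split_fg spl1).
exists (f' *m a *m g + s' *m p), (f *m b *m g' + s *m p'); split; try exact: E.
- exact: homD (comp _ _ _ _ _ gh (comp _ _ _ _ _ ah fh')) (comp _ _ _ _ _ ph sh').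
- exact: homD (comp _ _ _ _ _ gh' (comp _ _ _ _ _ bh fh)) (comp _ _ _ _ _ ph' sh).
Qed.

Lemma rdim0_mlt X : is_mod X -> (forall i, mlt X i = 0%N) -> rdim X = 0%N.
Proof.
move=> Xm X0; apply/eqP/negP => /negP X1.
have [i [u [eu u0]]] := exists_Epart Xm X1.
have ed : edim X i = 0%N by rewrite -(divnK (edim_dvd i Xm)) -/(mlt X i) X0.
have := card_Epart i Xm; rewrite ed expn0 => /eqP /cards1P[v Ev].
move/eqP: u0; apply; apply/eqP.
have : u \in Epart X i by rewrite inE eu.
have : 0 \in Epart X i by rewrite inE mulmx0.
by rewrite Ev !inE => /eqP <- /eqP->.
Qed.

Lemma dimvec0 X : is_mod X -> dimvec X = 0 -> rdim X = 0%N.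
Proof.
move=> Xm X0; apply: rdim0_mlt => // i.
by have := dimvecE X i; rewrite X0 mxE => -[].
Qed.

Lemma rdim0_dimvec X : is_mod X -> rdim X = 0%N -> dimvec X = 0.
Proof.
by move=> Xm X0; apply/matrixP=> i j; rewrite ord1 dimvecE mlt0 // mxE.
Qed.

Lemma rdim0_iso X Y : rdim X = 0%N -> rdim Y = 0%N -> mod_iso X Y.
Proof.
move=> X0 Y0; have z (Z : rawmod S) (A : 'M[F]_(rdim Z)) : rdim Z = 0%N -> A = 1%:M.
  by move=> Z0; apply/matrixP=> a b; have := ltn_ord a; rewrite {2}Z0.
by exists 0, 0; split; rewrite ?hom0 //; apply: z.
Qed.

(** Projectives are determined by their classes: both map onto some S_i, hence
    both split off the projective cover of S_i. *)
Lemma projective_iso P P' : is_mod P -> is_mod P' -> projective P -> projective P' ->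
  dimvec P = dimvec P' -> mod_iso P P'.
Proof.
have [m] := ubnP (rdim P); elim: m P P' => // m IH P P' Pm PM P'M Pp P'p dP.
have [P0|P0] := eqVneq (rdim P) 0%N.
  by apply: rdim0_iso => //; apply: dimvec0 => //; rewrite -dP rdim0_dimvec.
have [i [p [s [ph ps]]]] := simple_quotient acS PM P0.
have [p' p'h p'0] : exists2 p', hom P' (simple S i) p' & p' != 0.
  have d0 : dimHom P' (simple S i) != 0%N.
    have -> : dimHom P' (simple S i) = dimHom P (simple S i).
      have Sm := modP (simple S i).
      have := dimHom_proj P'M Sm P'p; rewrite -dP -dimHom_proj //.
      by case.
    apply: contraTneq (sdim_gt0 S i) => d0.
    have := card_Hom P (simple S i); rewrite d0 expn0 => /eqP/cards1P[w Ew].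
    have : p \in Homs P (simple S i) by rewrite inE.
    have : 0 \in Homs P (simple S i) by rewrite inE hom0.
    rewrite Ew !inE => /eqP <- /eqP p0; rewrite -leqNgt.
    move: ps; rewrite p0 mul0mx => /matrixP e.
    case: (posnP (sdim S i)) => [->//|d1].
    by have /eqP := e (Ordinal d1) (Ordinal d1); rewrite !mxE eqxx eq_sym oner_eq0.
  apply: contrapT => /forall2NP no; move/eqP: d0; apply; apply: (@expq_inj F).
  rewrite -card_Hom expn0; apply/eqP/cards1P; exists 0; apply/setP=> w; rewrite !inE.
  apply/idP/eqP=> [wh|->]; last exact: hom0.
  by case: (no w) => // /negP/negPn/eqP.
have [s1 ps1] := simple_hom_surj p'h p'0.
have [X [_ [t [th ts _ tmin]]]] := min_resolution (simple S i).
have Tm := tgt_mod (c2pP X); have Tp := tgt_proj (c2pP X).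
have [h [s2 [hh hs]]] := @cover_lift P (Mod Tm) _ _ _ PM Pp ph (section_surj ps) th ts tmin.
have [h' [s2' [hh' hs']]] := @cover_lift P' (Mod Tm) _ _ _ P'M P'p p'h (section_surj ps1) th ts tmin.
have [K [f [g [s3 KP]]]] := projective_splits PM Tm Tp hh hs.
have [K' [f' [g' [s3' KP']]]] := projective_splits P'M Tm Tp hh' hs'.
have [KPs _ _] := KP; have [KPs' _ _] := KP'.
have Km := ses_modl KPs PM; have Km' := ses_modl KPs' P'M.
apply: (dses_iso KP KP'); apply: IH => //.
- have := splits_dim (ses_split KPs); move: Pm; rewrite ltnS => Pm dE.
  apply: leq_trans Pm; rewrite dE -[X in (X <= _)%N]addn1 leq_add2l lt0n.
  apply/eqP=> T0.
  have [w tw] := ts (const_mx 1); have /matrixP/(_ (Ordinal (sdim_gt0 S i)) 0) := tw.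
  rewrite !mxE big1 => [/eqP|k _]; first by rewrite eq_sym oner_eq0.
  by have := ltn_ord k; rewrite {2}T0.
- case: KPs => fh _ spl; exact: projective_sub fh (split_gf spl) Pp.
- case: KPs' => fh _ spl; exact: projective_sub fh (split_gf spl) P'p.
by apply: (addIr (dimvec (tgt X))); rewrite -(dimvecD PM KPs) -(dimvecD P'M KPs').
Qed.

End MinimalResolutions.

(** * The coefficient ring *)

Section ZvUnits.
Variable F : finFieldType.

Lemma vv_sqr : vv F ^+ 2 = qq F.
Proof.
apply: val_inj; rewrite /qq rmorphXn rmorph_nat /=.
by rewrite /vC sqrtCK.
Qed.

Lemma vv_unit : vv F \is a GRing.unit.
Proof.
have iP : (vC F)^-1 \in Zv_pred F.
  by apply/asboolP; exists 1, 1%N; rewrite rmorph1 hornerE expr1 div1r.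
apply/unitrP; exists (MkZv iP); rewrite [_ * vv F]mulrC; split; apply: val_inj;
  by rewrite rmorphM rmorph1 /= mulfV // vC_neq0.
Qed.

Lemma qq_unit : qq F \is a GRing.unit.
Proof. by rewrite -vv_sqr unitrX ?vv_unit. Qed.

Lemma qq_exp (k : int) : qq F ^ k = vv F ^ (k + k).
Proof.
rewrite -vv_sqr -[vv F ^+ 2]/(vv F ^ 2) exprz_exp; congr (_ ^ _).
by lia.
Qed.

Lemma natq_exp k : ((#|F| ^ k)%N)%:R = qq F ^ (k%:Z).
Proof. by rewrite natrX. Qed.

Lemma natq_unit k : ((#|F| ^ k)%N)%:R \is a @GRing.unit (Zv F).
Proof. by rewrite natrX unitrX ?qq_unit. Qed.

End ZvUnits.

(** * Isomorphisms and extensions in the category of morphisms *)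

Section Morphisms.
Variables (F : finFieldType) (n : nat) (S : species F n).
Implicit Types X Y L : rawmor S.

Local Notation hom X Y f := (@is_hom F n S X Y f).
Local Notation coc X Y := {ffun gens S -> 'M[F]_(rdim Y, rdim X)}.
Local Notation coc2 X Y :=
  (coc (src X) (src Y) * coc (tgt X) (tgt Y) *
   'M[F]_(rdim (tgt Y), rdim (src X)))%type.

Lemma mor_isoP X Y : mor_iso X Y <->
  exists f1 g1 f2 g2, [/\ hom (src X) (src Y) f1 /\ hom (src Y) (src X) g1,
    hom (tgt X) (tgt Y) f2 /\ hom (tgt Y) (tgt X) g2,
    g1 *m f1 = 1%:M /\ f1 *m g1 = 1%:M, g2 *m f2 = 1%:M /\ f2 *m g2 = 1%:M &
    f2 *m dif X = dif Y *m f1].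
Proof.
split.
  case=> [[f1 f2] [[g1 g2]]] [/and3P[/= ? ? /eqP e] /and3P[/= ? ? _]] [? ?] [? ?].
  by exists f1, g1, f2, g2; split.
case=> f1 [g1 [f2 [g2 [[a b] [c d] [gf1 fg1] [gf2 fg2] e]]]].
exists (f1, f2), (g1, g2); split=> //; apply/and3P; split=> //=; first exact/eqP.
by rewrite -[dif Y]mulmx1 -fg1 (mulmxA (dif Y)) -e !mulmxA gf2 mul1mx.
Qed.

Lemma mor_iso_refl X : mor_iso X X.
Proof.
apply/mor_isoP; exists 1%:M, 1%:M, 1%:M, 1%:M.
by rewrite !is_hom1 !mulmx1 mul1mx.
Qed.

Lemma mor_iso_sym X Y : mor_iso X Y -> mor_iso Y X.
Proof. by case=> f [g [? ? [? ?] [? ?]]]; exists g, f. Qed.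

Lemma mor_iso_trans Y X L : mor_iso X Y -> mor_iso Y L -> mor_iso X L.
Proof.
move=> /mor_isoP[f1 [g1 [f2 [g2 [[a b] [c d] [gf1 fg1] [gf2 fg2] e]]]]].
move=> /mor_isoP[f1' [g1' [f2' [g2' [[a' b'] [c' d'] [gf1' fg1'] [gf2' fg2'] e']]]]].
have inv r s t (u : 'M[F]_(r, s)) (u' : 'M_(s, r)) (w : 'M_(s, t)) (w' : 'M_(t, s)) :
    u *m u' = 1%:M -> w *m w' = 1%:M -> (u *m w) *m (w' *m u') = 1%:M.
  by move=> uu ww; rewrite mulmxA -(mulmxA u) ww mulmx1.
apply/mor_isoP; exists (f1' *m f1), (g1 *m g1'), (f2' *m f2), (g2 *m g2').
split; try by split; apply: inv.
- by split; [exact: is_hom_comp a a' | exact: is_hom_comp b' b].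
- by split; [exact: is_hom_comp c c' | exact: is_hom_comp d' d].
by rewrite -mulmxA e mulmxA e' mulmxA.
Qed.

Lemma cl_iso (X Y : c2p S) : mor_iso X Y -> cl X = cl Y.
Proof.
move=> XY; rewrite /cl; congr << _ >>.
by apply/eqmodP/asboolP.
Qed.

Lemma rep_cls (X : c2p S) : mor_iso (rep_c2p (cls X)) X.
Proof.
have /eqmodP/asboolP : cls (rep_c2p (cls X)) = cls X by rewrite /cls /rep_c2p reprK.
by [].
Qed.

Lemma cl_rep (a : isoc2p S) : cl (rep_c2p a) = << a >>.
Proof. by rewrite /cl /cls /rep_c2p reprK. Qed.

Lemma cls_eq (X Y : c2p S) : (cls X == cls Y) = `[< mor_iso X Y >].
Proof.
apply/eqP/asboolP => [e|XY]; last by apply/eqmodP/asboolP.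
by move/eqmodP/asboolP: e.
Qed.

(** Raw data are retyped as an object of C_2(P) by choice, which spares
    carrying the proofs of is_c2p inside sums. *)
Definition toc2p X : c2p S :=
  xget (Z_ (prj0 S)) [set Y | c2p_raw Y = X]%classic.

Lemma toc2pK X : is_c2p X -> c2p_raw (toc2p X) = X.
Proof.
move=> Xc; rewrite /toc2p.
exact: (@xgetPex _ _ [set Y : c2p S | c2p_raw Y = X]%classic
  (ex_intro _ (C2P Xc) erefl)).
Qed.

Lemma cl_toc2p X (Y : c2p S) : is_c2p X -> mor_iso X Y -> cl (toc2p X) = cl Y.
Proof. by move=> Xc XY; apply: cl_iso; rewrite toc2pK. Qed.

Lemma Z2P (X Y : c2p S) (z : coc2 X Y) :
  reflect [/\ cocycle z.1.1, cocycle z.1.2 & is_hom (dif (ext_mid2 z))] (z \in Z2 X Y).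
Proof.
have [sX tX _ _ _] := c2pP X; have [sY tY _ _ _] := c2pP Y.
rewrite inE; apply: (iffP and3P) => -[z1 z2 z3]; split=> //; exact/Z1P.
Qed.

Lemma ext_mid2_c2p (X Y : c2p S) (z : coc2 X Y) : z \in Z2 X Y ->
  is_c2p (ext_mid2 z).
Proof.
have [sX tX sXp tXp _] := c2pP X; have [sY tY sYp tYp _] := c2pP Y.
move=> /Z2P[z1 z2 z3].
have sm : is_mod (src (ext_mid2 z)) by apply/ext_mod.
have tm : is_mod (tgt (ext_mid2 z)) by apply/ext_mod.
split=> //.
  exact: projective_ses sm (ext_mid_ses z.1.1) sYp sXp.
exact: projective_ses tm (ext_mid_ses z.1.2) tYp tXp.
Qed.

Lemma hom_dif2 (X Y : c2p S) (z : coc2 X Y) :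
  is_hom (dif (ext_mid2 z)) <-> forall g,
    dif Y *m z.1.1 g + z.2 *m act (src X) g =
    act (tgt Y) g *m z.2 + z.1.2 g *m dif X.
Proof.
have [_ _ _ _ dX] := c2pP X; have [_ _ _ _ dY] := c2pP Y.
split=> [/homP h g|h].
  have := h g; rewrite /= !mulmx_block !mulmx0 !mul0mx ?add0r ?addr0.
  by move/eq_block_mx=> [].
apply/homP=> g; rewrite /= !mulmx_block !mulmx0 !mul0mx ?add0r ?addr0.
by rewrite (homP dX) (homP dY) h.
Qed.

Definition cob2 X Y (h : 'M[F]_(rdim (src Y), rdim (src X)) *
    'M[F]_(rdim (tgt Y), rdim (tgt X))) : coc2 X Y :=
  (@cob F n S (src X) (src Y) h.1, @cob F n S (tgt X) (tgt Y) h.2,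
   dif Y *m h.1 - h.2 *m dif X).

Lemma B2P X Y z : reflect (exists h, z = @cob2 X Y h) (z \in B2 X Y).
Proof. by apply: (iffP imsetP) => [[h _ ->]|[h ->]]; exists h. Qed.

Lemma Z2_ZD (X Y : c2p S) (c : F) z z' : z \in Z2 X Y -> z' \in Z2 X Y ->
  c *: z + z' \in Z2 X Y.
Proof.
move=> /Z2P[a1 a2 /hom_dif2 a3] /Z2P[b1 b2 /hom_dif2 b3].
apply/Z2P; split; try exact: cocycleZD.
apply/hom_dif2 => g; rewrite /= !ffunE.
rewrite !(mulmxDl, mulmxDr) -!scalemxAr -!scalemxAl addrACA -scalerDr a3 b3.
by rewrite scalerDr addrACA.
Qed.

Lemma B2_ZD X Y (c : F) z z' : z \in B2 X Y -> z' \in B2 X Y ->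
  c *: z + z' \in B2 X Y.
Proof.
move=> /B2P[h ->] /B2P[h' ->]; apply/B2P; exists (c *: h + h').
rewrite /cob2 /= !cobZD; congr (_, _, _).
rewrite mulmxDr mulmxDl -scalemxAr -scalemxAl opprD addrACA -scalerBr.
by [].
Qed.

Lemma B2_0 X Y : 0 \in B2 X Y.
Proof.
by apply/B2P; exists 0; rewrite /cob2 /= !cob0 mulmx0 mul0mx subrr.
Qed.

Lemma B2_Z2 (X Y : c2p S) b : b \in B2 X Y -> b \in Z2 X Y.
Proof.
have [sX tX _ _ dX] := c2pP X; have [sY tY _ _ dY] := c2pP Y.
move=> /B2P[h ->]; apply/Z2P; split; try exact: cob_cocycle.
apply/hom_dif2 => g; rewrite /= !ffunE !mulmxBr !mulmxBl !mulmxA.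
rewrite (homP dY) -!mulmxA (homP dX) !mulmxA.
by rewrite addrA subrK addrA subrK.
Qed.

Lemma Z2_0 (X Y : c2p S) : 0 \in Z2 X Y.
Proof. by apply: B2_Z2; apply: B2_0. Qed.

Lemma Z2_D (X Y : c2p S) z z' : z \in Z2 X Y -> z' \in Z2 X Y -> z + z' \in Z2 X Y.
Proof. by move=> zZ z'Z; rewrite -[z]scale1r Z2_ZD. Qed.

Lemma B2_D X Y z z' : z \in B2 X Y -> z' \in B2 X Y -> z + z' \in B2 X Y.
Proof. by move=> zZ z'Z; rewrite -[z]scale1r B2_ZD. Qed.

Lemma B2_N X Y z : z \in B2 X Y -> - z \in B2 X Y.
Proof. by move=> zB; rewrite -scaleN1r -[_ *: _]addr0 B2_ZD ?B2_0. Qed.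

Lemma ext_mid2_B2 (X Y : c2p S) (z b : coc2 X Y) : b \in B2 X Y ->
  mor_iso (ext_mid2 (z + b)) (ext_mid2 z).
Proof.
move=> /B2P[h ->]; pose u r t (k : 'M[F]_(r, t)) := block_mx 1%:M k 0 1%:M.
have uN r t (k k' : 'M[F]_(r, t)) : k + k' = 0 -> u _ _ k *m u _ _ k' = 1%:M.
  move=> kk; rewrite /u mulmx_block !mulmx0 !mul0mx !mulmx1 !mul1mx !addr0 !add0r.
  by rewrite addrC kk -scalar_mx_block.
have hu (V W : rawmod S) (zz : coc V W) k k' : k' = - k ->
   hom (ext_mid (zz + @cob F n S V W k)) (ext_mid zz) (u _ _ k) /\
   hom (ext_mid zz) (ext_mid (zz + @cob F n S V W k)) (u _ _ k').
  move=> ->; split; apply/homP=> g; rewrite /= /u !mulmx_block !ffunE.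
    rewrite !mulmx0 !mul0mx !mulmx1 !mul1mx !addr0 !add0r.
    by congr block_mx; rewrite -addrA subrK addrC.
  rewrite !mulmx0 !mul0mx !mulmx1 !mul1mx !addr0 !add0r.
  by congr block_mx; rewrite mulmxN mulNmx addrCA addKr.
apply/mor_isoP; exists (u _ _ h.1), (u _ _ (- h.1)), (u _ _ h.2), (u _ _ (- h.2)).
split.
- exact: (hu _ _ z.1.1).
- exact: (hu _ _ z.1.2).
- by split; apply: uN; rewrite ?subrr ?addNr.
- by split; apply: uN; rewrite ?subrr ?addNr.
rewrite /= /u !mulmx_block !mulmx0 !mul0mx !mulmx1 !mul1mx !addr0 !add0r.
congr block_mx; rewrite -addrA subrK addrC //.
Qed.

End Morphisms.

(** * The Hall product as an average of cones *)

Lemma natr_card_sub (R : pzRingType) (I : finType) (A : {set I}) (P : pred I) :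
  #|[set i in A | P i]%SET|%:R = \sum_(i in A) (P i)%:R :> R.
Proof.
rewrite -sum1_card natr_sum big_mkcond [RHS]big_mkcond /=.
by apply: eq_bigr => i _; rewrite finset.in_set; case: (i \in A); case: (P i).
Qed.

Lemma fsum_fibers (R : pzRingType) (V : lmodType R) (I : finType) (T : choiceType)
    (A : {set I}) (k : I -> T) (f : T -> V) :
  \sum_(t \in [set: T]) (#|[set i in A | k i == t]%SET|%:R : R) *: f t =
  \sum_(i in A) f (k i).
Proof.
pose r := undup [seq k i | i <- enum A].
rewrite (fsbigE r) ?undup_uniq //; last first.
  move=> t _ tr; rewrite (_ : [set i in A | k i == t]%SET = finset.set0) ?cards0 ?scale0r //.
  apply/setP=> i; rewrite !inE; apply/negP=> /andP[iA /eqP kt]; move/negP: tr; apply.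
  by rewrite mem_undup -kt map_f // mem_enum.
transitivity (\sum_(t <- r) \sum_(i in A) ((k i == t)%:R : R) *: f t).
  apply: eq_big => [t|t _]; first by rewrite in_setT.
  rewrite -sum1_card natr_sum scaler_suml big_mkcond [RHS]big_mkcond /=.
  apply: eq_bigr => i _; rewrite finset.in_set.
  by case: (i \in A); case: (k i == t); rewrite /= ?scale0r.
rewrite exchange_big /=; apply: eq_bigr => i iA.
rewrite (bigD1_seq (k i)) ?undup_uniq //=; last first.
  by rewrite mem_undup map_f // mem_enum.
rewrite eqxx scale1r big1 ?addr0 // => t; rewrite eq_sym => /negPf->.
by rewrite scale0r.
Qed.

Section HallProduct.
Variables (F : finFieldType) (n : nat) (S : species F n).

Local Notation q := #|F|.
Local Notation Homs X Y := (@Defs.Hom F n S X Y).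
Local Notation coc X Y := {ffun gens S -> 'M[F]_(rdim Y, rdim X)}.
Local Notation coc2 X Y :=
  (coc (src X) (src Y) * coc (tgt X) (tgt Y) *
   'M[F]_(rdim (tgt Y), rdim (src X)))%type.

(** The extension of X by Y whose components are the direct sums and whose
    differential has off-diagonal entry w : X_(-1) -> Y_0. *)
Definition cone (X Y : rawmor S) (w : 'M[F]_(rdim (tgt Y), rdim (src X))) : rawmor S :=
  ext_mid2 ((0, 0, w) : coc2 X Y).

Lemma cone_Z2 (X Y : c2p S) w : (((0, 0, w) : coc2 X Y) \in Z2 X Y) = (w \in Homs (src X) (tgt Y)).
Proof.
apply/Z2P/idP=> [[_ _ /hom_dif2 h]|].
  rewrite inE; apply/homP=> g.
  by have := h g; rewrite /= !ffunE mulmx0 mul0mx add0r addr0.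
rewrite inE => /homP h; split; try exact: cocycle0; apply/hom_dif2 => g.
by rewrite /= !ffunE mulmx0 mul0mx add0r addr0.
Qed.

(** Both components of an extension split, the components of X being
    projective. *)
Lemma Z2_split (X Y : c2p S) (z : coc2 X Y) : z \in Z2 X Y ->
  exists w, (((0, 0, w) : coc2 X Y) \in Z2 X Y) /\ z - (0, 0, w) \in B2 X Y.
Proof.
have [sX tX sXp tXp _] := c2pP X; have [sY tY _ _ _] := c2pP Y.
case: z => [[z1 z2] z3] zZ; have /Z2P[/= z1c z2c _] := zZ.
have [h1 e1] := projective_Ext0 sX sY sXp z1c.
have [h2 e2] := projective_Ext0 tX tY tXp z2c.
pose b := cob2 (X := X) (Y := Y) (h1, h2).
have bB : b \in B2 X Y by apply/B2P; exists (h1, h2).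
pose w := z3 - b.2; exists w.
have e : (z1, z2, z3) - b = ((0, 0, w) : coc2 X Y).
  by congr (_, _, _); rewrite /= ?e1 ?e2 subrr.
split; last by rewrite -e opprB addrCA subrr addr0.
by rewrite -e Z2_D // B2_Z2 // B2_N.
Qed.

Lemma card_Z2 (X Y : c2p S) : #|Z2 X Y| = (q ^ \dim <<enum (Z2 X Y)>>%VS)%N.
Proof.
rewrite cardE -card_span ?enum_uniq // ?mem_enum; first exact: Z2_0.
by move=> c u w; rewrite !mem_enum; apply: Z2_ZD.
Qed.

Lemma card_B2 (X Y : rawmor S) : #|B2 X Y| = (q ^ \dim <<enum (B2 X Y)>>%VS)%N.
Proof.
rewrite cardE -card_span ?enum_uniq // ?mem_enum; first exact: B2_0.
by move=> c u w; rewrite !mem_enum; apply: B2_ZD.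
Qed.

Lemma card_Hom2 (X Y : rawmor S) : #|Hom2 X Y| = (q ^ \dim <<enum (Hom2 X Y)>>%VS)%N.
Proof.
rewrite cardE -card_span ?enum_uniq // ?mem_enum ?inE.
  by rewrite /is_hom2 /= !hom0 mulmx0 mul0mx eqxx.
move=> c u w; rewrite !mem_enum !inE => /and3P[u1 u2 /eqP u3] /and3P[w1 w2 /eqP w3].
apply/and3P; split; [exact: homZD | exact: homZD | apply/eqP].
by rewrite /= mulmxDl mulmxDr -scalemxAl -scalemxAr u3 w3.
Qed.

(** An element of Ext^1 is a coset of the coboundaries, and the middle term is
    constant on cosets. *)
Lemma card_Ext2_mid (X Y L : c2p S) :
  (#|Ext2_mid X Y L| * #|B2 X Y| =
   #|[set z in Z2 X Y | `[< mor_iso (ext_mid2 z) L >]]%SET|)%N.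
Proof.
set A := [set z in Z2 X Y | _]%SET.
pose f (z : coc2 X Y) := [set (z : coc2 X Y) + b | b in B2 X Y]%SET.
have fz z : z \in f z by apply/imsetP; exists 0; rewrite ?B2_0 ?addr0.
rewrite (@card_fibers _ _ A f #|B2 X Y|).
  congr (_ * _)%N; apply: eq_card => E; rewrite inE; apply/andP/imsetP.
    case=> /imsetP[z zZ ->] /existsP[w /andP[/imsetP[b bB ->] /asboolP iso]].
    exists z => //; rewrite inE zZ; apply/asboolP.
    exact: mor_iso_trans (mor_iso_sym (ext_mid2_B2 z bB)) iso.
  case=> z; rewrite inE => /andP[zZ iso] ->; split; first by apply/imsetP; exists z.
  by apply/existsP; exists z; rewrite fz.
move=> u; rewrite inE => /andP[uZ /asboolP uiso].
rewrite -(card_imset (B2 X Y) (addrI u)); apply: eq_card => a.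
rewrite finset.in_set [in X in X && _]finset.in_set.
apply/andP/imsetP=> [[_ /eqP fa]|[b bB ->]].
  by have := fz a; rewrite fa => /imsetP[b bB ->]; exists b.
split; last first.
  apply/eqP/setP=> x; apply/imsetP/imsetP=> -[c cB ->].
    by exists (b + c); rewrite ?addrA // B2_D.
  by exists (c - b); rewrite ?addrA; [rewrite B2_D // B2_N | rewrite addrAC addrK addrC].
apply/andP; split; first by rewrite Z2_D // B2_Z2.
apply/asboolP; exact: mor_iso_trans (ext_mid2_B2 u bB) uiso.
Qed.

(** In the structure constants, the power of q given by the Euler form and the
    cardinality of Hom combine to the number of coboundaries over the number
    of cocycles; counting cocycles instead of classes makes the product an
    average of middle terms over all cocycles. *)
Lemma hall_basis_mulE (X Y : c2p S) :
  #|Z2 X Y|%:R *: hall_basis_mul X Y = \sum_(z in Z2 X Y) cl (toc2p (ext_mid2 z)).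
Proof.
pose k (z : coc2 X Y) := cls (toc2p (ext_mid2 z)).
have coef L : #|Z2 X Y|%:R * (qq F ^ euler2 X Y * #|Ext2_mid X Y (rep_c2p L)|%:R / #|Hom2 X Y|%:R)
   = \sum_(z in Z2 X Y) (k z == L)%:R :> Zv F.
  transitivity (#|[set z in Z2 X Y | `[< mor_iso (ext_mid2 z) (rep_c2p L) >]]%SET|%:R : Zv F); last first.
    rewrite natr_card_sub; apply: eq_bigr => z zZ.
    rewrite /k -[in RHS](reprK (L : {eq_quot mor_iso_rel S}%qT)).
    rewrite -[(\pi_(_) _)%qT]/(cls (rep_c2p L)) cls_eq toc2pK.
      by case: asboolP.
    exact: ext_mid2_c2p.
  rewrite -card_Ext2_mid natrM card_Z2 card_Hom2 card_B2 /euler2.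
  set z := \dim _; set a := \dim _; set b := \dim _.
  have bz : (b <= z)%N.
    rewrite -(leq_exp2l _ _ (@q_gt1 F)) /b /z -card_B2 -card_Z2.
    by apply: subset_leq_card; apply/fintype.subsetP=> y; apply: B2_Z2.
  rewrite -subzn // !natq_exp opprB !exprzDr ?qq_unit // -invr_expz.
  have qu (m : nat) : qq F ^ m%:Z \is a GRing.unit by apply: unitrX; exact: qq_unit.
  have cancel (A A' Z Z' B N : Zv F) : A * A' = 1 -> Z * Z' = 1 ->
      Z * (A * (B * Z') * N * A') = N * B.
    move=> uA uZ; transitivity ((Z * Z') * (A * A') * (N * B)); first by ring.
    by rewrite uA uZ !mul1r.
  by apply: cancel; rewrite mulrV.
have NZ : #|Z2 X Y|%:R \is a @GRing.unit (Zv F) by rewrite card_Z2 natq_unit.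
have cE L : qq F ^ euler2 X Y * #|Ext2_mid X Y (rep_c2p L)|%:R / #|Hom2 X Y|%:R =
    #|[set z in Z2 X Y | k z == L]%SET|%:R * (#|Z2 X Y|%:R)^-1.
  rewrite -[LHS](mulKr NZ) coef mulrC; congr (_ * _).
  by rewrite natr_card_sub.
rewrite /hall_basis_mul.
rewrite (eq_fsbigr (fun L => (#|[set z in Z2 X Y | k z == L]%SET|%:R : Zv F) *:
     ((#|Z2 X Y|%:R : Zv F)^-1 *: (<< L >> : Hall S)))); last first.
  by move=> L _; rewrite cE scalerA.
rewrite fsum_fibers -scaler_sumr scalerA mulrV // scale1r.
by apply: eq_bigr => z _.
Qed.

End HallProduct.

Lemma unit_scalerI (R : unitRingType) (V : lmodType R) (a : R) (x y : V) :
  a \is a GRing.unit -> a *: x = a *: y -> x = y.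
Proof.
move=> ua /(congr1 (fun u => a^-1 *: u)).
by rewrite !scalerA mulVr // !scale1r.
Qed.

Section Cones.
Variables (F : finFieldType) (n : nat) (S : species F n).

Local Notation hom X Y f := (@is_hom F n S X Y f).
Local Notation Homs X Y := (@Defs.Hom F n S X Y).
Local Notation coc X Y := {ffun gens S -> 'M[F]_(rdim Y, rdim X)}.
Local Notation coc2 X Y :=
  (coc (src X) (src Y) * coc (tgt X) (tgt Y) *
   'M[F]_(rdim (tgt Y), rdim (src X)))%type.
Local Notation cone X Y w := (@cone F n S X Y w).

Lemma cone_c2p (X Y : c2p S) w : hom (src X) (tgt Y) w -> is_c2p (cone X Y w).
Proof. by move=> wh; apply: ext_mid2_c2p; rewrite cone_Z2 inE. Qed.

(** The cocycles that come from cones meet all cosets of the coboundaries, so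
    the average over all cocycles is also the average over the cones. *)
Lemma hall_basis_cone (X Y : c2p S) :
  #|Homs (src X) (tgt Y)|%:R *: hall_basis_mul X Y =
  \sum_(w in Homs (src X) (tgt Y)) cl (toc2p (cone X Y w)).
Proof.
pose phi (z : coc2 X Y) := cl (toc2p (ext_mid2 z)).
pose H : {set coc2 X Y} := [set ((0, 0, w) : coc2 X Y) | w in Homs (src X) (tgt Y)]%SET.
have inj0 : injective (fun w => ((0, 0, w) : coc2 X Y)) by move=> w w' [].
have HZ h : h \in H -> h \in Z2 X Y by case/imsetP=> w wH ->; rewrite cone_Z2.
have := @average_cosets (coc2 X Y) (Hall S) (Z2 X Y) (B2 X Y) H phi.
rewrite card_imset // big_imset /=; last by move=> w w' _ _; apply: inj0.
rewrite -hall_basis_mulE -!scaler_nat !scalerA mulrC -scalerA => avg.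
have NZ : #|Z2 X Y|%:R \is a @GRing.unit (Zv F) by rewrite card_Z2 natq_unit.
apply: (unit_scalerI NZ); apply: avg => //.
- by move=> z h zZ /HZ; apply: Z2_D.
- move=> _ _ /imsetP[w wH ->] /imsetP[w' w'H ->]; apply/imsetP.
  exists (w - w'); first by move: wH w'H; rewrite !inE; apply: homB.
  by congr (_, _, _); rewrite /= subrr.
- by apply/imsetP; exists 0; rewrite ?inE ?hom0.
- move=> z zZ; have [w [wZ zB]] := Z2_split zZ; exists (0, 0, w) => //.
  by apply/imsetP; exists w => //; rewrite -cone_Z2.
- move=> z b zZ zbZ bB; apply: cl_iso; rewrite !toc2pK; try exact: ext_mid2_c2p.
  exact: ext_mid2_B2.
Qed.

Local Notation dsm X Y := (@ext_mid F n S X Y 0).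

Lemma hom_block X Y X' Y' a b c d :
  hom Y Y' a -> hom X Y' b -> hom Y X' c -> hom X X' d ->
  hom (dsm X Y) (dsm X' Y') (block_mx a b c d).
Proof.
move=> /homP ah /homP bh /homP ch /homP dh; apply/homP=> g.
rewrite /= !mulmx_block !ffunE !mulmx0 !mul0mx !addr0 !add0r.
by rewrite ah bh ch dh.
Qed.

Lemma hom_row X Y Z a b : hom Y Z a -> hom X Z b -> hom (dsm X Y) Z (row_mx a b).
Proof.
move=> /homP ah /homP bh; apply/homP=> g.
by rewrite /= mul_row_block mul_mx_row ffunE !mulmx0 addr0 add0r ah bh.
Qed.

Lemma hom_col X Y Z a b : hom Z Y a -> hom Z X b -> hom Z (dsm X Y) (col_mx a b).
Proof.
move=> /homP ah /homP bh; apply/homP=> g.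
by rewrite /= mul_block_col mul_col_mx ffunE !mul0mx addr0 add0r ah bh.
Qed.

Lemma cone_iso (X Y X' Y' : rawmor S) f1 g1 f2 g2 k1 l1 k2 l2 w w' :
  [/\ hom (src X) (src X') f1 /\ hom (src X') (src X) g1,
    hom (tgt X) (tgt X') f2 /\ hom (tgt X') (tgt X) g2,
    g1 *m f1 = 1%:M /\ f1 *m g1 = 1%:M, g2 *m f2 = 1%:M /\ f2 *m g2 = 1%:M &
    f2 *m dif X = dif X' *m f1] ->
  [/\ hom (src Y) (src Y') k1 /\ hom (src Y') (src Y) l1,
    hom (tgt Y) (tgt Y') k2 /\ hom (tgt Y') (tgt Y) l2,
    l1 *m k1 = 1%:M /\ k1 *m l1 = 1%:M, l2 *m k2 = 1%:M /\ k2 *m l2 = 1%:M &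
    k2 *m dif Y = dif Y' *m k1] ->
  k2 *m w = w' *m f1 ->
  mor_iso (cone X Y w) (cone X' Y' w').
Proof.
move=> [[a1 b1] [a2 b2] [e1 e1'] [e2 e2'] e] [[c1 d1] [c2 d2] [u1 u1'] [u2 u2'] u] ww.
apply/mor_isoP; exists (block_mx k1 0 0 f1), (block_mx l1 0 0 g1),
  (block_mx k2 0 0 f2), (block_mx l2 0 0 g2); split.
- by split; apply: hom_block; rewrite ?hom0.
- by split; apply: hom_block; rewrite ?hom0.
- by split; rewrite mulmx_block !mulmx0 !mul0mx !addr0 !add0r ?u1 ?e1 ?u1' ?e1'
    -scalar_mx_block.
- by split; rewrite mulmx_block !mulmx0 !mul0mx !addr0 !add0r ?u2 ?e2 ?u2' ?e2'
    -scalar_mx_block.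
by rewrite /= !mulmx_block !mulmx0 !mul0mx !addr0 !add0r u ww e.
Qed.

Lemma cone_sum_iso (X Y X' Y' : c2p S) : mor_iso X X' -> mor_iso Y Y' ->
  #|Homs (src X) (tgt Y)| = #|Homs (src X') (tgt Y')| /\
  \sum_(w in Homs (src X) (tgt Y)) cl (toc2p (cone X Y w)) =
  \sum_(w in Homs (src X') (tgt Y')) cl (toc2p (cone X' Y' w)).
Proof.
move=> /mor_isoP[f1 [g1 [f2 [g2 XX]]]] /mor_isoP[k1 [l1 [k2 [l2 YY]]]].
have [[f1h g1h] _ [gf fg] _ _] := XX; have [_ [k2h l2h] _ [lk kl] _] := YY.
pose t (w : 'M_(rdim (tgt Y), rdim (src X))) := k2 *m w *m g1.
have tK w : l2 *m t w *m f1 = w.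
  by rewrite /t !mulmxA lk mul1mx -mulmxA gf mulmx1.
have ti : injective t by move=> w w' e; rewrite -(tK w) e tK.
have tH : [set t w | w in Homs (src X) (tgt Y)]%SET = Homs (src X') (tgt Y').
  apply/setP=> w; rewrite inE; apply/imsetP/idP=> [[v]|wh].
    rewrite inE => vh ->.
    by apply: is_hom_comp g1h _; apply: is_hom_comp vh k2h.
  exists (l2 *m w *m f1); last by rewrite /t !mulmxA kl mul1mx -mulmxA fg mulmx1.
  rewrite inE; apply: is_hom_comp f1h _; exact: is_hom_comp wh l2h.
rewrite -tH card_imset //; split=> //.
rewrite big_imset /=; last by move=> w w' _ _; apply: ti.
apply: eq_bigr => w; rewrite inE => wh; apply: cl_iso.
rewrite !toc2pK; try apply: cone_c2p => //.
  apply: cone_iso XX YY _; by rewrite /t -mulmxA gf mulmx1.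
by apply: is_hom_comp g1h _; apply: is_hom_comp wh k2h.
Qed.

Lemma hall_mulE (a b : isoc2p S) :
  hall_mul (<< a >> : Hall S) << b >> = hall_basis_mul (rep_c2p a) (rep_c2p b).
Proof.
rewrite /hall_mul /malg_bilin !msuppU oner_eq0 !big_seq_fset1 || idtac.
by rewrite !mcoeffUU mulr1 scale1r.
Qed.

(** The sum over cones depends only on the isomorphism classes of X and Y,
    hence may be computed on the chosen representatives. *)
Lemma hall_cl (X Y : c2p S) :
  #|Homs (src X) (tgt Y)|%:R *: hall_mul (cl X) (cl Y) =
  \sum_(w in Homs (src X) (tgt Y)) cl (toc2p (cone X Y w)).
Proof.
have [c <-] := cone_sum_iso (rep_cls X) (rep_cls Y).
by rewrite -c -hall_basis_cone hall_mulE.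
Qed.

(** When all cones are isomorphic, their average is a single class; this is
    the case when X or Y is contractible, or when the target of Y is zero. *)
Lemma hall_cl_cone (X Y Z : c2p S) :
  (forall w, hom (src X) (tgt Y) w -> mor_iso (cone X Y w) Z) ->
  hall_mul (cl X) (cl Y) = cl Z.
Proof.
move=> h.
have NZ : #|Homs (src X) (tgt Y)|%:R \is a @GRing.unit (Zv F).
  by rewrite card_Hom natq_unit.
apply: (unit_scalerI NZ); rewrite hall_cl scaler_nat -sumr_const.
apply: eq_bigr => w; rewrite inE => wh.
by apply: cl_toc2p; [exact: cone_c2p | exact: h].
Qed.

Definition dsum (X Y : c2p S) : c2p S := C2P (cone_c2p (hom0 (src X) (tgt Y))).

Lemma uni_mul r t (k k' : 'M[F]_(r, t)) : k + k' = 0 ->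
  block_mx 1%:M k 0 1%:M *m block_mx 1%:M k' 0 1%:M = 1%:M.
Proof.
move=> kk; rewrite mulmx_block !mulmx0 !mul0mx !mulmx1 !mul1mx !addr0 !add0r.
by rewrite addrC kk -scalar_mx_block.
Qed.

(** Any w : P -> Y_0 is removed by an automorphism of P + Y_0, the
    differential of K_P being the identity. *)
Lemma hall_K_l P (Y : c2p S) : hall_mul (cl (K_ P)) (cl Y) = cl (dsum (K_ P) Y).
Proof.
apply: hall_cl_cone => w wh; apply/mor_isoP.
exists 1%:M, 1%:M, (block_mx 1%:M (- w) 0 1%:M), (block_mx 1%:M w 0 1%:M).
split; rewrite ?mulmx1 //.
- by rewrite !is_hom1.
- by split; apply: hom_block; rewrite ?is_hom1 ?hom0 ?homN.
- by split; apply: uni_mul; rewrite ?subrr ?addNr.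
rewrite /= mulmx_block !mulmx0 !mul0mx !mul1mx !mulmx1 !addr0 !add0r.
by rewrite subrr.
Qed.

(** Any w : X_(-1) -> P is removed by an automorphism of X_(-1) + P. *)
Lemma hall_K_r P (X : c2p S) : hall_mul (cl X) (cl (K_ P)) = cl (dsum X (K_ P)).
Proof.
apply: hall_cl_cone => w wh; apply/mor_isoP.
exists (block_mx 1%:M w 0 1%:M), (block_mx 1%:M (- w) 0 1%:M), 1%:M, 1%:M.
split; rewrite ?mulmx1 //.
- by split; apply: hom_block; rewrite ?is_hom1 ?hom0 ?homN.
- by rewrite !is_hom1.
- by split; apply: uni_mul; rewrite ?subrr ?addNr.
rewrite mul1mx /= mulmx_block !mulmx0 !mul0mx !mul1mx !mulmx1 !addr0 !add0r.
by [].
Qed.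

Lemma dsum_comm X Y : mor_iso (dsum X Y) (dsum Y X).
Proof.
pose sw a b := block_mx (0 : 'M[F]_(a, b)) 1%:M 1%:M 0.
have swK a b : sw a b *m sw b a = 1%:M.
  by rewrite /sw mulmx_block !mulmx0 !mul0mx !mulmx1 !addr0 !add0r -scalar_mx_block.
apply/mor_isoP; exists (sw _ _), (sw _ _), (sw _ _), (sw _ _); split.
- by split; apply: hom_block; rewrite ?is_hom1 ?hom0.
- by split; apply: hom_block; rewrite ?is_hom1 ?hom0.
- by split; apply: swK.
- by split; apply: swK.
by rewrite /= /sw !mulmx_block !mulmx0 !mul0mx !mul1mx !mulmx1 !addr0 !add0r.
Qed.

Lemma prj_sum_subproof (P P' : prj S) : is_mod (dsm P P') /\ projective (dsm P P').
Proof.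
have m : is_mod (dsm P P').
  by apply/ext_mod; [exact: modP | exact: modP | exact: cocycle0].
split=> //; exact (projective_ses m (ext_mid_ses (0 : coc P P')) (@prjP F n S P') (@prjP F n S P)).
Qed.

Definition prj_sum (P P' : prj S) : prj S :=
  @Prj F n S (Mod (prj_sum_subproof P P').1) (prj_sum_subproof P P').2.

Lemma dimvec_prj_sum P P' : dimvec (prj_sum P P') = dimvec P + dimvec P'.
Proof.
by rewrite (dimvecD (prj_sum_subproof P P').1 (ext_mid_ses (0 : coc P P'))) addrC.
Qed.

Lemma hall_KK P P' : hall_mul (cl (K_ P)) (cl (K_ P')) = cl (K_ (prj_sum P P')).
Proof.
rewrite hall_K_l; apply: cl_iso; apply/mor_isoP.
exists 1%:M, 1%:M, 1%:M, 1%:M; split; rewrite ?is_hom1 ?mulmx1 ?mul1mx //.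
by rewrite /= -scalar_mx_block.
Qed.

Lemma K_iso (P P' : prj S) : mod_iso P P' -> cl (K_ P) = cl (K_ P').
Proof.
case=> f [g [fh gh gf fg]]; apply: cl_iso; apply/mor_isoP.
by exists f, g, f, g; rewrite /= mulmx1 mul1mx.
Qed.

Lemma hall_Z_r P (X : c2p S) : hall_mul (cl X) (cl (Z_ P)) = cl (dsum X (Z_ P)).
Proof.
apply: hall_cl_cone => w wh; rewrite (_ : w = 0) ?[w]flatmx0 //.
exact: mor_iso_refl.
Qed.

End Cones.

(** * Objects of the category of morphisms *)

Section Decomposition.
Variables (F : finFieldType) (n : nat) (S : species F n).
Hypothesis acS : acyclic S.

Local Notation hom X Y f := (@is_hom F n S X Y f).
Local Notation dsm X Y := (@ext_mid F n S X Y 0).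

Definition tgt_prj (X : c2p S) : prj S :=
  @Prj F n S (Mod (tgt_mod (c2pP X))) (tgt_proj (c2pP X)).
Definition src_prj (X : c2p S) : prj S :=
  @Prj F n S (Mod (src_mod (c2pP X))) (src_proj (c2pP X)).

(** An isomorphism of the targets over M induces one of the kernels of the
    maps to M. *)
Lemma inj_target_iso (A B : rawmor S) M rA pA sA rB pB sB th th' :
  @ses F n S (src A) (tgt A) M (dif A) rA pA sA ->
  @ses F n S (src B) (tgt B) M (dif B) rB pB sB ->
  hom (tgt A) (tgt B) th -> hom (tgt B) (tgt A) th' ->
  th' *m th = 1%:M -> th *m th' = 1%:M -> pB *m th = pA -> mor_iso A B.
Proof.
move=> Ases Bses thh thh' t't tt' pth.
have pth' : pA *m th' = pB by rewrite -pth -mulmxA tt' mulmx1.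
have [aA _ splA] := Ases; have [aB _ splB] := Bses.
have [|f1h f1E] := ses_liftl Bses (is_hom_comp aA thh).
  by rewrite mulmxA pth (split_pf splA).
have [|g1h g1E] := ses_liftl Ases (is_hom_comp aB thh').
  by rewrite mulmxA pth' (split_pf splB).
apply/mor_isoP; exists (rB *m (th *m dif A)), (rA *m (th' *m dif B)), th, th'.
set f1 := rB *m _ in f1h f1E *; set g1 := rA *m _ in g1h g1E *.
have gf : dif A *m (g1 *m f1) = dif A.
  by rewrite mulmxA g1E -mulmxA f1E mulmxA t't mul1mx.
have fg : dif B *m (f1 *m g1) = dif B.
  by rewrite mulmxA f1E -mulmxA g1E mulmxA tt' mul1mx.
split=> //; split.
  by rewrite -[LHS]mul1mx -(split_gf splA) -mulmxA gf.
by rewrite -[LHS]mul1mx -(split_gf splB) -mulmxA fg.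
Qed.

Lemma ses_block I X0 M T i r p s : @ses F n S I X0 M i r p s ->
  @ses F n S (dsm I T) (dsm X0 T) M (block_mx 1%:M 0 0 i) (block_mx 1%:M 0 0 r)
    (row_mx 0 p) (col_mx 0 s).
Proof.
move=> [ih ph [ri ps e]]; split.
- by apply: hom_block; rewrite ?is_hom1 ?hom0.
- by apply: hom_row; rewrite ?hom0.
split.
- by rewrite mulmx_block !mulmx0 !mul0mx !mulmx1 ri !addr0 !add0r -scalar_mx_block.
- by rewrite mul_row_col mul0mx add0r.
rewrite mulmx_block mul_col_row !mulmx0 !mul0mx !mulmx1 !addr0 !add0r.
by rewrite add_block_mx !addr0 e -scalar_mx_block.
Qed.

(** Schanuel's lemma: lifting each presentation through the other gives an
    automorphism of the sum of the targets that exchanges the two maps to M. *)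
Lemma schanuel (X Y : c2p S) (M : mod S) r p s r' p' s' :
  @ses F n S (src X) (tgt X) M (dif X) r p s ->
  @ses F n S (src Y) (tgt Y) M (dif Y) r' p' s' ->
  mor_iso (dsum X (K_ (tgt_prj Y))) (dsum Y (K_ (tgt_prj X))).
Proof.
move=> XM YM; have [_ ph spl] := XM; have [_ ph' spl'] := YM.
have Xm := tgt_mod (c2pP X); have Ym := tgt_mod (c2pP Y).
have Xp : projective (tgt X) := tgt_proj (c2pP X).
have Yp : projective (tgt Y) := tgt_proj (c2pP Y).
have [f fh pf] := Xp (Mod Ym) M p' p ph' (section_surj (split_ps spl')) ph.
have [g gh pg] := Yp (Mod Xm) M p p' ph (section_surj (split_ps spl)) ph'.
have inv a b (u : 'M[F]_(a, b)) (v : 'M[F]_(b, a)) :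
    block_mx (- u) 1%:M (1%:M - v *m u) v *m block_mx (- v) 1%:M (1%:M - u *m v) u = 1%:M.
  rewrite mulmx_block [RHS]scalar_mx_block; congr block_mx.
  - by rewrite mulmxN mulNmx opprK mul1mx addrCA subrr addr0.
  - by rewrite mulmx1 mul1mx addNr.
  - rewrite mulmxBl mulmxBr mul1mx mulmx1 !mulmxN opprK mulmxA.
    by rewrite addrACA addNr subrr addr0.
  - by rewrite mulmx1 subrK.
refine (@inj_target_iso (dsum X (K_ (tgt_prj Y))) (dsum Y (K_ (tgt_prj X))) M
   _ _ _ _ _ _ (block_mx (- g) 1%:M (1%:M - f *m g) f)
   (block_mx (- f) 1%:M (1%:M - g *m f) g)
   (ses_block (tgt Y) XM) (ses_block (tgt X) YM) _ _ _ _ _).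
- apply: hom_block; rewrite ?homN ?is_hom1 //.
  by rewrite homB ?is_hom1 //; exact: is_hom_comp gh fh.
- apply: hom_block; rewrite ?homN ?is_hom1 //.
  by rewrite homB ?is_hom1 //; exact: is_hom_comp fh gh.
- exact: inv.
- exact: inv.
rewrite mul_row_block !mul0mx !add0r mulmxBr mulmx1 mulmxA pf pg subrr.
by [].
Qed.

(** I is the image of d and K its kernel. *)
Lemma hom_factor X1 X0 d : is_mod X1 -> is_mod X0 -> hom X1 X0 d ->
  exists K I f g p s i r, [/\ @ses F n S K X1 I f g p s, hom I X0 i, r *m i = 1%:M &
    d = i *m p].
Proof.
move=> X1m X0m dh.
have Us : submod [set u : 'cV[F]_(rdim X1) | d *m u == 0]%SET.
  apply/submodP; split; first split.
  - by rewrite inE mulmx0.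
  - move=> c u w; rewrite !inE => /eqP du /eqP dw.
    by rewrite mulmxDr -scalemxAr du dw scaler0 addr0.
  - by move=> g u; rewrite !inE mulmxA (homP dh) -mulmxA => /eqP->; rewrite mulmx0.
have [K [I [f [g [p [s [KXI UE]]]]]]] := submod_ses Us.
have mem (u : 'cV_(rdim X1)) : (d *m u == 0) = (p *m u == 0).
  by move/setP/(_ u): UE; rewrite !inE.
have df : d *m f = 0.
  apply: mx_ext => v; rewrite mul0mx -mulmxA; apply/eqP; rewrite mem mulmxA.
  by rewrite (split_pf (ses_split KXI)) mul0mx.
have [ih iE] := ses_liftr KXI dh df.
have ii : mx_inj (d *m s).
  move=> u w /eqP; rewrite -subr_eq0 -mulmxBr -mulmxA mem mulmxA.
  by rewrite (split_ps (ses_split KXI)) mul1mx subr_eq0 => /eqP.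
have [r ri] := mx_inj_retract ii.
by exists K, I, f, g, p, s, (d *m s), r.
Qed.

Lemma flat_eq m (A B : 'M[F]_(0, m)) : A = B.
Proof. by rewrite [A]flatmx0 [B]flatmx0. Qed.

(** The given retraction g is corrected along a linear section of p. *)
Lemma exact_ses Y L X f g p : hom Y L f -> hom L X p -> g *m f = 1%:M ->
  mx_surj p -> (forall u : 'cV_(rdim L), p *m u = 0 <-> exists w, f *m w = u) ->
  exists g' s', @ses F n S Y L X f g' p s'.
Proof.
move=> fh ph gf psurj ex; have [s ps] := mx_surj_section psurj.
have pf : p *m f = 0.
  by apply: mx_ext => w; rewrite mul0mx -mulmxA; apply/ex; exists w.
have fE : f *m (g *m (1%:M - s *m p)) = 1%:M - s *m p.
  apply: mx_ext => v; have [|w we] := (ex ((1%:M - s *m p) *m v)).1.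
    by rewrite mulmxBl mulmxBr mul1mx !mulmxA ps mul1mx subrr.
  by rewrite -!mulmxA -we (mulmxA g) gf mul1mx.
exists (g *m (1%:M - s *m p)), s; split=> //; split=> //.
  by rewrite -mulmxA mulmxBl mul1mx -mulmxA pf mulmx0 subr0.
by rewrite fE subrK.
Qed.

Lemma C_ses (M : mod S) : exists r p s, @ses F n S (src (C_ M)) (tgt (C_ M)) M (dif (C_ M)) r p s.
Proof.
have [di [p [ph ps ex _]]] := C_min_res acS M.
have [g gf] := mx_inj_retract di.
have [g' [s' e]] := exact_ses (dif_hom (c2pP (C_ M))) ph gf ps ex.
by exists g', p, s'.
Qed.

(** The algebra being hereditary, the image I of the differential is
    projective, so the source splits as I + P with P the kernel; the remaining
    injection of I into the target presents M, and is compared with the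
    minimal presentation by Schanuel's lemma. *)
Lemma decomposition (X : c2p S) : exists (M : mod S) (P : prj S) (I : c2p S)
    (p : 'M_(rdim M, rdim (tgt X))) s,
  [/\ [/\ hom (tgt X) M p, p *m s = 1%:M &
       forall u : 'cV_(rdim (tgt X)), p *m u = 0 <-> exists w, u = dif X *m w],
     dimvec M - dimvec P = dimvec (tgt X) - dimvec (src X),
     mor_iso X (dsum I (Z_ P)) &
     mor_iso (dsum I (K_ (tgt_prj (C_ M)))) (dsum (C_ M) (K_ (tgt_prj X)))].
Proof.
have [sm _ sp _ dh] := c2pP X.
pose tm := tgt_mod (c2pP X); pose tp := tgt_proj (c2pP X).
have [K0 [I [f0 [g0 [p0 [s0 [i [r [KXI0 ih ri dE]]]]]]]]] := hom_factor sm tm dh.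
have Im := ses_modr KXI0 sm.
have Ip : projective I := projective_sub tm Im ih ri tp.
have [K [f [g [s [KXI gh sh]]]]] :=
  projective_splits sm Im Ip (ses_p KXI0) (split_ps (ses_split KXI0)).
have Km := ses_modl KXI sm; have [fh ph spl] := KXI.
have Kp : projective K := projective_sub sm Km fh (split_gf spl) sp.
pose Ic := @IsC2P F n S (@RawMor F n S I (tgt X) i) Im tm Ip tp ih.
have [M0 [p [s' IXM]]] := inj_ses ih ri.
pose M := Mod (ses_modr IXM tm); pose P := @Prj F n S (Mod Km) Kp.
exists M, P, (C2P Ic), p, s'; split.
- have [_ ph' spl'] := IXM; split=> //; first exact: split_ps spl'.
  move=> u; split=> [pu|[w ->]]; last by rewrite dE !mulmxA (split_pf spl') !mul0mx.
  exists (s *m (r *m u)); rewrite dE -mulmxA (mulmxA p0) (split_ps spl) mul1mx.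
  exact: split_ker spl' _ _ pu.
- rewrite (dimvecD tm IXM) (dimvecD sm KXI) /=.
  move: (dimvec M0) (dimvec I) (dimvec K) => x y z; 
  by rewrite opprD [- z + _]addrC addrA [y + x]addrC addrK.
- apply/mor_isoP; exists (col_mx g p0), (row_mx f s), (col_mx 0 1%:M), (row_mx 0 1%:M).
  split.
  + by split; [apply: hom_col | apply: hom_row].
  + by split; [apply: hom_col; rewrite ?hom0 ?is_hom1 | apply: hom_row; rewrite ?hom0 ?is_hom1].
  + split; first by rewrite mul_row_col (split_fg spl).
    by rewrite mul_col_row (split_gf spl) (split_pf spl) (split_gs spl) (split_ps spl)
      -scalar_mx_block.
  + split; first by rewrite mul_row_col mul0mx mul1mx add0r.
    rewrite mul_col_row mulmx0 mul0mx mulmx1 mul1mx.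
    by rewrite [RHS]scalar_mx_block; congr block_mx; exact: flat_eq.
  rewrite /= mul_block_col mul_col_mx mul0mx mul1mx mul0mx add0r -dE.
  by congr col_mx; [exact: flat_eq | rewrite mul0mx add0r].
have [r' [p' [s2 CM]]] := C_ses M.
exact: (@schanuel (C2P Ic) (C_ M) M _ _ _ _ _ _ IXM CM).
Qed.

End Decomposition.

(** * The localized Hall algebra *)

Lemma malg_expand (R : nzRingType) (K : choiceType) (g : {malg R[K]}) :
  g = \sum_(k <- msupp g) g@_k *: << k >>.
Proof.
rewrite {1}[g]monalgE; apply: eq_bigr => k _; apply/malgP=> k'.
by rewrite mcoeffZ !mcoeffU mulrnAr mulr1.
Qed.

Section Localization.
Variables (F : finFieldType) (n : nat) (S : species F n).
Hypothesis acS : acyclic S.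
Variables (MH : unitAlgType (Zv F)) (loc : {linear Hall S -> MH}).
Hypothesis hloc : is_localization loc.

Local Notation hom X Y f := (@is_hom F n S X Y f).
Local Notation lc X := (loc (cl X)).
Local Notation Kel := (Kel loc).

Lemma loc_cl_mul (X Y Z : c2p S) : hall_mul (cl X) (cl Y) = cl Z ->
  (lc X) * (lc Y) = (lc Z).
Proof. by move=> e; rewrite -(locM hloc) e. Qed.

Lemma K_unit P : (lc (K_ P)) \is a GRing.unit.
Proof. exact: loc_unit hloc P. Qed.

Lemma loc_span (Q : MH -> Prop) : (forall x y, Q x -> Q y -> Q (x + y)) ->
  (forall c x, Q x -> Q (c *: x)) -> Q 0 -> (forall X : c2p S, Q (lc X)) ->
  forall h : Hall S, Q (loc h).
Proof.
move=> QD QZ Q0 QX h; rewrite (malg_expand h) linear_sum.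
elim/big_ind: _ => // c _; rewrite linearZ /= -cl_rep.
by apply: QZ; apply: QX.
Qed.

(** On classes [X] both products are the class of the direct sum of X with
    K_P. *)
Lemma K_comm P (x : MH) : (lc (K_ P)) * x = x * (lc (K_ P)).
Proof.
have [h [P' ->]] := loc_frac hloc x.
have comm (h' : Hall S) P1 : (lc (K_ P1)) * loc h' = loc h' * (lc (K_ P1)).
  apply: (loc_span (Q := fun x => (lc (K_ P1)) * x = x * (lc (K_ P1)))) => [u w e1 e2|c u e| | X].
  - by rewrite mulrDl mulrDr e1 e2.
  - by rewrite -scalerAl -scalerAr e.
  - by rewrite mul0r mulr0.
  rewrite (loc_cl_mul (hall_K_l P1 X)) (loc_cl_mul (hall_K_r P1 X)).
  by congr (loc _); apply: cl_iso; apply: dsum_comm.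
have cV := commrV (comm (cl (K_ P')) P : GRing.comm (lc (K_ P)) (lc (K_ P'))).
by rewrite mulrA comm -mulrA cV mulrA.
Qed.

Lemma KV_comm P (x : MH) : (lc (K_ P))^-1 * x = x * (lc (K_ P))^-1.
Proof. by apply/esym/commrV/esym; apply: K_comm. Qed.

Lemma KK P P' : (lc (K_ P)) * (lc (K_ P')) = (lc (K_ (prj_sum P P'))).
Proof. exact: loc_cl_mul (hall_KK P P'). Qed.

Lemma K_dimvec (P P' : prj S) : dimvec P = dimvec P' -> (lc (K_ P)) = (lc (K_ P')).
Proof.
move=> e; congr (loc _); apply: K_iso.
by apply: (projective_iso acS) => //; [exact: modP | exact: modP | exact: prjP | exact: prjP].
Qed.

Lemma KelE (P P' : prj S) : Kel (dimvec P - dimvec P') = (lc (K_ P)) / (lc (K_ P')).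
Proof.
rewrite /Defs.Kel; case: xgetP => [[P1 P1'] /= _ /= e|/(_ (P, P'))]; last by case.
have /eqP := e; rewrite subr_eq addrAC eq_sym subr_eq -!dimvec_prj_sum => /eqP/K_dimvec.
rewrite -!KK => e'.
apply: (mulIr (K_unit P1')); rewrite mulrVK ?K_unit //.
by rewrite -mulrA KV_comm mulrA e' mulrK ?K_unit.
Qed.

(** The two terms of the resolution of S_i differ by a basis vector. *)
Lemma dimvec_gen (a : 'cV[int]_n) : exists P P' : prj S, dimvec P - dimvec P' = a.
Proof.
pose Q a := exists P P' : prj S, dimvec P - dimvec P' = a.
have QD b c : Q b -> Q c -> Q (b + c).
  move=> [P [P' <-]] [P1 [P1' <-]]; exists (prj_sum P P1), (prj_sum P' P1').
  by rewrite !dimvec_prj_sum opprD addrACA.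
have QN b : Q b -> Q (- b).
  by move=> [P [P' <-]]; exists P', P; rewrite opprB.
have Q0 : Q 0 by exists (prj0 S), (prj0 S); rewrite subrr.
have Qnat b k : Q b -> Q (b *+ k).
  by move=> Qb; elim: k => [|k IH]; rewrite ?mulr0n // mulrS; apply: QD.
have Qs i : Q (delta_mx i 0).
  have [r [p [s CM]]] := C_ses acS (simple S i).
  exists (tgt_prj (C_ (simple S i))), (src_prj (C_ (simple S i))).
  rewrite (dimvecD (tgt_mod (c2pP _)) CM) addrC addKr.
  apply/matrixP=> j k; rewrite ord1 dimvecE mlt_simple mxE eqxx andbT eq_sym.
  by case: eqP.
have -> : a = \sum_i a i 0 *: delta_mx i 0.
  rewrite {1}[a]matrix_sum_delta; apply: eq_bigr => i _.
  by rewrite big_ord1.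
elim/big_ind: _ => // i _; case: (a i 0) => k.
  by rewrite -[Posz k]natz scaler_nat; apply: Qnat.
by rewrite NegzE scaleNr -[Posz k.+1]natz scaler_nat; apply/QN/Qnat.
Qed.

Lemma Kel_comm a x : Kel a * x = x * Kel a.
Proof.
have [P [P' <-]] := dimvec_gen a.
by rewrite KelE -mulrA KV_comm mulrA K_comm mulrA.
Qed.

Lemma KelD a b : Kel (a + b) = Kel a * Kel b.
Proof.
have [P [P' <-]] := dimvec_gen a; have [P1 [P1' <-]] := dimvec_gen b.
rewrite !KelE addrACA -opprD -!dimvec_prj_sum KelE -!KK.
rewrite invrM ?K_unit // -!mulrA; congr (_ * _).
by rewrite [RHS]KV_comm mulrA.
Qed.

Lemma Kel0 : Kel 0 = 1.
Proof. by rewrite -(subrr (dimvec (prj0 S))) KelE mulrV ?K_unit. Qed.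

Lemma KelP (P : prj S) : Kel (dimvec P) = (lc (K_ P)).
Proof.
have d0 : dimvec (prj0 S) = 0 by apply: rdim0_dimvec => //; exact: modP.
have e : (lc (K_ (prj0 S))) = 1.
  apply: (mulIr (K_unit (prj0 S))); rewrite mul1r KK; apply: K_dimvec.
  by rewrite dimvec_prj_sum d0 addr0.
by rewrite -[dimvec P]subr0 -d0 KelE e divr1.
Qed.

(** The classes [K_T] appearing in the decomposition of X become invertible,
    and can be cancelled. *)
Lemma loc_decomposition (X : c2p S) : exists (M : mod S) (P : prj S)
    (p : 'M_(rdim M, rdim (tgt X))) s,
  [/\ hom (tgt X) M p, p *m s = 1%:M,
      forall u : 'cV_(rdim (tgt X)), p *m u = 0 <-> exists w, u = dif X *m w,
      dimvec M - dimvec P = dimvec (tgt X) - dimvec (src X) &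
      (lc X) = Kel (dimvec (tgt X)) * XX loc M P].
Proof.
have [M [P [I [p [s [[ph ps pX] dE XI IC]]]]]] := decomposition acS X.
exists M, P, p, s; split=> //; set T := tgt_prj (C_ M) in IC.
have e1 : (lc X) = (lc I) * (lc (Z_ P)).
  by rewrite (loc_cl_mul (hall_Z_r P I)) (cl_iso XI).
have e2 : (lc I) * (lc (K_ T)) = (lc (C_ M)) * (lc (K_ (tgt_prj X))).
  by rewrite !(loc_cl_mul (hall_K_r _ _)) (cl_iso IC).
rewrite -[dimvec (tgt X)]/(dimvec (tgt_prj X)) KelP /XX /XM /XP.
rewrite -[dimvec (tgt (C_ M))]/(dimvec T).
have -> : Kel (- dimvec T) = (lc (K_ T))^-1.
  apply: (mulIr (K_unit T)); rewrite mulVr ?K_unit //.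
  by rewrite -KelP -KelD addNr Kel0.
apply: (mulIr (K_unit T)).
rewrite -!mulrA (mulrA (lc (C_ M))) -[lc (C_ M) * _ * _](K_comm T) mulKr ?K_unit //.
by rewrite e1 -!mulrA -(K_comm T) !mulrA e2 (K_comm (tgt_prj X)).
Qed.

(** Denominators only change the index of K_a. *)
Lemma MH_span (x : MH) : exists (r : seq (Zv F * 'cV[int]_n * mod S * prj S)),
  x = \sum_(t <- r) t.1.1.1 *: (Kel t.1.1.2 * XX loc t.1.2 t.2).
Proof.
have [h [P0 ->]] := loc_frac hloc x.
pose Q y := exists (r : seq (Zv F * 'cV[int]_n * mod S * prj S)),
  y / (lc (K_ P0)) = \sum_(t <- r) t.1.1.1 *: (Kel t.1.1.2 * XX loc t.1.2 t.2).
apply: (loc_span (Q := Q)) => [u w [r1 e1] [r2 e2]|c u [r e]| |X].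
- by exists (r1 ++ r2); rewrite big_cat mulrDl e1 e2.
- exists [seq (c * t.1.1.1, t.1.1.2, t.1.2, t.2) | t <- r].
  rewrite big_map -scalerAl e scaler_sumr; apply: eq_bigr => t _.
  by rewrite scalerA.
- by exists [::]; rewrite big_nil mul0r.
have [M [P [p [s [_ _ _ _ ->]]]]] := loc_decomposition X.
exists [:: (1, dimvec (tgt X) - dimvec P0, M, P)]; rewrite big_seq1 scale1r.
transitivity (Kel (dimvec (tgt X) - dimvec P0) * XX loc M P); last by [].
rewrite -[dimvec (tgt X)]/(dimvec (tgt_prj X)) KelP KelE; move: (XX _ _ _) => y.
by rewrite -[RHS]mulrA KV_comm mulrA.
Qed.

End Localization.

(** * Dimensions of Ext over division rings *)

Section DivisionRing.
Variables (V T : finZmodType) (Z B : {set V}) (E : {set T}) (act : T -> V -> V).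
Hypotheses (B0 : 0 \in B) (BZ : B \subset Z).
Hypothesis BB : forall x y, x \in B -> y \in B -> x - y \in B.
Hypothesis ZB : forall x y, x \in Z -> y \in Z -> x - y \in Z.
Hypothesis E0 : 0 \in E.
Hypothesis EB : forall e f, e \in E -> f \in E -> e - f \in E.
Hypothesis E1 : (1 < #|E|)%N.
Hypothesis actBl : forall e f v, act (e - f) v = act e v - act f v.
Hypothesis actBr : forall e v w, act e (v - w) = act e v - act e w.
Hypothesis actZ : forall e v, e \in E -> v \in Z -> act e v \in Z.
Hypothesis actB : forall e v, e \in E -> v \in B -> act e v \in B.
Hypothesis actM : forall e f, e \in E -> f \in E ->
  exists2 h, h \in E & forall v, act e (act f v) = act h v.
Hypothesis actV : forall e, e \in E -> e != 0 ->
  exists2 f, f \in E & forall v, act f (act e v) = v.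

Definition comb r (f : {ffun 'I_r -> T}) (z : 'I_r -> V) := \sum_k act (f k) (z k).

(** A basis of Z / B over the division ring E, lifted to Z. *)
Definition is_basis r := exists z : 'I_r -> V, (forall k, z k \in Z) /\
  forall x, x \in Z -> exists! f : {ffun 'I_r -> T},
    (forall k, f k \in E) /\ x - comb f z \in B.

Let Z0 : 0 \in Z. Proof. exact: (fintype.subsetP BZ). Qed.
Let ZD x y : x \in Z -> y \in Z -> x + y \in Z. Proof. exact: closedD. Qed.
Let EN e : e \in E -> - e \in E. Proof. by rewrite -sub0r; apply: EB. Qed.
Let act0l v : act 0 v = 0. Proof. by have := actBl 0 0 v; rewrite !subrr. Qed.
Let act0r e : act e 0 = 0. Proof. by have := actBr e 0 0; rewrite !subrr. Qed.
Let actDr e v w : act e (v + w) = act e v + act e w.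
Proof. by rewrite -{1}[w]opprK actBr -[- w]sub0r actBr act0r sub0r opprK. Qed.

Let comb_Z r (f : {ffun 'I_r -> T}) z :
  (forall k, f k \in E) -> (forall k, z k \in Z) -> comb f z \in Z.
Proof.
by move=> fE zZ; rewrite /comb; elim/big_ind: _ => // k _; apply: actZ.
Qed.

(** Coordinates and a coboundary term identify Z with E^r x B. *)
Lemma card_basis r : is_basis r -> #|Z| = (#|E| ^ r * #|B|)%N.
Proof.
move=> [z [zZ zU]].
pose phi (u : {ffun 'I_r -> T} * V) := comb u.1 z + u.2.
have fE (f : {ffun 'I_r -> T}) :
    (f \in [set f | f \in ffun_on E]%SET) = [forall k, f k \in E].
  by rewrite inE; apply/ffun_onP/forallP.
have cE : #|[set f : {ffun 'I_r -> T} | f \in ffun_on E]%SET| = (#|E| ^ r)%N.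
  by rewrite cardsE card_ffun_on card_ord.
rewrite -cE -cardsX -(@card_in_imset _ _ phi); last first.
  move=> [f b] [f' b'] /finset.setXP[]; rewrite fE => /forallP fe bB.
  move=> /finset.setXP[]; rewrite fE => /forallP fe' bB'; rewrite /phi /= => e.
  have xZ : comb f z + b \in Z by rewrite ZD ?comb_Z // (fintype.subsetP BZ).
  have [g [_ gU]] := zU _ xZ.
  have gf : g = f by apply: gU; split=> //; rewrite addrC addKr.
  have gf' : g = f' by apply: gU; split=> //; rewrite e addrC addKr.
  move: e; rewrite -gf -gf' => /addrI ->; by [].
apply: eq_card => x; apply/idP/imsetP=> [xZ|[[f b]]].
  have [f [[fe fB] _]] := zU x xZ; exists (f, x - comb f z).
    by apply/finset.setXP; rewrite fE; split=> //; apply/forallP.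
  by rewrite /phi /= addrC subrK.
move=> /finset.setXP[]; rewrite fE => /forallP fe bB ->.
by rewrite ZD ?comb_Z // (fintype.subsetP BZ).
Qed.

(** A maximal independent family is a basis: a relation expressing dependence
    of one more vector can be solved for it as nonzero elements of E are
    invertible. *)
Lemma exists_basis : exists r, is_basis r.
Proof.
pose indep r := `[< exists z : 'I_r -> V, (forall k, z k \in Z) /\
  forall f : {ffun 'I_r -> T}, (forall k, f k \in E) -> comb f z \in B ->
    f = 0 >].
have combB r (f g : {ffun 'I_r -> T}) z : comb (f - g) z = comb f z - comb g z.
  by rewrite /comb -sumrB; apply: eq_bigr => k _; rewrite !ffunE actBl.
have indep0 : indep 0%N.
  apply/asboolP; exists (fun=> 0); split=> // f _ _.
  by apply/ffunP=> -[].
have bound r : indep r -> (r <= #|Z|)%N.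
  move=> /asboolP[z [zZ zi]]; apply: leq_trans (ltnW (ltn_expl r E1)) _.
  have <- : #|[set f : {ffun 'I_r -> T} | f \in ffun_on E]%SET| = (#|E| ^ r)%N.
    by rewrite cardsE card_ffun_on card_ord.
  rewrite -(@card_in_imset _ _ (fun f => comb f z)); last first.
    move=> f g; rewrite !inE => /ffun_onP fE /ffun_onP gE e.
    apply/eqP; rewrite -subr_eq0; apply/eqP/zi => [k|]; last by rewrite combB e subrr.
    by rewrite !ffunE EB.
  apply: subset_leq_card; apply/fintype.subsetP=> _ /imsetP[f + ->].
  by rewrite inE => /ffun_onP fE; apply: comb_Z.
have [r /asboolP[z [zZ zi]] rmax] := ex_maxnP (ex_intro _ 0%N indep0) bound.
exists r, z; split=> // x xZ.
have [f [fE fB]] : exists f : {ffun 'I_r -> T}, (forall k, f k \in E) /\ x - comb f z \in B.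
  apply: contrapT => /forallNP no.
  suff /rmax : indep r.+1 by rewrite ltnn.
  pose z' (k : 'I_r.+1) := if unlift ord_max k is Some k' then z k' else x.
  have z'w k : z' (widen_ord (leqnSn r) k) = z k.
    have -> : widen_ord (leqnSn r) k = lift ord_max k.
      by apply: val_inj; rewrite /= /bump leqNgt ltn_ord.
    by rewrite /z' liftK.
  have z'm : z' ord_max = x by rewrite /z' unlift_none.
  apply/asboolP; exists z'; split.
    by move=> k; rewrite /z'; case: unlift.
  move=> f fE; pose f' : {ffun 'I_r -> T} := [ffun k => f (widen_ord (leqnSn r) k)].
  have -> : comb f z' = comb f' z + act (f ord_max) x.
    rewrite /comb big_ord_recr /= z'm; congr (_ + _); apply: eq_bigr => k _.
    by rewrite z'w ffunE.
  have f'E k : f' k \in E by rewrite ffunE.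
  have [f0|f0] := eqVneq (f ord_max) 0.
    rewrite f0 act0l addr0 => /(zi f' f'E) f'0; apply/ffunP=> k; rewrite ffunE.
    have [k' ->|->] := unliftP ord_max k; last exact: f0.
    have -> : lift ord_max k' = widen_ord (leqnSn r) k'.
      by apply: val_inj; rewrite /= /bump leqNgt ltn_ord.
    by have /ffunP/(_ k') := f'0; rewrite !ffunE.
  have [e eE eK] := actV (fE ord_max) f0.
  move=> /(actB eE); rewrite actDr eK => sB; exfalso.
  have [h hE] : exists h : {ffun 'I_r -> T}, forall k, h k \in E /\
      forall v, act e (act (f' k) v) = act (h k) v.
    have ch k : exists h, (h \in E) && [forall v, act e (act (f' k) v) == act h v].
      have [h hE hv] := actM eE (f'E k); exists h; rewrite hE.
      by apply/forallP=> v; rewrite hv.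
    exists [ffun k => xchoose (ch k)] => k; rewrite ffunE.
    have /andP[-> /forallP hv] := xchooseP (ch k); split=> // v; exact/eqP.
  apply: (no (- h)); split=> [k|]; first by rewrite ffunE EN // (hE k).1.
  rewrite -[- h]sub0r combB opprB [X in _ - X](_ : comb 0 z = 0); last first.
    by rewrite /comb big1 // => k _; rewrite ffunE act0l.
  rewrite subr0; move: sB; rewrite addrC; congr (_ + _ \in B).
  rewrite /comb (big_morph (act e) (actDr e) (act0r e)); apply: eq_bigr => k _.
  exact: (hE k).2.
exists f; split=> // g [gE gB]; apply/eqP; rewrite -subr_eq0; apply/eqP/zi.
  by move=> k; rewrite !ffunE EB.
rewrite combB; have := BB gB fB.
by rewrite opprB addrC addrA subrK.
Qed.

End DivisionRing.

Section RMatrices.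
Variables (F : finFieldType) (n : nat) (S : species F n).
Implicit Types X Y : rawmod S.

Local Notation hom X Y f := (@is_hom F n S X Y f).
Local Notation q := #|F|.
Local Notation Homs X Y := (@Defs.Hom F n S X Y).
Local Notation coc X Y := {ffun gens S -> 'M[F]_(rdim Y, rdim X)}.

Lemma Hom_simple0 i j f : i != j -> hom (simple S i) (simple S j) f -> f = 0.
Proof.
move=> ij fh; rewrite -[f]mulmx1 -(regmx1 S i) -raw_simple_gD (homP fh).
by rewrite raw_simple_gD0 // mul0mx.
Qed.

(** Evaluating at 1 identifies the endomorphisms of S_i with K_i. *)
Lemma card_End_simple i : #|Homs (simple S i) (simple S i)| = (q ^ sdim S i)%N.
Proof.
rewrite -card_sD -cardsT.
rewrite -(card_imset _ (f := fun a : finvect_type (sD S i) => regmx (a : sD S i))); last first.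
  move=> a b ab; rewrite -[a]mulr1 -[b]mulr1 -[1 : sD S i]vecKK.
  by rewrite -!Kvec_regmx ab.
apply: eq_card => f; rewrite inE; apply/idP/imsetP=> [fh|[a _ ->]].
  exists (Kvec (f *m vecK 1)); rewrite ?inE //; apply: mx_ext => v.
  rewrite -[v]KvecK; set b := Kvec v.
  have -> : vecK b = regmx b *m vecK 1.
    by apply: (can_inj (@KvecK _ _ S i)); rewrite Kvec_regmx !vecKK mulr1.
  apply: (can_inj (@KvecK _ _ S i)).
  have := homP fh (gD b); rewrite raw_simple_gD => e.
  by rewrite mulmxA e -mulmxA !Kvec_regmx vecKK mulr1 mulrC.
apply/homP=> -[[j b]|u]; last by rewrite mulmx0 mul0mx.
rewrite -/(gD (b : sD S j)); have [e|ji] := eqVneq j i; last first.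
  by rewrite raw_simple_gD0 // mulmx0 mul0mx.
by subst j; rewrite raw_simple_gD -!regmxM mulrC.
Qed.

Lemma dimHom_simple i j : dimHom (simple S i) (simple S j) = (if i == j then sdim S i else 0)%N.
Proof.
apply: (@expq_inj F); rewrite -card_Hom; case: eqVneq => [<-|ij].
  exact: card_End_simple.
rewrite expn0; apply/eqP/cards1P; exists 0; apply/setP=> f; rewrite !inE.
apply/idP/eqP=> [|->]; last exact: hom0.
exact: Hom_simple0.
Qed.

Lemma End_simple_inv i f : hom (simple S i) (simple S i) f -> f != 0 ->
  exists2 g, hom (simple S i) (simple S i) g & g *m f = 1%:M /\ f *m g = 1%:M.
Proof.
move=> fh f0; have [g fg] := simple_hom_surj fh f0.
have gf : g *m f = 1%:M by apply: mulmx1C.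
exists g => //; apply/homP=> x.
by rewrite -[LHS]mulmx1 -fg mulmxA -(mulmxA g) -(homP fh) !mulmxA gf mul1mx.
Qed.

Lemma Z1_B X Y z z' : is_mod X -> is_mod Y ->
  z \in Z1 X Y -> z' \in Z1 X Y -> z - z' \in Z1 X Y.
Proof.
move=> Xm Ym /(Z1P _ Xm Ym) zc /(Z1P _ Xm Ym) zc'; apply/Z1P => //.
by rewrite addrC -scaleN1r; apply: cocycleZD.
Qed.

Lemma B1_B X Y z z' : z \in B1 X Y -> z' \in B1 X Y -> z - z' \in B1 X Y.
Proof. by move=> /B1P[h ->] /B1P[h' ->]; apply/B1P; exists (h - h'); rewrite cobB. Qed.

Lemma B1_0 X Y : 0 \in B1 X Y.
Proof. by apply/B1P; exists 0; rewrite cob0. Qed.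

Lemma card_End_gt1 i : (1 < #|Homs (simple S i) (simple S i)|)%N.
Proof. by rewrite card_End_simple -{1}(expn0 q) ltn_exp2l ?q_gt1 ?sdim_gt0. Qed.

Definition lact X Y (f : 'M[F]_(rdim Y)) (z : coc X Y) : coc X Y := [ffun g => f *m z g].
Definition ract X Y (f : 'M[F]_(rdim X)) (z : coc X Y) : coc X Y := [ffun g => z g *m f].

(** The endomorphisms of the simple target form a division ring. *)
Lemma lact_basis X j (Y := simple S j) : is_mod X ->
  (forall r, is_basis (Z1 X Y) (B1 X Y) (Homs Y Y) (@lact X Y) r ->
     #|Z1 X Y| = (#|Homs Y Y| ^ r * #|B1 X Y|)%N) /\
  exists r, is_basis (Z1 X Y) (B1 X Y) (Homs Y Y) (@lact X Y) r.
Proof.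
move=> Xm; have Ym : is_mod Y := modP _.
have h1 : {subset B1 X Y <= Z1 X Y} by apply/fintype.subsetP; apply: B1_Z1.
have h2 (e f : 'M_(rdim Y)) v : lact (X := X) (e - f) v = lact e v - lact f v.
  by apply/ffunP=> g; rewrite !ffunE mulmxBl.
have h3 (e : 'M_(rdim Y)) v w : lact (X := X) e (v - w) = lact e v - lact e w.
  by apply/ffunP=> g; rewrite !ffunE mulmxBr.
have h4 (e : 'M_(rdim Y)) (v : coc X Y) : e \in Homs Y Y -> v \in Z1 X Y -> lact e v \in Z1 X Y.
  rewrite inE => eh /(Z1P _ Xm Ym) vc; apply/Z1P => //.
  have := pull_cocycle (is_hom1 X) eh vc; congr cocycle.
  by apply/ffunP=> g; rewrite !ffunE mulmx1.
have h5 (e : 'M_(rdim Y)) (v : coc X Y) : e \in Homs Y Y -> v \in B1 X Y -> lact e v \in B1 X Y.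
  rewrite inE => eh /B1P[h ->]; apply/B1P; exists (e *m h); apply/ffunP=> g.
  by rewrite !ffunE mulmxBr !mulmxA (homP eh).
have h6 (e f : 'M_(rdim Y)) : e \in Homs Y Y -> f \in Homs Y Y ->
    exists2 h, h \in Homs Y Y & forall v : coc X Y, lact e (lact f v) = lact h v.
  rewrite !inE => eh fh; exists (e *m f); first by rewrite inE; exact: is_hom_comp fh eh.
  by move=> v; apply/ffunP=> g; rewrite !ffunE mulmxA.
have h7 (e : 'M_(rdim Y)) : e \in Homs Y Y -> e != 0 ->
    exists2 f, f \in Homs Y Y & forall v : coc X Y, lact f (lact e v) = v.
  rewrite inE => eh e0; have [f fh [fe _]] := End_simple_inv eh e0.
  exists f; first by rewrite inE.
  by move=> v; apply/ffunP=> g; rewrite !ffunE mulmxA fe mul1mx.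
have h8 (e f : 'M_(rdim Y)) : e \in Homs Y Y -> f \in Homs Y Y -> e - f \in Homs Y Y.
  by rewrite !inE; apply: homB.
have h9 : 0 \in Homs Y Y by rewrite inE hom0.
split; [apply: card_basis | apply: exists_basis] => //; try exact: card_End_gt1;
  try exact: B1_0; try exact: B1_Z1; try exact: B1_B; by move=> *; apply: Z1_B.
Qed.

(** The endomorphisms of the simple source form a division ring. *)
Lemma ract_basis j Y (X := simple S j) : is_mod Y ->
  (forall r, is_basis (Z1 X Y) (B1 X Y) (Homs X X) (@ract X Y) r ->
     #|Z1 X Y| = (#|Homs X X| ^ r * #|B1 X Y|)%N) /\
  exists r, is_basis (Z1 X Y) (B1 X Y) (Homs X X) (@ract X Y) r.
Proof.
move=> Ym; have Xm : is_mod X := modP _.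
have h2 (e f : 'M_(rdim X)) v : ract (Y := Y) (e - f) v = ract e v - ract f v.
  by apply/ffunP=> g; rewrite !ffunE mulmxBr.
have h3 (e : 'M_(rdim X)) v w : ract (Y := Y) e (v - w) = ract e v - ract e w.
  by apply/ffunP=> g; rewrite !ffunE mulmxBl.
have h4 (e : 'M_(rdim X)) (v : coc X Y) : e \in Homs X X -> v \in Z1 X Y -> ract e v \in Z1 X Y.
  rewrite inE => eh /(Z1P _ Xm Ym) vc; apply/Z1P => //.
  have := pull_cocycle eh (is_hom1 Y) vc; congr cocycle.
  by apply/ffunP=> g; rewrite !ffunE mul1mx.
have h5 (e : 'M_(rdim X)) (v : coc X Y) : e \in Homs X X -> v \in B1 X Y -> ract e v \in B1 X Y.
  rewrite inE => eh /B1P[h ->]; apply/B1P; exists (h *m e); apply/ffunP=> g.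
  by rewrite !ffunE mulmxBl -!mulmxA (homP eh).
have h6 (e f : 'M_(rdim X)) : e \in Homs X X -> f \in Homs X X ->
    exists2 h, h \in Homs X X & forall v : coc X Y, ract e (ract f v) = ract h v.
  rewrite !inE => eh fh; exists (f *m e); first by rewrite inE; exact: is_hom_comp eh fh.
  by move=> v; apply/ffunP=> g; rewrite !ffunE mulmxA.
have h7 (e : 'M_(rdim X)) : e \in Homs X X -> e != 0 ->
    exists2 f, f \in Homs X X & forall v : coc X Y, ract f (ract e v) = v.
  rewrite inE => eh e0; have [f fh [_ ef]] := End_simple_inv eh e0.
  exists f; first by rewrite inE.
  by move=> v; apply/ffunP=> g; rewrite !ffunE -mulmxA ef mulmx1.
have h8 (e f : 'M_(rdim X)) : e \in Homs X X -> f \in Homs X X -> e - f \in Homs X X.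
  by rewrite !inE; apply: homB.
have h9 : 0 \in Homs X X by rewrite inE hom0.
split; [apply: card_basis | apply: exists_basis] => //; try exact: card_End_gt1;
  try exact: B1_0; try exact: B1_Z1; try exact: B1_B; by move=> *; apply: Z1_B.
Qed.

Lemma dimExt_card X Y k d : is_mod X -> is_mod Y ->
  #|Z1 X Y| = ((q ^ d) ^ k * #|B1 X Y|)%N -> (d * k)%N = dimExt X Y.
Proof.
move=> Xm Ym; rewrite card_Z1 // card_B1 -expnM -expnD => /expq_inj.
by rewrite /dimExt -/(dimZ1 X Y) -/(dimB1 X Y) => ->; rewrite addnK.
Qed.

Lemma ext_ldimE i j :
  (sdim S i * ext_ldim (simple S j) (simple S i))%N = dimExt (simple S j) (simple S i).
Proof.
set X := simple S j; set Y := simple S i.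
have [cardE [r0 br0]] := lact_basis i (modP X).
have basisE r : is_ext_ldim X Y r <-> is_basis (Z1 X Y) (B1 X Y) (Homs Y Y) (@lact X Y) r.
  have combE (f : {ffun 'I_r -> 'M[F]_(rdim Y)}) (z : 'I_r -> coc X Y) :
       [ffun g => \sum_k f k *m z k g] = comb (@lact X Y) f z.
    by apply/ffunP=> g; rewrite /comb sum_ffunE !ffunE; apply: eq_bigr => k _; rewrite ffunE.
  split=> -[z [zZ zU]]; exists z; split=> // x xZ; have [f [[fE fB] fU]] := zU x xZ;
    exists f; split; do ?[by split=> //; rewrite ?combE // -combE]
     ; move=> g [gE gB]; apply: fU; split=> //; by rewrite ?combE // -combE.
apply: dimExt_card; try exact: modP.
rewrite -card_End_simple; apply/cardE/basisE.
by apply: (@xgetPex _ 0%N [set r | is_ext_ldim X Y r]%classic); exists r0; apply/basisE.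
Qed.

Lemma ext_rdimE i j :
  (sdim S i * ext_rdim (simple S i) (simple S j))%N = dimExt (simple S i) (simple S j).
Proof.
set X := simple S i; set Y := simple S j.
have [cardE [r0 br0]] := ract_basis i (modP Y).
have basisE r : is_ext_rdim X Y r <-> is_basis (Z1 X Y) (B1 X Y) (Homs X X) (@ract X Y) r.
  have combE (f : {ffun 'I_r -> 'M[F]_(rdim X)}) (z : 'I_r -> coc X Y) :
       [ffun g => \sum_k z k g *m f k] = comb (@ract X Y) f z.
    by apply/ffunP=> g; rewrite /comb sum_ffunE !ffunE; apply: eq_bigr => k _; rewrite ffunE.
  split=> -[z [zZ zU]]; exists z; split=> // x xZ; have [f [[fE fB] fU]] := zU x xZ;
    exists f; split; do ?[by split=> //; rewrite ?combE // -combE]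
     ; move=> g [gE gB]; apply: fU; split=> //; by rewrite ?combE // -combE.
apply: dimExt_card; try exact: modP.
rewrite -card_End_simple; apply/cardE/basisE.
by apply: (@xgetPex _ 0%N [set r | is_ext_rdim X Y r]%classic); exists r0; apply/basisE.
Qed.

(** The bimodule maps from the arrows j -> i to Hom_k(K_j, K_i), written
    without reference to modules over the species, so that a species and its
    full subspecies can be compared. *)
Definition bimod_maps i j :
   {set {ffun finvect_type (sM S i j) -> 'M[F]_(sdim S i, sdim S j)}} :=
  [set w : {ffun finvect_type (sM S i j) -> 'M[F]_(sdim S i, sdim S j)} |
    `[< [/\ forall (c : F) (m m' : sM S i j), w (c *: m + m') = c *: w m + w m',
      forall (a : sD S i) (m : sM S i j), w (sl a m) = regmx a *m w m &
      forall (m : sM S i j) (b : sD S j), w (sr m b) = w m *m regmx b] >]]%SET.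

Lemma card_Z10_simple i j :
  #|Z10 (simple S j) (simple S i)| = #|bimod_maps i j|.
Proof.
set X := simple S j; set Y := simple S i.
have Xm : is_mod X := modP _; have Ym : is_mod Y := modP _.
pose ext (w : {ffun finvect_type (sM S i j) -> 'M[F]_(sdim S i, sdim S j)}) : coc X Y :=
  [ffun g : gens S => match g return 'M[F]_(rdim Y, rdim X) with
    | inl _ => 0
    | inr u => untag (i := (i, j)) 0 (fun m : finvect_type (sM S i j) => w m) u
   end].
have extE w (m : sM S i j) : ext w (gM m) = w m by rewrite ffunE /= untagE.
have ext0 w k l (m : sM S k l) : (k, l) != (i, j) -> ext w (gM m) = 0.
  by move=> kl; rewrite ffunE /= untag_dflt.
have exti : injective ext.
  by move=> w w' /ffunP e; apply/ffunP=> m; have := e (gM (m : sM S i j)); rewrite !extE.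
rewrite -(card_imset _ exti); apply: eq_card => z; apply/Z10P/imsetP => //.
  case=> zc z0; have [_ _ _ _ C5 C6 C7] := zc.
  have zl k l (a : sD S k) (m : sM S k l) : z (gM (sl a m)) = act Y (gD a) *m z (gM m).
    by rewrite C6 [z (gD _)]z0 mul0mx addr0.
  have zr k l (b : sD S l) (m : sM S k l) : z (gM (sr m b)) = z (gM m) *m act X (gD b).
    by rewrite C7 [z (gD _)]z0 mulmx0 add0r.
  exists [ffun m : finvect_type (sM S i j) => z (gM (m : sM S i j))].
    rewrite inE; apply/asboolP; split=> *; rewrite !ffunE.
    - exact: C5.
    - by rewrite zl raw_simple_gD.
    - by rewrite zr raw_simple_gD.
  apply/ffunP=> -[u|[[k l] m]]; first by rewrite z0 ffunE.
  rewrite -[inr _]/(gM (m : sM S k l)).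
  have [[ki lj]|kl] := eqVneq (k, l) (i, j).
    by subst k l; rewrite extE ffunE.
  rewrite ext0 //; move: kl; rewrite xpair_eqE negb_and => /orP[ki|lj].
    by rewrite -[m]sl1 zl raw_simple_gD0 // mul0mx.
  by rewrite -[m]sr1 zr raw_simple_gD0 // mulmx0.
case=> w; rewrite inE => /asboolP[w1 w2 w3] ->; split; last by move=> u; rewrite ffunE.
have e0 u : ext w (inl u) = 0 by rewrite ffunE.
split.
- by move=> *; rewrite !e0 scaler0 addr0.
- by move=> *; rewrite !e0 mulmx0 mul0mx addr0.
- by move=> *; rewrite !e0 mulmx0 mul0mx addr0.
- by rewrite big1 // => k _; exact: e0.
- move=> k l c m m'; have [[ki lj]|kl] := eqVneq (k, l) (i, j).
    by subst k l; rewrite !extE w1.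
  by rewrite !ext0 // scaler0 addr0.
- move=> k l a m; rewrite [ext w (gD _)]e0 mul0mx addr0.
  have [[ki lj]|kl] := eqVneq (k, l) (i, j).
    by subst k l; rewrite !extE w2 raw_simple_gD.
  by rewrite !ext0 // mulmx0.
- move=> k l m b; rewrite [ext w (gD _)]e0 mulmx0 add0r.
  have [[ki lj]|kl] := eqVneq (k, l) (i, j).
    by subst k l; rewrite !extE w3 raw_simple_gD.
  by rewrite !ext0 // mul0mx.
Qed.

Lemma dimHom_Dsimple i j :
  dimHom (Dres (simple S i)) (Dres (simple S j)) = (if i == j then sdim S i else 0)%N.
Proof.
rewrite -dimHom_simple; apply: (@expq_inj F); rewrite -!card_Hom.
apply: eq_card => f; rewrite !inE; apply/homP/homP=> fh g; last first.
  by case: g => u /=; [exact: (fh (inl u)) | rewrite mulmx0 mul0mx].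
by case: g => u; [exact: (fh (inl u)) | rewrite /= mulmx0 mul0mx].
Qed.

Lemma sdim_delta_sub i j r (X := simple S i) (Y := simple S j) k :
  sdim S k = (if i == j then sdim S i else sdim S k) ->
  (sdim S k * r)%N = dimExt X Y ->
  (sdim S k)%:Z * ((i == j)%:Z - r%:Z) = euler_mod X Y.
Proof.
move=> dk e; rewrite /euler_mod -e dimHom_simple mulrBr -PoszM; congr (_ - _).
by move: dk; case: (i == j) => [->|_] /=; rewrite ?muln1 ?muln0.
Qed.

End RMatrices.

Section SubSpecies.
Variables (F : finFieldType) (n : nat) (S : species F (n + n)).
Local Notation Q := (sub_species S).

(** Q being a full subquiver, the bimodules between two of its vertices are
    the same. *)
Lemma euler_simple_sub (i j : 'I_n) :
  euler_mod (simple S (lshift n j)) (simple S (lshift n i)) =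
  euler_mod (simple Q j) (simple Q i).
Proof.
rewrite !euler_modE; try exact: modP.
rewrite !dimHom_Dsimple (inj_eq (@lshift_inj _ _)); congr (_%:Z - _%:Z).
apply: (@expq_inj F); rewrite -!card_Z10; try exact: modP.
by rewrite !card_Z10_simple.
Qed.

Lemma Rt_euler (i j : 'I_n) : (sdim S (lshift n i))%:Z * (It n (lshift n i) j - Rt S (lshift n i) j) =
  euler_mod (simple Q j) (simple Q i).
Proof.
rewrite -euler_simple_sub !mxE -(sdim_delta_sub _ (ext_ldimE S (lshift n i) (lshift n j))).
  by rewrite natz eq_sym.
by case: eqP => // ->.
Qed.

Lemma Rt'_euler (i j : 'I_n) : (sdim S (lshift n i))%:Z * (It n (lshift n i) j - Rt' S (lshift n i) j) =
  euler_mod (simple Q i) (simple Q j).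
Proof.
rewrite -euler_simple_sub !mxE -(sdim_delta_sub _ (ext_rdimE S (lshift n i) (lshift n j))) //.
  by rewrite natz.
by case: eqP.
Qed.

End SubSpecies.

(** * Counting submodules *)

Section Submodules.
Variables (F : finFieldType) (n : nat) (S : species F n).
Implicit Types X Y L Z : rawmod S.

Local Notation hom X Y f := (@is_hom F n S X Y f).

Definition subs X : {set {set 'cV[F]_(rdim X)}} := [set U | submod U]%SET.

Lemma dimvec_sub_image Y L f g : is_mod Y -> hom Y L f -> g *m f = 1%:M ->
  dimvec_sub [set f *m w | w : 'cV[F]_(rdim Y)]%SET = dimvec Y.
Proof.
move=> Ym fh gf; apply/matrixP=> i j; rewrite ord1 dimvecE mxE; congr (Posz (_ %/ _)).
apply: (@expq_inj F); rewrite card_image_span.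
  by rewrite (card_Eimage i Ym fh gf) card_Epart.
exact: submod_subspace (submod_image fh).
Qed.

Lemma dimvec_sub_ker L Z p s : is_mod L -> hom L Z p -> p *m s = 1%:M ->
  dimvec_sub [set u : 'cV[F]_(rdim L) | p *m u == 0]%SET = dimvec L - dimvec Z.
Proof.
move=> Lm ph ps; have [Y [f [g YLZ]]] := surj_ses ph ps.
have [fh _ spl] := YLZ.
rewrite (ses_image YLZ) (dimvec_sub_image (ses_modl YLZ Lm) fh (split_gf spl)).
by rewrite (dimvecD Lm YLZ) addrK.
Qed.

Lemma submod_ker L Z p : hom L Z p -> submod [set u : 'cV[F]_(rdim L) | p *m u == 0]%SET.
Proof.
move=> ph; apply/submodP; split; first split.
- by rewrite inE mulmx0.
- move=> c u w; rewrite !inE => /eqP du /eqP dw.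
  by rewrite mulmxDr -scalemxAr du dw scaler0 addr0.
by move=> g u; rewrite !inE mulmxA (homP ph) -mulmxA => /eqP->; rewrite mulmx0.
Qed.

(** Submodules of the target of p correspond to those of L containing the
    kernel of p. *)
Definition presub L Z (p : 'M[F]_(rdim Z, rdim L)) (V : {set 'cV[F]_(rdim Z)}) :
  {set 'cV[F]_(rdim L)} := [set u | p *m u \in V]%SET.

Lemma presub_ker L Z p Z' r :
  @presub L Z p [set u | r *m u == 0]%SET = [set u | (r *m p : 'M[F]_(rdim Z', rdim L)) *m u == 0]%SET.
Proof. by apply/setP=> u; rewrite !inE mulmxA. Qed.

Lemma presub_submod L Z p V : hom L Z p -> submod V -> submod (@presub L Z p V).
Proof.
move=> ph /submod_ses[Y [Z' [f [g [r [s [YZZ ->]]]]]]]; have [_ rh _] := YZZ.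
by rewrite presub_ker; apply: submod_ker; apply: is_hom_comp ph rh.
Qed.

Lemma presub_dimvec L Z p s V : is_mod L -> hom L Z p -> p *m s = 1%:M -> submod V ->
  dimvec_sub (@presub L Z p V) = dimvec_sub V + (dimvec L - dimvec Z).
Proof.
move=> Lm ph ps Vs; have [Y [Z' [f [g [r [t [YZZ VE]]]]]]] := submod_ses Vs.
have [_ rh spl] := YZZ; have Zm : is_mod Z := is_mod_surj ph ps Lm.
rewrite VE presub_ker (dimvec_sub_ker Zm rh (split_ps spl)).
rewrite (dimvec_sub_ker (s := s *m t) Lm (is_hom_comp ph rh)); last first.
  by rewrite mulmxA -(mulmxA r) ps mulmx1 (split_ps spl).
by rewrite [RHS]addrC addrA subrK.
Qed.

Lemma subs_presub L Z p s : is_mod L -> hom L Z p -> p *m s = 1%:M ->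
  [set presub p V | V in subs Z]%SET =
  [set U in subs L | [set u : 'cV[F]_(rdim L) | p *m u == 0]%SET \subset U]%SET.
Proof.
move=> Lm ph ps; apply/setP=> U; rewrite [RHS]finset.in_set; apply/imsetP/andP.
  case=> V; rewrite inE => Vs ->; split; first by rewrite inE presub_submod.
  apply/fintype.subsetP=> u; rewrite !inE => /eqP ->.
  by have /submodP[[]] := Vs.
case; rewrite inE => Us /fintype.subsetP kU.
have [[U0 Ucl] Uact] := submodP U Us.
pose V : {set 'cV[F]_(rdim Z)} := [set p *m u | u in U]%SET.
have VP u : (p *m u \in V) = (u \in U).
  apply/imsetP/idP=> [[w wU e]|uU]; last by exists u.
  rewrite -[u](subrK w) -[u - w]scale1r; apply: Ucl => //.
  by apply: kU; rewrite inE mulmxBr e subrr.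
exists V; last by apply/setP=> u; rewrite inE VP.
rewrite inE; apply/submodP; split; first split.
- by rewrite -(mulmx0 _ p) VP.
- move=> c _ _ /imsetP[u uU ->] /imsetP[w wU ->].
  by rewrite scalemxAr -mulmxDr VP Ucl.
by move=> g _ /imsetP[u uU ->]; rewrite mulmxA -(homP ph) -mulmxA VP Uact.
Qed.

Lemma presub_inj L Z p s : p *m s = 1%:M -> injective (@presub L Z p).
Proof.
move=> ps V V' /setP e; apply/setP=> u; have := e (s *m u).
by rewrite !inE mulmxA ps mul1mx.
Qed.

Lemma image_iso Y Y' L f f' : hom Y L f -> hom Y' L f' -> mx_inj f -> mx_inj f' ->
  [set f *m w | w : 'cV[F]_(rdim Y)]%SET = [set f' *m w | w : 'cV[F]_(rdim Y')]%SET ->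
  mod_iso Y Y'.
Proof.
move=> fh fh' /mx_inj_retract[g gf] /mx_inj_retract[g' gf'] e.
have fac Y1 Y2 (f1 : 'M_(rdim L, rdim Y1)) (f2 : 'M_(rdim L, rdim Y2)) g2 :
    hom Y1 L f1 -> hom Y2 L f2 -> g2 *m f2 = 1%:M ->
    (forall w, f1 *m w \in [set f2 *m w | w : 'cV[F]_(rdim Y2)]%SET) ->
    hom Y1 Y2 (g2 *m f1) /\ f2 *m (g2 *m f1) = f1.
  move=> h1 h2 gf2 im.
  have E : f2 *m (g2 *m f1) = f1.
    apply: mx_ext => w; have /imsetP[v _ fv] := im w.
    by rewrite -!mulmxA fv (mulmxA g2) gf2 mul1mx.
  split=> //; apply/homP=> x.
  rewrite -[RHS]mul1mx -gf2 -!mulmxA (mulmxA f2) (homP h2) -(mulmxA (act L x)) E.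
  by rewrite (homP h1).
have [|h1 E1] := fac Y Y' f f' g' fh fh' gf'.
  by move=> w; rewrite -e; apply/imsetP; exists w.
have [|h2 E2] := fac Y' Y f' f g fh' fh gf.
  by move=> w; rewrite e; apply/imsetP; exists w.
exists (g' *m f), (g *m f'); split=> //.
  by rewrite -mulmxA E1 gf.
by rewrite -mulmxA E2 gf'.
Qed.

Lemma kernel_iso L Z Z' p p' : hom L Z p -> hom L Z' p' -> mx_surj p -> mx_surj p' ->
  [set u | p *m u == 0]%SET = [set u | p' *m u == 0]%SET :> {set 'cV[F]_(rdim L)} ->
  mod_iso Z Z'.
Proof.
move=> ph ph' /mx_surj_section[s ps] /mx_surj_section[s' ps'] e.
have fac Z1 Z2 (p1 : 'M_(rdim Z1, rdim L)) s1 (p2 : 'M_(rdim Z2, rdim L)) :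
    hom L Z1 p1 -> hom L Z2 p2 -> p1 *m s1 = 1%:M ->
    (forall u : 'cV_(rdim L), p1 *m u == 0 -> p2 *m u == 0) ->
    hom Z1 Z2 (p2 *m s1) /\ p2 *m s1 *m p1 = p2.
  move=> h1 h2 ps1 im.
  have E : p2 *m s1 *m p1 = p2.
    apply: mx_ext => w; apply/eqP; rewrite -subr_eq0 -!mulmxA -mulmxBr.
    by apply: im; rewrite mulmxBr !mulmxA ps1 mul1mx subrr.
  split=> //; apply/homP=> x.
  rewrite -[LHS]mulmx1 -ps1 !mulmxA -(mulmxA _ (act Z1 x)) -(homP h1) mulmxA E.
  by rewrite (homP h2).
have [|h1 E1] := fac Z Z' p s p' ph ph' ps.
  by move=> u; move/setP/(_ u): e; rewrite !inE => ->.
have [|h2 E2] := fac Z' Z p' s' p ph' ph ps'.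
  by move=> u; move/setP/(_ u): e; rewrite !inE => ->.
exists (p' *m s), (p *m s'); split=> //.
  by rewrite mulmxA E2 ps.
by rewrite mulmxA E1 ps'.
Qed.

Definition icls (M : mod S) : isomod S := (\pi_({eq_quot mod_iso_rel S}) M)%qT.

Lemma rep_icls (M : mod S) : mod_iso (rep_mod (icls M)) M.
Proof.
have /eqmodP/asboolP : icls (rep_mod (icls M)) = icls M by rewrite /icls /rep_mod reprK.
by [].
Qed.

Lemma icls_eq (M N : mod S) : mod_iso M N -> icls M = icls N.
Proof. by move=> MN; apply/eqmodP/asboolP. Qed.

Lemma icls_rep (a : isomod S) : icls (rep_mod a) = a.
Proof. by rewrite /icls /rep_mod reprK. Qed.

(** The condition that defines the Hall number, at a fixed submodule. *)
Definition hall_at L (U : {set 'cV[F]_(rdim L)}) (M N : rawmod S) : Prop :=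
  (exists f : 'M[F]_(rdim L, rdim N), [/\ hom N L f, mx_inj f &
            U = [set f *m u | u : 'cV[F]_(rdim N)]%SET]) /\
  (exists p : 'M[F]_(rdim M, rdim L), [/\ hom L M p, mx_surj p &
            U = [set u | p *m u == 0]%SET]).

(** The classes of the quotient by U and of U. Submodules of L are counted by
    Hall numbers according to this pair. *)
Definition subquo_type L (U : {set 'cV[F]_(rdim L)}) : isomod S * isomod S :=
  xget (icls (mod0 S), icls (mod0 S))
    [set MN | hall_at U (rep_mod MN.1) (rep_mod MN.2)]%classic.

Lemma subquo_typeP L U : is_mod L -> submod U ->
  hall_at (L := L) U (rep_mod (subquo_type U).1) (rep_mod (subquo_type U).2).
Proof.
move=> Lm Us; have [Y [Z [f [g [p [s [YLZ UE]]]]]]] := submod_ses Us.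
have Ym := ses_modl YLZ Lm; have Zm := ses_modr YLZ Lm.
apply: (@xgetPex _ _ [set MN | hall_at U (rep_mod MN.1) (rep_mod MN.2)]%classic).
exists (icls (Mod Zm), icls (Mod Ym)); rewrite /=; have [fh ph spl] := YLZ.
have [a [b [ah bh ba ab]]] := rep_icls (Mod Ym).
have [c [d [ch dh dc cd]]] := rep_icls (Mod Zm).
split.
  exists (f *m a); split; first exact: is_hom_comp ah fh.
    apply: (retract_inj (g := b *m g)).
    by rewrite mulmxA -(mulmxA b) (split_gf spl) mulmx1.
  rewrite UE (ses_image YLZ); apply/setP=> u; apply/imsetP/imsetP=> -[w _ ->].
    by exists (b *m w); rewrite ?inE // mulmxA -(mulmxA f) ab mulmx1.
  by exists (a *m w); rewrite ?inE // mulmxA.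
exists (d *m p); split; first exact: is_hom_comp ph dh.
  apply: (section_surj (s := s *m c)).
  by rewrite mulmxA -(mulmxA d) (split_ps spl) mulmx1.
rewrite UE; apply/setP=> u; rewrite !inE -mulmxA.
apply/eqP/eqP=> [->|]; first by rewrite mulmx0.
by move/(congr1 (mulmx c)); rewrite mulmxA cd mul1mx mulmx0.
Qed.

Lemma hall_at_iso L U (M N M' N' : rawmod S) : hall_at (L := L) U M N -> hall_at U M' N' ->
  mod_iso M M' /\ mod_iso N N'.
Proof.
case=> [[f [fh fi ->]] [p [ph ps pU]]] [[f' [fh' fi' e]] [p' [ph' ps' pU']]]; split.
  by apply: (kernel_iso ph ph' ps ps'); rewrite -pU -pU'.
exact: image_iso fh fh' fi fi' e.
Qed.

Lemma hallF_subquo_type L (MN : isomod S * isomod S) : is_mod L ->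
  hallF (rep_mod MN.1) (rep_mod MN.2) L = #|[set U in subs L | subquo_type U == MN]%SET|.
Proof.
move=> Lm; apply: eq_card => U; rewrite [RHS]finset.in_set [LHS]finset.in_set.
rewrite [U \in subs L]finset.in_set.
have [Us|] := boolP (submod U); rewrite /= ?andbF //.
have UT := subquo_typeP Lm Us.
apply/andP/eqP=> [[/asboolP uf /asboolP up]|<-]; last first.
  by case: UT => uf up; split; apply/asboolP.
have [i1 i2] := hall_at_iso UT (conj uf up).
by rewrite [LHS]surjective_pairing [RHS]surjective_pairing -[(subquo_type U).1]icls_rep
  -[(subquo_type U).2]icls_rep (icls_eq i1) (icls_eq i2) !icls_rep.
Qed.

Lemma subquo_type_dimvec L U : is_mod L -> submod U ->
  dimvec (rep_mod (subquo_type (L := L) U).2) = dimvec_sub U /\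
  dimvec (rep_mod (subquo_type U).1) = dimvec L - dimvec_sub U.
Proof.
move=> Lm Us; have [[f [fh fi fU]] [p [ph psurj pU]]] := subquo_typeP Lm Us.
have [g gf] := mx_inj_retract fi; have [s ps] := mx_surj_section psurj.
split; first by rewrite {2}fU (dimvec_sub_image (modP _) fh gf).
by rewrite {2}pU (dimvec_sub_ker Lm ph ps) opprB addrCA subrr addr0.
Qed.

End Submodules.

(** * Submodules of the cokernels of cones *)

Section ConeCount.
Variables (F : finFieldType) (n : nat) (S : species F n).

Local Notation hom X Y f := (@is_hom F n S X Y f).
Local Notation Homs X Y := (@Defs.Hom F n S X Y).
Local Notation dsm X Y := (@ext_mid F n S X Y 0).
Local Notation cone X Y w := (@cone F n S X Y w).

(** Submodules of the cokernel, by their preimages in the target. *)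
Definition subsD (X : rawmor S) : {set {set 'cV[F]_(rdim (tgt X))}} :=
  [set U in subs (tgt X) | [forall w, dif X *m w \in U]]%SET.

Lemma subsDE X U : (U \in subsD X) = submod U && [forall w, dif X *m w \in U].
Proof. by rewrite finset.in_set [_ \in subs _]finset.in_set. Qed.

Section Direct.
Variables (X0 Y0 : rawmod S).
Hypotheses (X0m : is_mod X0) (Y0m : is_mod Y0).
Implicit Types (U : {set 'cV[F]_(rdim Y0 + rdim X0)}).

Definition lowpart U : {set 'cV[F]_(rdim Y0)} := [set y | col_mx y 0 \in U]%SET.
Definition highpart U : {set 'cV[F]_(rdim X0)} := [set dsubmx u | u in U]%SET.

Lemma act_dsm g y x : act (dsm X0 Y0) g *m col_mx y x = col_mx (act Y0 g *m y) (act X0 g *m x) :> 'cV[F]_(rdim Y0 + rdim X0).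
Proof. by rewrite /= mul_block_col ffunE !mul0mx addr0 add0r. Qed.

Lemma dsm_mod : is_mod (dsm X0 Y0).
Proof. by apply/ext_mod => //; exact: cocycle0. Qed.

(** The dimension formula is exactness of the sequence formed by the part of U
    in Y_0, U, and the projection of U to X_0. *)
Lemma sub_dsum (U : {set 'cV[F]_(rdim Y0 + rdim X0)}) : submod (X := dsm X0 Y0) U ->
  [/\ submod (lowpart U), submod (highpart U) &
   dimvec_sub (S := S) (X := dsm X0 Y0) U = dimvec_sub (lowpart U) + dimvec_sub (highpart U)].
Proof.
move=> Us; have Lm := dsm_mod.
have [N [Z [f [g [p [s [NLZ UE0]]]]]]] := submod_ses Us.
have UE : U = [set f *m w | w : 'cV[F]_(rdim N)]%SET by rewrite UE0 (ses_image NLZ).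
have Nm := ses_modl NLZ Lm; have [fh _ spl] := NLZ.
pose pr : 'M[F]_(rdim X0, rdim Y0 + rdim X0) := row_mx 0 1%:M.
have prE u : pr *m u = dsubmx u.
  by rewrite -{1}[u]vsubmxK mul_row_col mul0mx add0r mul1mx.
have prh : hom (dsm X0 Y0) X0 pr by apply: hom_row; rewrite ?hom0 ?is_hom1.
have kh : hom N X0 (pr *m f) := is_hom_comp fh prh.
have hiE : highpart U = [set (pr *m f) *m w | w : 'cV[F]_(rdim N)]%SET.
  rewrite /highpart UE; apply/setP=> x; apply/imsetP/imsetP.
    case=> _ /imsetP[w _ ->] ->; by exists w; rewrite // -mulmxA prE.
  by case=> w _ ->; exists (f *m w); [apply/imsetP; exists w | rewrite -mulmxA prE].
have his : submod (highpart U) by rewrite hiE; apply: submod_image.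
(* the kernel of N -> X_0 is the part of U in Y_0 *)
have [K [I [k [k' [r [r' [i [i' [KNI ih ii' dE]]]]]]]]] := hom_factor Nm X0m kh.
have [kkh rh splk] := KNI; have Km := ses_modl KNI Nm; have Im := ses_modr KNI Nm.
pose up : 'M[F]_(rdim Y0, rdim Y0 + rdim X0) := row_mx 1%:M 0.
have upE u : up *m u = usubmx u.
  by rewrite -{1}[u]vsubmxK mul_row_col mul0mx addr0 mul1mx.
have uph : hom (dsm X0 Y0) Y0 up by apply: hom_row; rewrite ?hom0 ?is_hom1.
have fk : pr *m (f *m k) = 0.
  by rewrite mulmxA dE -mulmxA (split_pf splk) mulmx0.
have fkE : f *m k = col_mx (up *m f *m k) 0.
  rewrite -[LHS]vsubmxK -mulmxA; congr col_mx.
    by rewrite -[f *m k in RHS]vsubmxK mul_row_col mul0mx addr0 mul1mx.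
  by move: fk; rewrite -{1}[f *m k]vsubmxK mul_row_col mul0mx add0r mul1mx.
have lowE : lowpart U = [set (up *m f *m k) *m w | w : 'cV[F]_(rdim K)]%SET.
  apply/setP=> y; rewrite inE UE; apply/imsetP/imsetP=> [[w _ e]|[w _ ->]].
    have rw : r *m w = 0.
      apply: (retract_inj ii'); rewrite mulmxA -dE -mulmxA -e prE col_mxKd.
      by rewrite mulmx0.
    exists (k' *m w); rewrite ?inE //.
    by rewrite -mulmxA -(split_ker splk rw) -mulmxA -e upE col_mxKu.
  exists (k *m w); rewrite ?inE //.
  by rewrite mulmxA fkE mul_col_mx mul0mx.
have lowh : hom K Y0 (up *m f *m k).
  by rewrite -mulmxA; apply: is_hom_comp uph; apply: is_hom_comp kkh fh.
have fki : mx_inj (up *m f *m k).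
  move=> u w e; apply: (retract_inj (split_gf splk)).
  apply: (retract_inj (split_gf spl)); rewrite !mulmxA fkE !mul_col_mx.
  by rewrite e !mul0mx.
split=> //; first by rewrite lowE; apply: submod_image.
have [h hk] := mx_inj_retract fki.
rewrite UE (dimvec_sub_image Nm fh (split_gf spl)) -UE lowE (dimvec_sub_image Km lowh hk).
have -> : highpart U = [set i *m w | w : 'cV[F]_(rdim I)]%SET.
  rewrite hiE dE; apply/setP=> x; apply/imsetP/imsetP=> -[w _ ->].
    by exists (r *m w); rewrite ?inE // mulmxA.
  by exists (r' *m w); rewrite ?inE // -(mulmxA i) (mulmxA r) (split_ps splk) mul1mx.
by rewrite (dimvec_sub_image Im ih ii') (dimvecD Nm KNI).
Qed.

(** Submodules of Y_0 + X_0 with given parts V in Y_0 and W in X_0 are the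
    graphs of the homs from W to Y_0 / V. *)
Lemma card_graphs (A B C D : rawmod S) fA gA pA sA fB gB pB sB :
  @ses F n S A Y0 C fA gA pA sA -> @ses F n S B X0 D fB gB pB sB ->
  #|[set U in subs (dsm X0 Y0) | (lowpart U == [set y | pA *m y == 0]%SET) &&
       (highpart U == [set x | pB *m x == 0]%SET)]%SET| = #|Homs B C|.
Proof.
move=> AY BX; have [fAh pAh splA] := AY; have [fBh pBh splB] := BX.
pose G (phi : 'M[F]_(rdim C, rdim B)) : {set 'cV[F]_(rdim Y0 + rdim X0)} :=
  [set u | (pB *m dsubmx u == 0) && (pA *m usubmx u == phi *m (gB *m dsubmx u))]%SET.
have GE phi y x : (col_mx y x \in G phi) =
    (pB *m x == 0) && (pA *m y == phi *m (gB *m x)).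
  by rewrite inE col_mxKd col_mxKu.
have Gb phi b : col_mx (sA *m (phi *m b)) (fB *m b) \in G phi.
  rewrite GE !mulmxA (split_pf splB) mul0mx eqxx (split_ps splA) mul1mx /=.
  by rewrite -(mulmxA phi) (split_gf splB) mulmx1.
have Ginj : injective G.
  move=> phi phi' e; apply: mx_ext => b; have := Gb phi b; rewrite e GE.
  case/andP=> _ /eqP; rewrite !mulmxA (split_ps splA) mul1mx.
  by rewrite -(mulmxA phi') (split_gf splB) mulmx1.
rewrite -(card_imset (Homs B C) Ginj); apply: eq_card => U.
rewrite finset.in_set [U \in subs _]finset.in_set; apply/idP/imsetP; last first.
  case=> phi; rewrite inE => phih ->; apply/and3P; split.
  - apply/submodP; split; first split.
    + by rewrite inE !linear0 !eqxx.
    + move=> c u w; rewrite !inE => /andP[/eqP u1 /eqP u2] /andP[/eqP w1 /eqP w2].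
      rewrite !linearP /= u1 w1 u2 w2 scaler0 addr0 eqxx /=.
      by apply/eqP.
    move=> g u; rewrite -[u]vsubmxK act_dsm !GE => /andP[/eqP u1 /eqP u2].
    rewrite !mulmxA (homP pBh) -mulmxA u1 mulmx0 eqxx (homP pAh) -mulmxA u2 /=.
    have e := split_ker splB u1; rewrite {2}e !mulmxA -(mulmxA _ (act X0 g)) -(homP fBh).
    rewrite !mulmxA -(mulmxA phi) (split_gf splB) mulmx1 -(homP phih) //.
  - apply/eqP/setP=> y; rewrite inE GE mulmx0 eqxx /= mulmx0 mulmx0.
    by rewrite inE.
  apply/eqP/setP=> x; rewrite [RHS]inE; apply/imsetP/eqP=> [[u uG ->]|px].
    by move: uG; rewrite inE => /andP[/eqP].
  exists (col_mx (sA *m (phi *m (gB *m x))) x); last by rewrite col_mxKd.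
  by rewrite {2}(split_ker splB px) Gb.
case/and3P=> Us /eqP lowE /eqP hiE.
have [[U0 Ucl] Uact] := submodP (X := dsm X0 Y0) U Us.
have Usub u w : u \in U -> w \in U -> w - u \in U.
  by move=> uU wU; rewrite addrC -scaleN1r Ucl.
have low y : (col_mx y 0 \in U) = (pA *m y == 0).
  by move/setP/(_ y): lowE; rewrite !inE.
have ex b : exists y, col_mx y (fB *m b) \in U.
  have : fB *m b \in highpart U by rewrite hiE inE mulmxA (split_pf splB) mul0mx.
  case/imsetP=> u uU ->; exists (usubmx u); by rewrite vsubmxK.
(* a linear choice of preimages *)
have exk k : exists y, col_mx y (fB *m delta_mx k 0) \in U := ex _.
pose sg : 'M[F]_(rdim Y0, rdim B) := \matrix_(i, k) xchoose (exk k) i 0.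
have sgU b : col_mx (sg *m b) (fB *m b) \in U.
  rewrite -mul_col_mx; apply: subspace_mul; first by [].
  move=> k; rewrite colE mul_col_mx -[sg *m _]colE.
  have -> : col k sg = xchoose (exk k).
    by apply/matrixP=> i c; rewrite ord1 !mxE.
  exact: xchooseP (exk k).
pose phi := pA *m sg.
have Uphi y x : (col_mx y x \in U) = (pB *m x == 0) && (pA *m y == phi *m (gB *m x)).
  apply/idP/andP=> [uU|[/eqP px /eqP py]].
    have xh : x \in highpart U by apply/imsetP; exists (col_mx y x); rewrite ?col_mxKd.
    have px : pB *m x == 0 by move: xh; rewrite hiE inE.
    split=> //; have := Usub _ _ (sgU (gB *m x)) uU.
    rewrite -(split_ker splB (eqP px)) opp_col_mx add_col_mx subrr low.
    by rewrite mulmxBr subr_eq0 /phi !mulmxA.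
  have : col_mx (y - sg *m (gB *m x)) 0 \in U.
    by rewrite low mulmxBr py /phi !mulmxA subrr.
  move=> /(Ucl 1 _ _)/(_ (sgU (gB *m x))); rewrite scale1r add_col_mx subrK add0r.
  by rewrite -(split_ker splB px).
exists phi; last by apply/setP=> u; rewrite -[u]vsubmxK Uphi GE.
rewrite inE; apply/homP=> g; apply: mx_ext => b.
have /(Uact g) := sgU b; rewrite act_dsm Uphi => /andP[_ /eqP].
rewrite !mulmxA (homP pAh) -!mulmxA (mulmxA (act X0 g)) -(homP fBh) => e.
move: e; rewrite -(mulmxA fB) (mulmxA gB) (split_gf splB) mul1mx => e.
by rewrite e.
Qed.

End Direct.

Lemma subsD_cone (X Y : c2p S) w (U : {set 'cV[F]_(rdim (tgt Y) + rdim (tgt X))}) :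
  (U \in subsD (cone X Y w)) = (submod (X := dsm (tgt X) (tgt Y)) U) &&
    [forall y, dif Y *m y \in lowpart U] &&
    [forall x, col_mx (w *m x) (dif X *m x) \in U].
Proof.
have -> : (U \in subsD (cone X Y w)) = (submod (X := dsm (tgt X) (tgt Y)) U) &&
    [forall v, dif (cone X Y w) *m v \in U].
  exact: subsDE.
have [Us|//] := boolP (submod (X := dsm (tgt X) (tgt Y)) U).
rewrite [LHS]andTb andTb; have [[U0 Ucl] _] := submodP (X := dsm (tgt X) (tgt Y)) U Us.
have dE y x : dif (cone X Y w) *m col_mx y x = col_mx (dif Y *m y) 0 + col_mx (w *m x) (dif X *m x) :> 'cV_(rdim (tgt Y) + rdim (tgt X)).
  by rewrite /= mul_block_col mul0mx add0r add_col_mx add0r.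
apply/forallP/andP=> [h|[/forallP hy /forallP hx] v].
  split; apply/forallP=> x; last first.
    have := h (col_mx 0 x); rewrite dE mulmx0 col_mx0 add0r; exact.
  by rewrite inE; have := h (col_mx x 0); rewrite dE !mulmx0 col_mx0 addr0; exact.
rewrite -[v]vsubmxK dE -[X in X + _]scale1r Ucl //.
by have := hy (usubmx v); rewrite inE.
Qed.

(** The cone of w admits U when w lifts the differential, as a map to the
    projection W of U, to a map into U. As X_(-1) is projective such lifts
    exist, and they form a torsor under the homs to the part V of U in Y_0. *)
Lemma card_lifts (X Y : c2p S) (U : {set 'cV[F]_(rdim (tgt Y) + rdim (tgt X))}) :
  submod (X := dsm (tgt X) (tgt Y)) U -> lowpart U \in subsD Y -> highpart U \in subsD X ->
  (#|[set w in Homs (src X) (tgt Y) | U \in subsD (cone X Y w)]%SET|%:R : Zv F) =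
    qq F ^ euler S (dimvec (src X)) (dimvec_sub (lowpart U)).
Proof.
have [sX tX sXp tXp dX] := c2pP X; have [_ tY _ _ _] := c2pP Y.
move=> Us; rewrite !subsDE => /andP[ls ld] /andP[hs /forallP hd].
have [[U0 Ucl] _] := submodP (X := dsm (tgt X) (tgt Y)) U Us.
have [A [C [fA [gA [pA [sA [AY lowE]]]]]]] := submod_ses ls.
have [fAh pAh splA] := AY; have Am := ses_modl AY tY.
have low y : (col_mx y 0 \in U) = (pA *m y == 0) by move/setP/(_ y): lowE; rewrite !inE.
have [N [Z [f [g [p [s [NLZ UE0]]]]]]] := submod_ses Us.
have UE : U = [set f *m w | w : 'cV[F]_(rdim N)]%SET by rewrite UE0 (ses_image NLZ).
have Lm := dsm_mod tX tY; have Nm := ses_modl NLZ Lm; have [fh _ spl] := NLZ.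
pose pr : 'M[F]_(rdim (tgt X), rdim (tgt Y) + rdim (tgt X)) := row_mx 0 1%:M.
pose up : 'M[F]_(rdim (tgt Y), rdim (tgt Y) + rdim (tgt X)) := row_mx 1%:M 0.
have prE m (u : 'M_(_, m)) : pr *m u = dsubmx u.
  by rewrite -{1}[u]vsubmxK mul_row_col mul0mx add0r mul1mx.
have upE m (u : 'M_(_, m)) : up *m u = usubmx u.
  by rewrite -{1}[u]vsubmxK mul_row_col mul0mx addr0 mul1mx.
have prh : hom (dsm (tgt X) (tgt Y)) (tgt X) pr by apply: hom_row; rewrite ?hom0 ?is_hom1.
have uph : hom (dsm (tgt X) (tgt Y)) (tgt Y) up by apply: hom_row; rewrite ?hom0 ?is_hom1.
(* dX lifts through U -> W as its source is projective *)
have [B [D [fB [gB [pB [sB [BX hiE]]]]]]] := submod_ses hs.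
have [fBh pBh splB] := BX; have Bm := ses_modl BX tX.
have pdX : pB *m dif X = 0.
  apply: mx_ext => v; rewrite mul0mx -mulmxA; apply/eqP.
  by have := hd v; rewrite hiE inE.
have [bh bE] := ses_liftl BX dX pdX.
have pprf : pB *m (pr *m f) = 0.
  apply: mx_ext => v; rewrite mul0mx -!mulmxA prE; apply/eqP.
  have : dsubmx (f *m v) \in highpart U.
    by apply/imsetP; exists (f *m v); rewrite // UE; apply/imsetP; exists v.
  by rewrite hiE inE.
have [hh hE] := ses_liftl BX (is_hom_comp fh prh) pprf.
set h := gB *m (pr *m f) in hh hE; set b := gB *m dif X in bh bE.
have hsurj : mx_surj h.
  move=> v; have : fB *m v \in highpart U by rewrite hiE inE mulmxA (split_pf splB) mul0mx.
  case/imsetP=> u; rewrite UE => /imsetP[w _ ->] e; exists w.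
  by apply: (retract_inj (split_gf splB)); rewrite mulmxA hE -mulmxA prE.
have [c ch hc] := sXp (Mod Nm) (Mod Bm) h b hh hsurj bh.
pose w0 := up *m (f *m c).
have w0h : hom (src X) (tgt Y) w0 := is_hom_comp (is_hom_comp ch fh) uph.
have w0U x : col_mx (w0 *m x) (dif X *m x) \in U.
  rewrite UE; apply/imsetP; exists (c *m x); rewrite ?inE // -[RHS]vsubmxK; congr col_mx.
    by rewrite -upE /w0 !mulmxA.
  by rewrite -prE !mulmxA -hE -(mulmxA fB) hc bE.
(* the lifts form a torsor under Hom(X_(-1), V) *)
pose t k := w0 + fA *m k.
have ti : injective t.
  by move=> k k' /addrI e; apply: mx_ext => v; apply: (retract_inj (split_gf splA));
    rewrite !mulmxA e.
rewrite (_ : [set w in _ | _]%SET = [set t k | k in Homs (src X) A]%SET); last first.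
  apply/setP=> w; rewrite finset.in_set subsD_cone Us ld /= inE.
  apply/andP/imsetP=> [[wh /forallP wU]|[k + ->]]; last first.
    rewrite inE => kh; split; first by rewrite homD //; exact: is_hom_comp kh fAh.
    apply/forallP=> x; rewrite mulmxDl addrC -[dif X *m x]add0r -add_col_mx.
    rewrite -[X in X + _]scale1r Ucl // low !mulmxA (split_pf splA).
    by rewrite !mul0mx.
  have pw : pA *m (w - w0) = 0.
    apply: mx_ext => x; rewrite mul0mx -mulmxA; apply/eqP; rewrite -low.
    have := Ucl (-1) _ _ (w0U x) (wU x).
    by rewrite scaleN1r opp_col_mx add_col_mx addNr mulmxBl addrC.
  have [kh kE] := ses_liftl AY (homB wh w0h) pw.
  exists (gA *m (w - w0)); first by rewrite inE.
  by rewrite /t kE addrC subrK.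
rewrite card_imset // card_Hom natq_exp dimHom_proj //.
rewrite lowE (ses_image AY) (dimvec_sub_image Am fAh (split_gf splA)).
by [].
Qed.

(** Exchange the sums: each submodule U of Y_0 + X_0 is counted once for each
    w whose cone admits it (card_lifts), and the U with given parts are
    counted by graphs (card_graphs); since W is projective as a submodule of
    X_0, both counts are powers of q given by the Euler form. *)
Lemma cone_count (V : lmodType (Zv F)) (g : 'cV[int]_n -> V) (X Y : c2p S) :
  \sum_(w in Homs (src X) (tgt Y)) \sum_(U in subsD (cone X Y w)) g (dimvec_sub U) =
  \sum_(W in subsD X) \sum_(U in subsD Y)
    qq F ^ (euler S (dimvec (src X)) (dimvec_sub U) +
            euler S (dimvec_sub W) (dimvec (tgt Y) - dimvec_sub U)) *:
      g (dimvec_sub U + dimvec_sub W).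
Proof.
have [sX tX sXp tXp dX] := c2pP X; have [_ tY _ _ _] := c2pP Y.
pose L0 := dsm (tgt X) (tgt Y).
pose H := Homs (src X) (tgt Y).
pose ok (U : {set 'cV[F]_(rdim (tgt Y) + rdim (tgt X))}) :=
  (highpart U \in subsD X) && (lowpart U \in subsD Y).
have ok_cone w U : U \in subsD (cone X Y w) -> (submod (X := L0) U) && ok U.
  rewrite subsD_cone => /andP[/andP[Us ly] /forallP hx]; rewrite Us /=.
  have [ls hs _] := sub_dsum tX tY Us.
  rewrite /ok !subsDE ls ly hs /= andbT; apply/forallP=> x.
  by apply/imsetP; exists (col_mx (w *m x) (dif X *m x)); rewrite ?col_mxKd.
transitivity (\sum_(U : {set 'cV[F]_(rdim (tgt Y) + rdim (tgt X))} | submod (X := L0) U && ok U)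
   (#|[set w in H | U \in subsD (cone X Y w)]%SET|%:R : Zv F) *: g (dimvec_sub (S := S) (X := L0) U)).
  under [RHS]eq_bigr => U _ do rewrite natr_card_sub scaler_suml.
  rewrite exchange_big /=; apply: eq_bigr => w wH.
  rewrite big_mkcond [RHS]big_mkcond /=; apply: eq_bigr => U _.
  case: ifP => [/ok_cone ->|]; first by rewrite scale1r.
  by rewrite scale0r if_same.
rewrite pair_big_dep /=.
rewrite (partition_big (fun U => (highpart U, lowpart U))
   (fun p => (p.1 \in subsD X) && (p.2 \in subsD Y))) /=; last first.
  by move=> U /andP[_].
apply: eq_bigr => -[W U'] /= /andP[WX UY].
transitivity (\sum_(U : {set 'cV[F]_(rdim (tgt Y) + rdim (tgt X))} |
     U \in [set U in subs L0 | (lowpart U == U') && (highpart U == W)]%SET)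
   qq F ^ euler S (dimvec (src X)) (dimvec_sub U') *: g (dimvec_sub U' + dimvec_sub W)).
  apply: eq_big => [U|U].
    rewrite finset.in_set [U \in subs L0]finset.in_set xpair_eqE.
    case Us : (submod (X := L0) U) => //=; rewrite /ok.
    have [->|] := eqVneq (highpart U) W; rewrite ?andbF //= !andbT.
    by have [->|] := eqVneq (lowpart U) U'; rewrite ?andbF //= WX UY.
  move=> /andP[/andP[Us /andP[hX lY]] /eqP[hW lU]].
  by rewrite card_lifts //; have [_ _ ->] := sub_dsum tX tY Us; rewrite hW lU.
have := WX; rewrite subsDE => /andP[Ws _].
have := UY; rewrite subsDE => /andP[Us _].
have [A [C [fA [gA [pA [sA [AY UE]]]]]]] := submod_ses Us.
have [B [D [fB [gB [pB [sB [BX WE]]]]]]] := submod_ses Ws.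
have [fBh _ splB] := BX; have Bm := ses_modl BX tX.
have [fAh pAh splA] := AY; have Cm := ses_modr AY tY.
have cardE : #|[set U in subs L0 | (lowpart U == U') && (highpart U == W)]%SET| =
    #|Homs B C| by rewrite -(card_graphs AY BX) -UE -WE.
rewrite sumr_const cardE -scaler_nat scalerA.
congr (_ *: _); rewrite card_Hom natq_exp dimHom_proj //; last first.
  exact: projective_sub fBh (split_gf splB) tXp.
rewrite mulrC -exprzDr ?qq_unit //; congr (_ ^ (_ + euler _ _ _)).
  by rewrite WE (ses_image BX) (dimvec_sub_image Bm fBh (split_gf splB)).
by rewrite UE (dimvec_sub_ker tY pAh (split_ps splA)) opprB addrCA subrr addr0.
Qed.

End ConeCount.

(** * Bilinear forms *)

Section Malg.
Variables (R : comNzRingType) (K : choiceType) (W : lmodType R) (f : K -> K -> W).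

Lemma malg_bilinE (x y : {malg R[K]}) (d e : {fset K}) :
  (msupp x `<=` d)%fset -> (msupp y `<=` e)%fset ->
  malg_bilin f x y = \sum_(a <- d) \sum_(b <- e) (x@_a * y@_b) *: f a b.
Proof.
move=> xd ye; rewrite /malg_bilin.
rewrite (big_fset_incl _ xd) /=; last first.
  move=> a _ ax; rewrite big1 // => b _.
  by rewrite (mcoeff_outdom ax) mul0r scale0r.
apply: eq_bigr => a _; rewrite (big_fset_incl _ ye) //= => b _ bx.
by rewrite (mcoeff_outdom bx) mulr0 scale0r.
Qed.

Lemma malg_bilin_bilin : bilin (malg_bilin f : {malg R[K]} -> {malg R[K]} -> W).
Proof.
split=> u c x y.
  pose d := (msupp (c *: x + y) `|` (msupp x `|` msupp y))%fset.
  rewrite !(@malg_bilinE u _ (msupp u) d) //.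
  - rewrite scaler_sumr -big_split; apply: eq_bigr => a _ /=.
    rewrite scaler_sumr -big_split; apply: eq_bigr => b _ /=.
    by rewrite scalerA -scalerDl mcoeffD mcoeffZ mulrDr mulrCA.
  - by rewrite /d fsetUA fsubsetUr.
  - by rewrite /d fsetUCA fsubsetUl.
  - by rewrite /d fsubsetUl.
pose d := (msupp (c *: x + y) `|` (msupp x `|` msupp y))%fset.
rewrite !(@malg_bilinE _ u d (msupp u)) //.
- rewrite scaler_sumr -big_split; apply: eq_bigr => a _ /=.
  rewrite scaler_sumr -big_split; apply: eq_bigr => b _ /=.
  by rewrite scalerA -scalerDl mcoeffD mcoeffZ mulrDl mulrA.
- by rewrite /d fsetUA fsubsetUr.
- by rewrite /d fsetUCA fsubsetUl.
- by rewrite /d fsubsetUl.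
Qed.

Lemma malg_bilinU (a b : K) : malg_bilin f << a >> << b >> = f a b.
Proof.
rewrite (@malg_bilinE _ _ [fset a]%fset [fset b]%fset) ?msuppU_le //.
by rewrite !big_seq_fset1 !mcoeffUU mulr1 scale1r.
Qed.
End Malg.

Section BilinSum.
Variables (R : comNzRingType) (U V W : lmodType R) (f : U -> V -> W).
Hypothesis fb : bilin f.

Lemma bilin_suml (I : Type) (r : seq I) (P : pred I) (F : I -> U) w :
  f (\sum_(i <- r | P i) F i) w = \sum_(i <- r | P i) f (F i) w.
Proof.
have lin := fb.2 w.
have f0 : f 0 w = 0 by have := lin (-1) 0 0; rewrite scaler0 addr0 scaleN1r addNr.
have fD x y : f (x + y) w = f x w + f y w by have := lin 1 x y; rewrite !scale1r.
exact: (big_morph (fun x => f x w) fD f0).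
Qed.

Lemma bilin_sumr (I : Type) (r : seq I) (P : pred I) (F : I -> V) u :
  f u (\sum_(i <- r | P i) F i) = \sum_(i <- r | P i) f u (F i).
Proof.
have lin := fb.1 u.
have f0 : f u 0 = 0 by have := lin (-1) 0 0; rewrite scaler0 addr0 scaleN1r addNr.
have fD x y : f u (x + y) = f u x + f u y by have := lin 1 x y; rewrite !scale1r.
exact: (big_morph (f u) fD f0).
Qed.

Lemma bilinZl c x w : f (c *: x) w = c *: f x w.
Proof.
have lin := fb.2 w.
have f0 : f 0 w = 0 by have := lin (-1) 0 0; rewrite scaler0 addr0 scaleN1r addNr.
by have := lin c x 0; rewrite addr0 f0 addr0.
Qed.

Lemma bilinZr c u y : f u (c *: y) = c *: f u y.
Proof.
have lin := fb.1 u.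
have f0 : f u 0 = 0 by have := lin (-1) 0 0; rewrite scaler0 addr0 scaleN1r addNr.
by have := lin c y 0; rewrite addr0 f0 addr0.
Qed.
End BilinSum.

Section EulerBilinear.
Variables (F : finFieldType) (n : nat) (S : species F n).
Implicit Types a b : 'cV[int]_n.

Lemma eulerDl a a' b : euler S (a + a') b = euler S a b + euler S a' b.
Proof.
rewrite /euler -big_split; apply: eq_bigr => i _; rewrite -big_split /=.
apply: eq_bigr => j _.
by rewrite (_ : (a + a') i 0 = (a i 0%R + a' i 0%R : int)) ?[LHS]mxE // !mulrDl.
Qed.

Lemma eulerDr a b b' : euler S a (b + b') = euler S a b + euler S a b'.
Proof.
rewrite /euler -big_split; apply: eq_bigr => i _; rewrite -big_split /=.
apply: eq_bigr => j _.
by rewrite (_ : (b + b') j 0 = (b j 0%R + b' j 0%R : int)) ?[LHS]mxE //; ring.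
Qed.

Lemma eulerNl a b : euler S (- a) b = - euler S a b.
Proof.
rewrite /euler -sumrN; apply: eq_bigr => i _; rewrite -sumrN.
apply: eq_bigr => j _.
by rewrite (_ : (- a) i 0 = (- a i 0%R : int)) ?[LHS]mxE // !mulNr.
Qed.

Lemma eulerNr a b : euler S a (- b) = - euler S a b.
Proof.
rewrite /euler -sumrN; apply: eq_bigr => i _; rewrite -sumrN.
apply: eq_bigr => j _.
by rewrite (_ : (- b) j 0 = (- b j 0%R : int)) ?[LHS]mxE // mulrN mulNr.
Qed.

End EulerBilinear.

(** * The skew form on degrees *)

Section Lambda.
Variables (F : finFieldType) (n : nat) (S : species F (n + n)).
Variable Lam : 'M[int]_(n + n).
Hypothesis hskew : Lam^T = - Lam.
Hypothesis hLam : Lam *m (- Bt S) = col_mx (Dn S) 0.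
Local Notation Q := (sub_species S).
Local Notation L := (Lform Lam).
Implicit Types (a b : 'cV[int]_n) (x y : 'cV[int]_(n + n)).

Lemma LformDl x x' y : L (x + x') y = L x y + L x' y.
Proof. by rewrite /Lform linearD /= !mulmxDl mxE. Qed.

Lemma LformDr x y y' : L x (y + y') = L x y + L x y'.
Proof. by rewrite /Lform mulmxDr mxE. Qed.

Lemma LformNl x y : L (- x) y = - L x y.
Proof. by rewrite /Lform linearN /= !mulNmx mxE. Qed.

Lemma LformNr x y : L x (- y) = - L x y.
Proof. by rewrite /Lform mulmxN mxE. Qed.

Lemma Lform_skew x y : L x y = - L y x.
Proof.
rewrite /Lform -[x^T *m _ *m _]trmxK [LHS]mxE.
by rewrite !trmx_mul trmxK hskew mulNmx mulmxN mxE mulmxA.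
Qed.

Lemma Lform_Bt x b :
  L x (Bt S *m b) = - \sum_i x (lshift n i) 0 * (sdim S (lshift n i))%:Z * b i 0.
Proof.
rewrite /Lform -[Bt S]opprK mulNmx mulmxN mxE mulmxA -(mulmxA x^T) hLam.
congr (- _); rewrite -mulmxA mul_col_mx mul0mx -[x in LHS]vsubmxK tr_col_mx mul_row_col.
rewrite mulmx0 addr0 mul_diag_mx mxE; apply: eq_bigr => i _.
by rewrite !mxE mulrA.
Qed.

(** The matrix D (I - R) is the Gram matrix of the Euler form on the simples
    of Q. *)
Lemma Lform_deg a al b : L (Et' S *m a - til al) (Bt S *m b) = - euler Q a b.
Proof.
rewrite Lform_Bt /euler exchange_big /=; congr (- _); apply: eq_bigr => i _.
have -> : (Et' S *m a - til al) (lshift n i) 0 = \sum_j Et' S (lshift n i) j * a j 0.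
  rewrite [LHS]mxE [X in _ + X]mxE col_mxEu [X in - X]mxE.
  by apply: etrans (subr0 _) _; rewrite mxE.
rewrite !mulr_suml; apply: eq_bigr => j _; rewrite -Rt_euler.
rewrite (_ : Et' S _ _ = (It n (lshift n i) j - Rt S (lshift n i) j : int)); last first.
  by rewrite [LHS]mxE [X in _ + X]mxE.
ring.
Qed.

(** As B is the difference of I - R and I - R', the skew form restricts on its
    image to minus the antisymmetrized Euler form. *)
Lemma Lform_BB a b : L (Bt S *m a) (Bt S *m b) = euler Q b a - euler Q a b.
Proof.
rewrite Lform_Bt -[RHS]opprB; congr (- _).
rewrite [X in _ = X - _]exchange_big /= -sumrB; apply: eq_bigr => i _.
rewrite [(Bt S *m a) _ _]mxE !mulr_suml -sumrB; apply: eq_bigr => j _.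
rewrite -(Rt_euler S i j) -(Rt'_euler S i j).
rewrite (_ : Bt S _ _ = (Rt' S (lshift n i) j - Rt S (lshift n i) j : int)); last first.
  by rewrite [LHS]mxE [X in _ + X]mxE.
ring.
Qed.

(** The monomial of a submodule with quotient class a has degree the opposite
    of the degree of the object, shifted by B a; this computes the skew form
    on two such degrees. *)
Lemma Lform_shift ex ey al be a b :
  L (- (Et' S *m ex - til al) + Bt S *m a) (- (Et' S *m ey - til be) + Bt S *m b) =
  L (Et' S *m ex - til al) (Et' S *m ey - til be)
    + euler Q ex b - euler Q ey a + euler Q b a - euler Q a b.
Proof.
have hX := Lform_deg ex al b; have hY := Lform_deg ey be a.
set X := _ - til al in hX *; set Y := _ - til be in hY *.
clearbody X Y; rewrite LformDl !LformDr !LformNl !LformNr Lform_BB hX.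
by rewrite [L (Bt S *m a) Y]Lform_skew hY; ring.
Qed.

End Lambda.

(** * The character map *)

Lemma vv_scale (F : finFieldType) (V : lmodType (Zv F)) (j k : int) (x : V) :
  vv F ^ j *: (vv F ^ k *: x) = vv F ^ (j + k) *: x.
Proof. by rewrite scalerA exprzDr ?vv_unit. Qed.

Lemma monomial_eq (F : finFieldType) (K : choiceType) (j k : int) (x y : K) :
  j = k -> x = y -> vv F ^ j *: (<< x >> : {malg (Zv F)[K]}) = vv F ^ k *: << y >>.
Proof. by move=> -> ->. Qed.

Section Character.
Variables (F : finFieldType) (n : nat) (S : species F (n + n)).
Local Notation Q := (sub_species S).
Hypothesis hQ : acyclic Q.
Variables (MH : unitAlgType (Zv F)) (loc : {linear Hall Q -> MH}).
Hypothesis hloc : is_localization loc.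
Local Notation hom X Y f := (@is_hom F n Q X Y f).
Local Notation lc X := (loc (cl X)).
Local Notation cone X Y w := (@cone F n Q X Y w).
Local Notation Kel := (Kel loc).
Local Notation E' := (Et' S).
Local Notation E := (Et S).
Implicit Types a b c : 'cV[int]_n.

Lemma cone_ses (X Y : c2p Q) w : hom (src X) (tgt Y) w ->
  dimvec (src (cone X Y w)) = dimvec (src X) + dimvec (src Y) /\
  dimvec (tgt (cone X Y w)) = dimvec (tgt X) + dimvec (tgt Y).
Proof.
move=> wh; have [sm tm _ _ _] := cone_c2p wh.
by rewrite (dimvecD sm (ext_mid_ses _)) (dimvecD tm (ext_mid_ses _)); split; apply: addrC.
Qed.

Lemma tgt_Z (P : prj Q) : dimvec (tgt (Z_ P)) = 0.
Proof. by apply: rdim0_dimvec => //; exact: modP. Qed.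

Lemma src_C (M : mod Q) : dimvec (tgt (C_ M)) = dimvec (src (C_ M)) + dimvec M.
Proof.
have [r [p [s e]]] := C_ses hQ M.
exact: dimvecD (tgt_mod (c2pP (C_ M))) e.
Qed.

(** The object whose class is, up to some K_a, the basis element of M and P. *)
Definition std (M : mod Q) (P : prj Q) : c2p Q := dsum (C_ M) (Z_ P).

Lemma std_dim M P : dimvec (tgt (std M P)) = dimvec (tgt (C_ M)) /\
  dimvec (tgt (std M P)) - dimvec (src (std M P)) = dimvec M - dimvec P.
Proof.
have [e1 e2] := cone_ses (hom0 (src (C_ M)) (tgt (Z_ P))).
rewrite [dimvec (tgt _)]e2 [dimvec (src _)]e1 tgt_Z addr0; split=> //.
by rewrite src_C opprD addrACA subrr add0r.
Qed.

Lemma basis_std a M P : Kel a * XX loc M P =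
  Kel (a - dimvec (tgt (std M P))) * lc (std M P).
Proof.
have [-> _] := std_dim M P.
rewrite /XX /XM /XP -mulrA (loc_cl_mul hloc (hall_Z_r P (C_ M))).
by rewrite mulrA -(KelD hQ hloc).
Qed.

Lemma Kel_mul a b x y : (Kel a * x) * (Kel b * y) = Kel (a + b) * (x * y).
Proof.
rewrite (KelD hQ hloc a b); move: (Kel_comm hQ hloc b x).
by move: (Kel a) (Kel b) => ka kb e; rewrite -!mulrA [x * (_ * _)]mulrA -e -mulrA.
Qed.

Section Integral.
Variable I : {linear MH -> torus F n}.
Hypothesis hI : is_int loc I.

Lemma int_XM M : I (XM loc M) = << col_mx (dimvec M) 0 >>.
Proof.
rewrite /XM hI /til add_col_mx addNr add0r src_C addrAC subrr add0r //.
Qed.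

Lemma int_XX a N P : I (Kel a * XX loc N P) = << col_mx (dimvec N - dimvec P) a >>.
Proof.
by rewrite basis_std hI /til add_col_mx add0r subrK; have [_ ->] := std_dim N P.
Qed.
End Integral.

Variables (MM : lmodType (Zv F)) (tMM : MH -> MH -> MM)
  (TT : lmodType (Zv F)) (tTT : torus F n -> torus F n -> TT)
  (Delta : {linear MH -> MM}) (hDelta : is_Delta loc tMM Delta)
  (I : {linear MH -> torus F n}) (hI : is_int loc I)
  (II : {linear MM -> TT})
  (hII : forall x y : MH, II (tMM x y) = tTT (I x) (I y))
  (mu : {linear TT -> torus F n}) (hmu : is_mu S tTT mu).
Local Notation Psi x := (mu (II (Delta x))).

(** The monomial attached to a submodule of class u of the cokernel of an
    object of class (x1, x0). *)
Definition term x1 x0 c u : torus F n :=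
  vv F ^ euler Q (x1 - u) (x0 - u) *: << E' *m (x1 - u) - E *m (x0 - u) + til c >>.

(** The Hall numbers in the coproduct count the submodules of L according to
    their class and that of the quotient, and the two Euler exponents, from
    the coproduct and from mu, combine to the asserted one. *)
Lemma Psi_XX a (L : mod Q) (P : prj Q) : Psi (Kel a * XX loc L P) =
  \sum_(U in subs L) term (dimvec P) (dimvec L) a (dimvec_sub U).
Proof.
pose f (MN : isomod Q * isomod Q) : torus F n :=
  let m := dimvec (rep_mod MN.1) in let k := dimvec (rep_mod MN.2) in
  qq F ^ euler Q m (k - dimvec P) *:
    mu (tTT << col_mx m 0 >> << col_mx (k - dimvec P) a >>).
transitivity (\sum_(U in subs L) f (subquo_type U)).
  rewrite -fsum_fibers hDelta.
  rewrite (eq_fsbigr (fun MN => (#|[set U in subs L | subquo_type U == MN]%SET|%:R : Zv F) *: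
    (qq F ^ euler Q (dimvec (rep_mod MN.1)) (dimvec (rep_mod MN.2) - dimvec P) *:
      tMM (XM loc (rep_mod MN.1)) (Kel a * XX loc (rep_mod MN.2) P)))); last first.
    by move=> MN _; rewrite -(hallF_subquo_type MN (modP L)) /= mulrC; apply/esym; exact: scalerA.
  rewrite !fsum_fibers !linear_sum; apply: eq_bigr => U _.
  by rewrite !linearZ /= hII (int_XM hI) (int_XX hI).
apply: eq_bigr => U; rewrite finset.in_set => Us.
have [] := subquo_type_dimvec (modP L) Us.
rewrite /f => -> ->; rewrite hmu qq_exp vv_scale /term.
set l := dimvec L; set p := dimvec P; set u := dimvec_sub U.
apply: monomial_eq.
  by rewrite /seuler -[u - p]opprB !eulerNr !eulerNl; ring.
by rewrite -[u - p]opprB mulmxN opprK /til col_mx0 addr0 [X in X + _]addrC.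
Qed.

(** Decompose X by its cokernel M and kernel P; the submodules of M correspond
    to the submodules of the target containing the image of the differential,
    and u is shifted by x_0 - m, which is also x_1 - p. *)
Lemma Psi_obj c (X : c2p Q) : Psi (Kel c * lc X) =
  \sum_(U in subsD X)
    term (dimvec (src X)) (dimvec (tgt X)) (c + dimvec (tgt X)) (dimvec_sub U).
Proof.
have [M [P [p [s [ph ps pk dX ->]]]]] := loc_decomposition hQ hloc X.
have tm := tgt_mod (c2pP X).
rewrite mulrA -(KelD hQ hloc) Psi_XX.
have -> : subsD X = [set presub p V | V in subs M]%SET.
  rewrite (subs_presub tm ph ps); apply/setP=> U; rewrite subsDE [RHS]finset.in_set.
  rewrite [U \in subs _]finset.in_set; congr (_ && _).
  apply/forallP/fintype.subsetP=> [dU u|kU w].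
    by rewrite finset.in_set => /eqP /pk[w ->].
  by apply: kU; rewrite finset.in_set; apply/eqP/pk; exists w.
rewrite big_imset /=; last by move=> V V' _ _; exact: presub_inj ps V V'.
apply: eq_bigr => V; rewrite finset.in_set => Vs.
rewrite (presub_dimvec tm ph ps Vs) /term.
set v := dimvec_sub V; set x0 := dimvec (tgt X) in dX *; set x1 := dimvec (src X) in dX *.
have e0 : x0 - (v + (x0 - dimvec M)) = dimvec M - v.
  by rewrite opprD opprB addrCA [x0 + _]addrC subrK addrC.
have e1 : x1 - (v + (x0 - dimvec M)) = dimvec P - v.
  have -> : x1 = dimvec P + (x0 - dimvec M).
    by rewrite -[x1](subKr x0) -dX opprB addrCA.
  by rewrite opprD addrACA subrr addr0.
by rewrite e0 e1.
Qed.

Lemma Psi_cone c (X Y : c2p Q) w : hom (src X) (tgt Y) w ->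
  Psi (Kel c * lc (toc2p (cone X Y w))) =
  \sum_(U in subsD (cone X Y w))
    term (dimvec (src X) + dimvec (src Y)) (dimvec (tgt X) + dimvec (tgt Y))
         (c + (dimvec (tgt X) + dimvec (tgt Y))) (dimvec_sub U).
Proof.
move=> wh; rewrite Psi_obj (toc2pK (cone_c2p wh)).
by have [-> ->] := cone_ses wh.
Qed.

(** The number of homs from X_(-1) to Y_0, which makes the product of two
    classes a sum of cones, is a power of q as X_(-1) is projective; the sum
    over the cones is evaluated by cone_count. *)
Lemma Psi_mul a b (X Y : c2p Q) :
  qq F ^ euler Q (dimvec (src X)) (dimvec (tgt Y)) *:
    Psi ((Kel a * lc X) * (Kel b * lc Y)) =
  \sum_(W in subsD X) \sum_(U in subsD Y)
    qq F ^ (euler Q (dimvec (src X)) (dimvec_sub U) +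
            euler Q (dimvec_sub W) (dimvec (tgt Y) - dimvec_sub U)) *:
      term (dimvec (src X) + dimvec (src Y)) (dimvec (tgt X) + dimvec (tgt Y))
           (a + b + (dimvec (tgt X) + dimvec (tgt Y)))
           (dimvec_sub U + dimvec_sub W).
Proof.
have [sX _ sXp _ _] := c2pP X; have [_ tY _ _ _] := c2pP Y.
rewrite -cone_count -(dimHom_proj sX tY sXp) -natq_exp -card_Hom.
rewrite Kel_mul -(locM hloc); set c := (_%:R : Zv F).
transitivity (Psi (Kel (a + b) * loc (c *: hall_mul (cl X) (cl Y)))).
  by rewrite [loc (c *: _)]linearZ /= -scalerAr !linearZ.
rewrite /c hall_cl linear_sum mulr_sumr !linear_sum; apply: eq_bigr => w.
rewrite finset.in_set => wh; exact: Psi_cone wh.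
Qed.

(** The degree of a monomial in terms of the degree of the object and of the
    image of B. *)
Lemma std_term (M : mod Q) (P : prj Q) a (t := std M P) u :
  E' *m (dimvec (src t) - u) - E *m (dimvec (tgt t) - u) + til a =
  - (E' *m (dimvec M - dimvec P) - til a) + Bt S *m (dimvec (tgt t) - u).
Proof.
have [_ <-] := std_dim M P; rewrite -/t.
have -> : Bt S = E' - E by rewrite /Et /Et' /Bt opprB [RHS]addrC addrA subrK.
move: (dimvec (src t)) (dimvec (tgt t)) => x1 x0.
have -> : x1 - u = (x0 - u) - (x0 - x1) by rewrite opprB [RHS]addrC addrA subrK.
rewrite [(E' - E) *m _]mulmxBl [E' *m (_ - (x0 - x1))]mulmxBr opprB.
move: (E' *m _) (E' *m _) (E *m _) (til a) => al ga be c.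
by rewrite addrC [al - ga - be]addrAC [al - be - ga]addrC addrA.
Qed.

Lemma Psi_std a M P : Psi (Kel a * XX loc M P) =
  \sum_(U in subsD (std M P))
    term (dimvec (src (std M P))) (dimvec (tgt (std M P))) a (dimvec_sub U).
Proof. by rewrite basis_std Psi_obj subrK. Qed.

Lemma Psi_mul_std a b (M N : mod Q) (P P' : prj Q) (X := std M P) (Y := std N P') :
  qq F ^ euler Q (dimvec (src X)) (dimvec (tgt Y)) *:
    Psi ((Kel a * XX loc M P) * (Kel b * XX loc N P')) =
  \sum_(W in subsD X) \sum_(U in subsD Y)
    qq F ^ (euler Q (dimvec (src X)) (dimvec_sub U) +
            euler Q (dimvec_sub W) (dimvec (tgt Y) - dimvec_sub U)) *:
      term (dimvec (src X) + dimvec (src Y)) (dimvec (tgt X) + dimvec (tgt Y))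
           (a + b) (dimvec_sub U + dimvec_sub W).
Proof.
have eab x0 y0 : (a - x0) + (b - y0) + (x0 + y0) = a + b by rewrite addrACA !subrK.
rewrite (basis_std a M P) (basis_std b N P') Psi_mul.
by rewrite (eab (dimvec (tgt X)) (dimvec (tgt Y))).
Qed.

Variable Lam : 'M[int]_(n + n).
Hypothesis hskew : Lam^T = - Lam.
Hypothesis hLam : Lam *m (- Bt S) = col_mx (Dn S) 0.
Local Notation L := (Lform Lam).

Lemma torus_bilin : bilin (torus_mul Lam : torus F n -> torus F n -> torus F n).
Proof. exact: malg_bilin_bilin. Qed.

Lemma torus_monomials j k (x y : 'cV[int]_(n + n)) :
  torus_mul Lam (vv F ^ j *: << x >>) (vv F ^ k *: << y >>) =
  vv F ^ (j + k + L x y) *: << x + y >>.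
Proof.
rewrite (bilinZl torus_bilin) (bilinZr torus_bilin) /torus_mul malg_bilinU.
by rewrite !vv_scale.
Qed.

(** The exponents of v on the two sides agree because the skew form only sees
    the classes of the objects and of the submodules through the Euler form. *)
Lemma exponents x1 x0 y1 y0 al be w u :
  L (E' *m (x0 - x1) - til al) (E' *m (y0 - y1) - til be)
    + ((euler Q x1 u + euler Q w (y0 - u)) + (euler Q x1 u + euler Q w (y0 - u)))
    + euler Q (x1 + y1 - (u + w)) (x0 + y0 - (u + w)) =
  (euler Q x1 y0 + euler Q x1 y0)
    + (euler Q (x1 - w) (x0 - w) + euler Q (y1 - u) (y0 - u)
    + L (- (E' *m (x0 - x1) - til al) + Bt S *m (x0 - w))
        (- (E' *m (y0 - y1) - til be) + Bt S *m (y0 - u))).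
Proof.
rewrite (Lform_shift hskew hLam); move: (L _ _) => L0.
by rewrite !(eulerDl, eulerDr, eulerNl, eulerNr); ring.
Qed.

Lemma degree_sum x1 x0 y1 y0 a b u w :
  E' *m (x1 + y1 - (u + w)) - E *m (x0 + y0 - (u + w)) + til (a + b) =
  (E' *m (x1 - w) - E *m (x0 - w) + til a) + (E' *m (y1 - u) - E *m (y0 - u) + til b).
Proof.
have split_uw z z' : z + z' - (u + w) = (z - w) + (z' - u).
  by rewrite [u + w]addrC opprD addrACA.
have -> : til (a + b) = til a + til b by rewrite /til add_col_mx addr0.
rewrite !split_uw (mulmxDr E') (mulmxDr E) opprD.
by rewrite [RHS]addrACA; congr (_ + _); rewrite addrACA.
Qed.

Variable star : MH -> MH -> MH.
Hypothesis hstar : is_star loc Lam star.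

(** After scaling by the number of homs from X_(-1) to Y_0 both sides are sums
    over pairs of submodules of the two cokernels, and agree term by term: the
    degrees by additivity, the powers of v by the identity of exponents. *)
Lemma Psi_star_basis a b (M N : mod Q) (P P' : prj Q) :
  Psi (star (Kel a * XX loc M P) (Kel b * XX loc N P')) =
  torus_mul Lam (Psi (Kel a * XX loc M P)) (Psi (Kel b * XX loc N P')).
Proof.
rewrite hstar.2 !linearZ /=.
have [_ dM] := std_dim M P; have [_ dN] := std_dim N P'.
have qu : qq F ^ euler Q (dimvec (src (std M P))) (dimvec (tgt (std N P')))
  \is a GRing.unit by rewrite unitrXz ?qq_unit.
apply: (unit_scalerI qu); rewrite scalerA mulrC -scalerA.
rewrite Psi_mul_std.
rewrite !Psi_std (bilin_suml torus_bilin) !scaler_sumr; apply: eq_bigr => W _.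
rewrite (bilin_sumr torus_bilin) !scaler_sumr; apply: eq_bigr => U _.
rewrite torus_monomials !qq_exp !vv_scale.
apply: monomial_eq.
  by rewrite (std_term M P) (std_term N P') -dM -dN exponents.
exact: degree_sum.
Qed.

Lemma Psi_star x y : Psi (star x y) = torus_mul Lam (Psi x) (Psi y).
Proof.
have Psi_sum T (r : seq T) (f : T -> MH) : Psi (\sum_(t <- r) f t) = \sum_(t <- r) Psi (f t).
  by rewrite !linear_sum.
have PsiZ (k : Zv F) z : Psi (k *: z) = k *: Psi z by rewrite !linearZ.
have [r ->] := MH_span hQ hloc x; have [r' ->] := MH_span hQ hloc y.
rewrite (bilin_suml hstar.1) !Psi_sum (bilin_suml torus_bilin).
apply: eq_bigr => s _.
rewrite (bilinZl hstar.1) !PsiZ (bilinZl torus_bilin).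
rewrite (bilin_sumr hstar.1) !Psi_sum (bilin_sumr torus_bilin) !scaler_sumr.
apply: eq_bigr => t _.
by rewrite (bilinZr hstar.1) !PsiZ (bilinZr torus_bilin) Psi_star_basis.
Qed.

(** K_a is its product with the class of the zero object, whose cokernel has a
    single submodule. *)
Lemma Psi_Kel a : Psi (Kel a) = << til a >>.
Proof.
rewrite -[Kel a]mulr1 -(loc1 hloc) Psi_obj.
have z0 : dimvec (tgt (Z_ (prj0 Q))) = 0 by exact: tgt_Z.
have -> : subsD (Z_ (prj0 Q)) = [set [set: 'cV[F]_(rdim (tgt (Z_ (prj0 Q))))]]%SET.
  apply/setP=> U; rewrite subsDE finset.in_set1.
  have flat (u w : 'cV[F]_(rdim (tgt (Z_ (prj0 Q))))) : u = w.
    by apply/matrixP; case.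
  apply/andP/eqP=> [[/submodP[[U0 _] _] _]|->].
    by apply/setP=> u; rewrite finset.in_set (flat u 0).
  by split; [apply/submodP; split; [split|]|apply/forallP] => *; rewrite finset.in_set.
rewrite big_set1 -/(dimvec _) !z0 addr0 /term subrr.
have -> : euler Q 0 0 = 0 by rewrite /euler big1 // => i _; rewrite big1 // => j _; rewrite !mxE mul0r.
by rewrite expr0z scale1r !mulmx0 subrr add0r.
Qed.

(** Group the submodules of M by their class. *)
Lemma Psi_Gr (M : mod Q) (P : prj Q) : Psi (XX loc M P) =
  \sum_(e \in [set: 'cV[int]_n])
    (vv F ^ euler Q (dimvec P - e) (dimvec M - e) * #|Gr M e|%:R) *:
      << E' *m (dimvec P - e) - E *m (dimvec M - e) >>.
Proof.
rewrite -[XX loc M P]mul1r -(Kel0 hQ hloc) Psi_XX -fsum_fibers.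
apply: eq_fsbigr => e _.
have -> : Gr M e = [set U in subs M | dimvec_sub U == e]%SET.
  by apply/setP=> U; rewrite !finset.in_set.
by rewrite /term /til col_mx0 addr0 scalerA mulrC.
Qed.

End Character.

Theorem theorem6p6 (F : finFieldType) (n : nat) (S : species F (n + n))
  (Q := sub_species S) (hQ : acyclic Q)
  (Lam : 'M[int]_(n + n)) (hskew : Lam^T = - Lam)
  (hLam : Lam *m (- Bt S) = col_mx (Dn S) 0)
  (MH : unitAlgType (Zv F)) (loc : {linear Hall Q -> MH})
  (hloc : is_localization loc)
  (MM : lmodType (Zv F)) (tMM : MH -> MH -> MM) (hMM : is_tensor tMM)
  (TT : lmodType (Zv F)) (tTT : torus F n -> torus F n -> TT)
  (hTT : is_tensor tTT)
  (star : MH -> MH -> MH) (hstar : is_star loc Lam star)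
  (Delta : {linear MH -> MM}) (hDelta : is_Delta loc tMM Delta)
  (I : {linear MH -> torus F n}) (hI : is_int loc I)
  (II : {linear MM -> TT})
  (hII : forall x y : MH, II (tMM x y) = tTT (I x) (I y))
  (mu : {linear TT -> torus F n}) (hmu : is_mu S tTT mu)
  (Psi := fun x : MH => mu (II (Delta x))) :
  [/\ linear Psi,
      Psi 1 = << 0 >>,
      forall x y : MH, Psi (star x y) = torus_mul Lam (Psi x) (Psi y),
      forall a : 'cV[int]_n, Psi (Kel loc a) = << til a >> &
      forall (M : mod Q) (P : prj Q),
        Psi (XX loc M P) =
        \sum_(e \in [set: 'cV[int]_n])
          (vv F ^ euler Q (dimvec P - e) (dimvec M - e) * #|Gr M e|%:R) *:
            << Et' S *m (dimvec P - e) - Et S *m (dimvec M - e) >>].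
Proof.
have PsiE x : Psi x = mu (II (Delta x)) by [].
split.
- by move=> k x y; rewrite !PsiE !linearP.
- rewrite -(Kel0 hQ hloc) PsiE (Psi_Kel hQ hloc hDelta hI hII hmu).
  by rewrite /til col_mx0.
- move=> x y; rewrite !PsiE.
  exact: (Psi_star hQ hloc hDelta hI hII hmu hskew hLam hstar).
- by move=> a; rewrite PsiE (Psi_Kel hQ hloc hDelta hI hII hmu).
- by move=> M P; rewrite PsiE; exact: (Psi_Gr hQ hloc hDelta hI hII hmu).
Qed.
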